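(* Let $0<r<1$ and let $(\epsilon_k)_{k\ge1}$ be a sequence of positive real numbers with $\epsilon_{k+1}\le r\epsilon_k$ for all $k$. Then for $1<p<\infty$ and for any $f\in L^p(\mathbb{R})$, the series $\sum_{k=1}^\infty\left(D_{\epsilon_{k+1}}f-D_{\epsilon_k}f\right)$ is unconditionally convergent in $L^p(\mathbb{R})$.
   Context: For $\epsilon>0$, $D_\epsilon f=\varphi_\epsilon*f$ with $\varphi_\epsilon=\frac1{2\epsilon}1_{[-\epsilon,\epsilon]}$. A series $\sum_{k=1}^\infty f_k$ in a Banach space is unconditionally convergent if $\sum_{k=1}^\infty f_{\pi(k)}$ converges in norm for every permutation $\pi$ of $\{1,2,3,\dots\}$. *)

(* Defs.v *)
From HB Require Import structures.
From mathcomp Require Import all_boot all_order all_algebra.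
From mathcomp Require Import complex.
From mathcomp Require Import all_classical all_reals all_analysis.
Set Implicit Arguments.
Unset Strict Implicit.
Unset Printing Implicit Defensive.
Import Order.TTheory GRing.Theory Num.Theory.
Import numFieldNormedType.Exports.
Local Open Scope classical_set_scope.
Local Open Scope complex_scope.
Local Open Scope ring_scope.

(* The library has no measurable or integral structure on R[i]: both are taken
   componentwise.  [complex.Re]/[complex.Im] and [normc] are the R-valued real
   part, imaginary part and modulus (whereas [`|z|] lives in R[i]). *)
Notation normc := ComplexField.Normc.normc.

Definition cmeasurable (R : realType) (f : measurableTypeR R -> R[i]) : Prop :=
  measurable_fun [set: measurableTypeR R] (fun x => complex.Re (f x)) /\
  measurable_fun [set: measurableTypeR R] (fun x => complex.Im (f x)).

Definition cintegral (R : realType) (f : measurableTypeR R -> R[i]) : R[i] :=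
  (\int[@lebesgue_measure R]_x complex.Re (f x)) +i*
  (\int[@lebesgue_measure R]_x complex.Im (f x)).

Definition cLnorm (R : realType) (p : R) (f : measurableTypeR R -> R[i])
    : \bar R :=
  ('N[@lebesgue_measure R]_(p%:E)[EFin \o (@normc R \o f)])%E.

(* Elements of L^p(R) are represented by functions, [cLnorm] being the usual
   norm on classes modulo a.e. equality. *)
Definition cLfun (R : realType) (p : R) : set (measurableTypeR R -> R[i]) :=
  [set f | cmeasurable f /\ (cLnorm p f < +oo)%E].

Definition convolution (R : realType) (g f : measurableTypeR R -> R[i])
    : measurableTypeR R -> R[i] :=
  fun x => cintegral (fun y => g (x - y) * f y).

Definition phi (R : realType) (e : R) : measurableTypeR R -> R[i] :=
  fun x => ((2 * e)^-1 * \1_(`[- e, e]) x)%:C.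

Definition D (R : realType) (e : R) (f : measurableTypeR R -> R[i])
    : measurableTypeR R -> R[i] :=
  convolution (phi e) f.

Definition convergent_in_Lp (R : realType) (p : R)
    (u : nat -> measurableTypeR R -> R[i]) : Prop :=
  exists2 g, cLfun p g & cLnorm p (u n - g) @[n --> \oo] --> 0%E.

Definition unconditionally_convergent_in_Lp (R : realType) (p : R)
    (u : nat -> measurableTypeR R -> R[i]) : Prop :=
  (forall k, cLfun p (u k)) /\
  (forall pi : nat -> nat, bijective pi ->
     convergent_in_Lp p (series (u \o pi))).

(* Main.v *)
Require Import Defs.
From HB Require Import structures.
From mathcomp Require Import all_boot all_order all_algebra.
From mathcomp Require Import complex.
From mathcomp Require Import all_classical all_reals all_analysis.
From mathcomp Require Import measurable_realfun.
From mathcomp Require Import ring lra zify.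

(** Write D_e f for the average of f over [x - e, x + e].  Everything rests on
    a bound for the lacunary transforms
    T_a f = sum_(k < s) a_k (D_(eps_(k+1)) f - D_(eps_k) f), |a_k| <= 1,
    on L^p, with a constant that depends on r and p only
    ([Avg_transform_bound]).

    Unconditional convergence follows from this bound.  Transforms whose
    coefficients vanish for k < M tend to 0 as M grows, uniformly in the other
    coefficients ([Avg_transform_tail]): split f = (f - D_d f) + D_d f.  The
    first part is small in L^p when d is small ([Avg_cvg_Lp]), hence so is its
    transform; on the second part an average of radius e << d changes nothing
    but an amount of order e / d ([Avg_smooth]), and these amounts are summable
    because eps is lacunary.  A partial sum of a rearranged series differs from
    a partial sum of the telescoping series by such a tail, so every
    rearrangement converges to f - D_(eps_0) f ([rearranged_cvg]).  A
    complex-valued f is treated through its real and imaginary parts.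

    The bound on transforms is obtained by transference from the cyclic groups
    Z/2^n.  An interval of length (2m+1)h is a union of 2m+1 intervals of
    length h ([Avg_commensurable]), so along x + hZ the transform with radii
    (2m_k+1)h/2 is a lacunary transform on a cyclic group large enough for the
    windows not to wrap around it ([commensurable_bound]).  Arbitrary radii are
    limits of commensurable ones, and Fatou's lemma passes to the limit.

    On the cyclic group ([discrete_Lp_bound]) the case p = 2 is a statement
    about commuting symmetric operators B_k, the differences of consecutive
    averages, with ||B_j B_k|| decaying geometrically in |j - k|
    ([almost_orthogonal_sum]).  For p > 2 the transform is compared with the
    martingale of dyadic blocks: its mean oscillation over a block is dominated
    by a maximal function of f^2 ([oscillation]), by the l2 bound at the scales
    shorter than the block and by slow variation at the longer ones.  A
    martingale version of the Fefferman-Stein inequality ([sharp_maximal]) and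
    Doob's inequality ([doob_maximal]) turn this into the bound on L^p.  The
    case p < 2 follows by duality, the transform being symmetric. *)

Set Implicit Arguments.
Unset Strict Implicit.
Unset Printing Implicit Defensive.
Import Order.TTheory GRing.Theory Num.Theory.
Import numFieldNormedType.Exports.
Local Open Scope classical_set_scope.
Local Open Scope complex_scope.
Local Open Scope ring_scope.

(** * Power inequalities *)

Lemma powR_le (R : realType) (p a b : R) :
  0 <= p -> 0 <= a -> a <= b -> a `^ p <= b `^ p.
Proof.
move=> p0 a0 ab; apply: ge0_ler_powR => //; rewrite nnegrE //.
exact: le_trans ab.
Qed.

Lemma powR_splitD (R : realType) (a s t : R) :
  0 < s + t -> a `^ (s + t) = a `^ s * a `^ t.
Proof. by move=> st; rewrite powRD // gt_eqF. Qed.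

(** If b^t <= d a^t the first term alone suffices; otherwise a is at most a
    multiple of b and the second one does. *)
Lemma young_powR (R : realType) (s t d : R) : 0 <= s -> 0 < t -> 0 < d ->
  exists2 C : R, 0 < C & forall a b, 0 <= a -> 0 <= b ->
    a `^ s * b `^ t <= d * a `^ (s + t) + C * b `^ (s + t).
Proof.
move=> s0 t0 d0; have st0 : 0 < s + t by lra.
have K0 : 0 < (d^-1) `^ (t^-1) by rewrite powR_gt0 // invr_gt0.
exists (((d^-1) `^ (t^-1)) `^ s); first exact: powR_gt0.
move=> a b a0 b0; have [bt|] := leP (b `^ t) (d * a `^ t).
  apply: (@le_trans _ _ (d * a `^ (s + t))).
    rewrite powR_splitD // [leRHS]mulrCA; exact: ler_wpM2l (powR_ge0 _ _) _ _ bt.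
  by rewrite lerDl mulr_ge0 ?powR_ge0.
move=> /ltW abt.
have ab : a <= d^-1 `^ t^-1 * b.
  have -> : a = (a `^ t) `^ (t^-1) by rewrite -powRrM mulfV ?gt_eqF // powRr1.
  have -> : d^-1 `^ t^-1 * b = d^-1 `^ t^-1 * (b `^ t) `^ (t^-1) by rewrite -powRrM mulfV ?gt_eqF // powRr1.
  rewrite -powRM ?invr_ge0 ?powR_ge0 ?(ltW d0) //; apply: powR_le.
  - by rewrite invr_ge0 ltW.
  - exact: powR_ge0.
  - by rewrite ler_pdivlMl.
have := powR_le s0 a0 ab; rewrite powRM ?(ltW K0) // => as_le.
apply: (@le_trans _ _ ((d^-1 `^ t^-1) `^ s * b `^ (s + t))).
  by rewrite powR_splitD // mulrA; apply: ler_wpM2r as_le; exact: powR_ge0.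
by rewrite lerDr mulr_ge0 ?powR_ge0 ?ltW.
Qed.

Lemma subr_expr_le (R : realType) (u : R) (n : nat) : 0 <= u -> u <= 1 ->
  1 - u ^+ n <= n%:R * (1 - u).
Proof.
move=> u0 u1; elim: n => [|n IH]; first by rewrite expr0 subrr mul0r.
have un1 : u ^+ n <= 1 by exact: exprn_ile1.
rewrite exprS -natr1; have := ler_wpM2l u0 IH; have n0 : 0 <= n%:R :> R by [].
by nra.
Qed.

(** The inequality that makes Doob's maximal inequality telescope.  With
    t = a / b and u = t^(q-1) it reads 1 - t u <= K (1 - u), and it holds
    because u^M <= t for any integer M >= 1 / (q - 1). *)
Lemma powR_increment (R : realType) (q : R) : 1 < q ->
  exists2 K : R, 1 <= K & forall a b, 0 <= a -> a <= b ->
    b `^ q - a `^ q <= K * (b * (b `^ (q - 1) - a `^ (q - 1))).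
Proof.
move=> q1; have q10 : 0 < q - 1 by lra.
have [M HM] : exists M : nat, (q - 1)^-1 <= M%:R.
  exists (Num.truncn (q - 1)^-1).+1; exact/ltW/truncnS_gt.
exists M.+1%:R; first by rewrite ler1n.
move=> a b a0 ab; have [b0|b0] := leP b 0.
  have -> : b = 0 by lra.
  have -> : a = 0 by lra.
  by rewrite subrr mul0r mulr0.
pose t := a / b; have at_ : a = t * b by rewrite /t divfK ?gt_eqF.
have t0 : 0 <= t by rewrite divr_ge0 // ltW.
have t1 : t <= 1 by rewrite ler_pdivrMr // mul1r.
pose u := t `^ (q - 1).
have u0 : 0 <= u by exact: powR_ge0.
have u1 : u <= 1 by have := powR_le (ltW q10) t0 t1; rewrite powR1.
have tu : u ^+ M <= t.
  have [tz|tn0] := eqVneq t 0.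
    rewrite /u tz powR0 ?gt_eqF // expr0n; move: HM.
    by case: (M) => [|//]; rewrite leNgt invr_gt0 q10.
  have tp : 0 < t by rewrite lt_neqAle eq_sym tn0.
  rewrite /u -powR_mulrn ?powR_ge0 // -powRrM -[leRHS]powRr1 //.
  by apply: ger_powR; [rewrite tp|rewrite -ler_pdivrMl ?mulr1].
have main : 1 - t * u <= M.+1%:R * (1 - u).
  apply: le_trans (subr_expr_le M.+1 u0 u1); rewrite exprSr; nra.
have -> : a `^ q = t * u * b `^ q.
  by rewrite at_ powRM ?(ltW b0) // -(mulr_powRB1 t0) //; lra.
have -> : a `^ (q - 1) = u * b `^ (q - 1) by rewrite at_ powRM ?(ltW b0).
rewrite -(mulr_powRB1 (ltW b0)); last lra.
have bq : 0 <= b * b `^ (q - 1) by rewrite mulr_ge0 ?powR_ge0 // ltW.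
have := ler_wpM2r bq main; nra.
Qed.

Lemma expR_taylor2 (R : realType) (u : R) :
  expR u <= 1 + u + u ^+ 2 * expR `|u|.
Proof.
have h1 := expR_ge1Dx u; have h2 := expR_ge1Dx (- u).
have e0 := expR_gt0 u; have := expRN u => eN.
have h3 : expR u - 1 <= u * expR u.
  rewrite eN in h2; have : (1 - u) * expR u <= 1.
    by rewrite -ler_pdivlMr // mul1r; lra.
  by lra.
have [u0|u0] := leP 0 u.
  by rewrite ger0_norm //; nra.
have e1 : 1 <= expR `|u| by rewrite -expR0 ler_expR.
nra.
Qed.

(** Taylor's formula at order 2, with the second derivative bounded through m.
    If |a| <= 2 |d|, each term is at most a multiple of m^(p-2) d^2; otherwise
    d = u a with |u| < 1/2, and |1 + u|^p <= exp(p u). *)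
Lemma powR_taylor2 (R : realType) (p : R) : 2 <= p ->
  exists2 C : R, 0 < C & forall a d m : R, `|a| <= m -> `|a + d| <= m ->
    `|a + d| `^ p <= `|a| `^ p + p * (`|a| `^ (p - 2) * a) * d
                     + C * (m `^ (p - 2) * d ^+ 2).
Proof.
move=> p2; pose E := expR p; have E0 : 0 < E by exact: expR_gt0.
have sq (x : R) : `|x| `^ p = `|x| `^ (p - 2) * x ^+ 2.
  have -> : p = (p - 2) + 2 by lra.
  rewrite powR_splitD; last lra.
  by rewrite powR_mulrn // real_normK ?num_real // addrK.
have pE : 0 <= p ^+ 2 * E by rewrite mulr_ge0 ?sqr_ge0 // ltW.
exists (9 + 2 * p + p ^+ 2 * E); first by lra.
move=> a d m am adm.
have m0 : 0 <= m by exact: le_trans am.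
have mp0 : 0 <= m `^ (p - 2) by exact: powR_ge0.
have ap : `|a| `^ (p - 2) <= m `^ (p - 2) by apply: powR_le => //; lra.
have ap0 : 0 <= `|a| `^ (p - 2) by exact: powR_ge0.
have adp : `|a + d| `^ (p - 2) <= m `^ (p - 2) by apply: powR_le => //; lra.
have mdd : 0 <= m `^ (p - 2) * d ^+ 2 by rewrite mulr_ge0 ?sqr_ge0.
have [ad|ad] := leP `|a| (2 * `|d|).
  rewrite !sq.
  have s1 : (a + d) ^+ 2 <= 9 * d ^+ 2.
    rewrite -(real_normK (num_real (a + d))) -(real_normK (num_real d)).
    have := ler_normD a d; have := normr_ge0 (a + d); have := normr_ge0 d; nra.
  have s2 : - (a * d) <= 2 * d ^+ 2.
    rewrite -(real_normK (num_real d)).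
    have : - (a * d) <= `|a| * `|d| by rewrite -normrM ler_normr lexx orbT.
    have := normr_ge0 d; nra.
  have t1 : `|a + d| `^ (p - 2) * (a + d) ^+ 2 <= 9 * (m `^ (p - 2) * d ^+ 2).
    rewrite [leRHS]mulrCA; apply: ler_pM => //.
    exact: sqr_ge0.
  have t2 : - (p * (`|a| `^ (p - 2) * a) * d) <= 2 * p * (m `^ (p - 2) * d ^+ 2).
    have -> : - (p * (`|a| `^ (p - 2) * a) * d) = p * (`|a| `^ (p - 2) * - (a * d)) by ring.
    have -> : 2 * p * (m `^ (p - 2) * d ^+ 2) = p * (m `^ (p - 2) * (2 * d ^+ 2)) by ring.
    apply: ler_wpM2l; first lra.
    apply: (@le_trans _ _ (`|a| `^ (p - 2) * (2 * d ^+ 2))); first exact: ler_wpM2l.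
    by apply: ler_wpM2r => //; have := sqr_ge0 d; lra.
  have t3 : 0 <= `|a| `^ (p - 2) * a ^+ 2 by rewrite mulr_ge0 ?sqr_ge0.
  have t4 : 0 <= p ^+ 2 * E * (m `^ (p - 2) * d ^+ 2) by rewrite mulr_ge0.
  lra.
have a0 : a != 0 by rewrite -normr_gt0; apply: le_lt_trans ad; have := normr_ge0 d; lra.
pose u := d / a; have du : d = u * a by rewrite /u divfK.
have au : `|u| < 2^-1.
  rewrite /u normrM normfV ltr_pdivrMr ?normr_gt0 //; lra.
have /ltr_normlP [u1 u2] := au.
have b1 : `|1 + u| `^ p <= 1 + p * u + p ^+ 2 * E * u ^+ 2.
  rewrite ger0_norm; last lra.
  rewrite /powR gt_eqF; last lra.
  apply: (@le_trans _ _ (expR (p * u))).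
    rewrite ler_expR; apply: ler_wpM2l; first lra.
    by have := @le_ln1Dx R u; apply; lra.
  apply: le_trans (expR_taylor2 _) _; rewrite lerD2l exprMn.
  rewrite [leRHS]mulrAC; apply: ler_wpM2l.
    by rewrite mulr_ge0 ?sqr_ge0.
  rewrite ler_expR normrM ger0_norm; last lra.
  by rewrite -[leRHS]mulr1; apply: ler_wpM2l; lra.
have -> : `|a + d| `^ p = `|a| `^ p * `|1 + u| `^ p.
  by rewrite -powRM // -normrM; congr (`|_| `^ p); rewrite du; ring.
apply: le_trans (ler_wpM2l (powR_ge0 _ _) b1) _.
have -> : `|a| `^ p * (1 + p * u + p ^+ 2 * E * u ^+ 2) =
  `|a| `^ p + p * (`|a| `^ (p - 2) * a) * d + p ^+ 2 * E * (`|a| `^ (p - 2) * d ^+ 2).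
  rewrite sq du; ring.
rewrite lerD2l; apply: (@le_trans _ _ (p ^+ 2 * E * (m `^ (p - 2) * d ^+ 2))).
  apply: ler_wpM2l => //.
  by apply: ler_wpM2r => //; exact: sqr_ge0.
by apply: ler_wpM2r => //; lra.
Qed.

(** The tangent line of the convex function a^q at A, whence Jensen's inequality
    by averaging over a with A the mean. *)
Lemma young_powR_exact (R : realType) (q A a : R) : 1 < q -> 0 <= A -> 0 <= a ->
  A `^ (q - 1) * a <= (1 - q^-1) * A `^ q + q^-1 * a `^ q.
Proof.
move=> q1 A0 a0; have q10 : 0 < q - 1 by lra.
have q0 : 0 < q by lra.
have := @conjugate_powR R (A `^ (q - 1)) a (q / (q - 1)) q (powR_ge0 _ _) a0.
rewrite divr_gt0 // q0 invf_div => /(_ isT isT).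
have -> : (q - 1) / q + q^-1 = 1 by field; rewrite gt_eqF.
have -> : (A `^ (q - 1)) `^ (q / (q - 1)) = A `^ q.
  by rewrite -powRrM mulrCA mulfV ?gt_eqF // mulr1.
move=> /(_ erefl); have -> : A `^ q * ((q - 1) / q) = (1 - q^-1) * A `^ q by field; rewrite gt_eqF.
by rewrite [a `^ q / q]mulrC.
Qed.

Lemma power_mean (R : realType) (I : finType) (q : R) (a : I -> R) : 1 < q ->
  (0 < #|I|)%N -> (forall i, 0 <= a i) ->
  ((\sum_i a i) / #|I|%:R) `^ q <= (\sum_i a i `^ q) / #|I|%:R.
Proof.
move=> q1 I0 a0; have q0 : 0 < q by lra.
have N0 : 0 < #|I|%:R :> R by rewrite ltr0n.
set A := _ / _; have A0 : 0 <= A by rewrite divr_ge0 // sumr_ge0.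
have h : A `^ q <= (1 - q^-1) * A `^ q + q^-1 * ((\sum_i a i `^ q) / #|I|%:R).
  rewrite -{1}(mulr_powRB1 A0 q0) mulrC {2}/A mulrA ler_pdivrMr // mulr_sumr.
  apply: le_trans (ler_sum _ (fun i _ => young_powR_exact q1 A0 (a0 i))) _.
  rewrite big_split /= sumr_const -mulr_sumr -[X in X + _ <= _]mulr_natr.
  by rewrite [leRHS]mulrDl -[X in _ <= _ + X]mulrA divfK ?gt_eqF.
have qi : 0 < q^-1 by rewrite invr_gt0.
by rewrite -(ler_pM2l qi); lra.
Qed.

(** The tangent line at the weighted mean, summed with the weights. *)
Lemma jensen_sum (R : realType) (n : nat) (p : R) (w y : nat -> R) : 1 < p ->
  (forall k, 0 <= w k) -> (forall k, 0 <= y k) ->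
  (\sum_(k < n) w k * y k) `^ p <= (\sum_(k < n) w k) `^ (p - 1) * \sum_(k < n) w k * y k `^ p.
Proof.
move=> p1 w0 y0; have p0 : 0 < p by lra.
set W := \sum_(k < n) w k; set S := \sum_(k < n) w k * y k.
have W0 : 0 <= W by rewrite sumr_ge0.
have S0 : 0 <= S by rewrite sumr_ge0 // => k _; rewrite mulr_ge0.
have [WE|Wn] := eqVneq W 0.
  have -> : S = 0.
    apply/eqP; rewrite psumr_eq0 => [|k _]; last by rewrite mulr_ge0.
    have := WE; move/eqP; rewrite psumr_eq0 // => /allP H.
    by apply/allP => k kin; have /= /eqP -> := H k kin; rewrite mul0r.
  rewrite powR0 ?gt_eqF // mulr_ge0 ?powR_ge0 // sumr_ge0 // => k _.
  by rewrite mulr_ge0 // powR_ge0.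
have Wp : 0 < W by rewrite lt_neqAle eq_sym Wn.
pose A := S / W; have A0 : 0 <= A by rewrite divr_ge0.
have SE : S = W * A by rewrite /A mulrC divfK.
have H : A `^ (p - 1) * S <= (1 - p^-1) * A `^ p * W + p^-1 * \sum_(k < n) w k * y k `^ p.
  rewrite /S /W !mulr_sumr -big_split /=; apply: ler_sum => k _.
  have := ler_wpM2l (w0 k) (young_powR_exact p1 A0 (y0 k)); lra.
have SA : A `^ (p - 1) * S = A `^ p * W.
  by rewrite SE mulrCA [A `^ _ * A]mulrC mulr_powRB1 // mulrC.
rewrite SA in H.
have pi : 0 < p^-1 by rewrite invr_gt0.
have H2 : A `^ p * W <= \sum_(k < n) w k * y k `^ p.
  by rewrite -(ler_pM2l pi); move: H; set T := \sum_(k < n) _; lra.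
rewrite [X in X `^ p <= _]SE powRM // -[W `^ p]mulr_powRB1 // -mulrA mulrCA.
by apply: ler_wpM2l; rewrite ?powR_ge0 // mulrC.
Qed.

Lemma powR_lipschitz (R : realType) (p a b M : R) : 1 < p -> 0 <= a -> a <= M -> 0 <= b -> b <= M ->
  `|a `^ p - b `^ p| <= p * M `^ (p - 1) * `|a - b|.
Proof.
move=> p1; have p0 : 0 < p by lra.
have H x y : 0 <= x -> x <= M -> 0 <= y -> y <= x ->
    x `^ p - y `^ p <= p * M `^ (p - 1) * (x - y).
  move=> x0 xM y0 yx; have := young_powR_exact p1 x0 y0.
  have xp : x `^ p = x * x `^ (p - 1) by rewrite mulr_powRB1.
  have : x `^ (p - 1) <= M `^ (p - 1) by apply: powR_le => //; lra.
  set X := x `^ (p - 1); set Y := y `^ p => XM yg.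
  have : p * (X * y) <= p * ((1 - p^-1) * x `^ p + p^-1 * Y) by rewrite ler_pM2l.
  have -> : p * ((1 - p^-1) * x `^ p + p^-1 * Y) = p * x `^ p - x `^ p + Y.
    by field; rewrite gt_eqF.
  have : p * (X * (x - y)) <= p * (M `^ (p - 1) * (x - y)).
    by rewrite ler_pM2l // ler_wpM2r // subr_ge0.
  by rewrite -/X in xp; rewrite xp; lra.
move=> a0 aM b0 bM; have [ab|ba] := leP a b.
  rewrite distrC [`|a - b|]distrC !ger0_norm ?subr_ge0 //; first exact: H.
  by apply: powR_le => //; lra.
have ba' : b <= a by lra.
rewrite !ger0_norm ?subr_ge0 //; first exact: H.
by apply: powR_le => //; lra.
Qed.

Lemma powR_normD_le (R : realType) (a b p : R) : 0 <= p ->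
  `|a + b| `^ p <= 2 `^ p * (`|a| `^ p + `|b| `^ p).
Proof.
move=> p0; wlog ba : a b / `|b| <= `|a|.
  by move=> H; have [/H//|/ltW/H] := leP `|b| `|a|; rewrite addrC [X in _ * X]addrC.
have le2 : `|a + b| <= 2 * `|a|.
  by apply: le_trans (ler_normD _ _) _; lra.
apply: le_trans (powR_le p0 _ le2) _ => //.
by rewrite powRM // ler_wpM2l ?powR_ge0 // lerDl powR_ge0.
Qed.

Lemma powR_sqrt (R : realType) (u p : R) : 0 <= u -> Num.sqrt u `^ p = u `^ (p / 2).
Proof. by move=> u0; rewrite -powR12_sqrt // -powRrM mulrC. Qed.

Lemma sqr_powR_half (R : realType) (u p : R) : (u ^+ 2) `^ (p / 2) = `|u| `^ p.
Proof. by rewrite -powR_sqrt ?sqr_ge0 // sqrtr_sqr. Qed.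

(** * Martingales on finite sets *)

(** Conditional expectation of f, for the uniform measure, given the partition
    of G into the level sets of [blk t]. *)
Definition cexp (R : realType) (G : finType) (blk : nat -> G -> nat) (t : nat)
    (f : G -> R) (x : G) : R :=
  (\sum_(y | blk t y == blk t x) f y) / #|[pred y | blk t y == blk t x]|%:R.

Definition adapted (R : realType) (G : finType) (blk : nat -> G -> nat)
    (t : nat) (phi : G -> R) :=
  forall x y, blk t x = blk t y -> phi x = phi y.

Definition refining (G : finType) (blk : nat -> G -> nat) :=
  forall t x y, blk t.+1 x = blk t.+1 y -> blk t x = blk t y.

(** Regularity of the filtration: passing from a block to the next finer one
    around the same point loses at most half of its elements. *)
Definition doubling (G : finType) (blk : nat -> G -> nat) := forall t x,
  (#|[pred y | blk t y == blk t x]| <= 2 * #|[pred y | blk t.+1 y == blk t.+1 x]|)%N.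

Fixpoint runmax (R : realType) (G : Type) (u : nat -> G -> R) (t : nat) (x : G) : R :=
  if t is s.+1 then Num.max (runmax u s x) (u s.+1 x) else u 0 x.

Section filtration.
Variables (R : realType) (G : finType) (blk : nat -> G -> nat).
Implicit Types (f g w phi : G -> R) (t : nat).
Local Notation E := (cexp blk).

Lemma card_block_gt0 t x : 0 < #|[pred y | blk t y == blk t x]|%:R :> R.
Proof. by rewrite ltr0n; apply/card_gt0P; exists x; rewrite inE. Qed.

Lemma cexp_adapted t f : adapted blk t (cexp blk t f).
Proof.
move=> x y xy; rewrite /cexp xy; congr (_ / _).
Qed.

(** Testing against a function that is constant on blocks does not see the
    averaging over blocks: the defining property of conditional expectation. *)
Lemma cexp_dual t f phi : adapted blk t phi ->
  \sum_x phi x * cexp blk t f x = \sum_x phi x * f x.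
Proof.
move=> mphi.
under eq_bigr => x _ do rewrite /cexp mulrC.
under eq_bigr => x _ do rewrite -mulrA mulr_suml.
rewrite (exchange_big_dep predT) //=.
apply: eq_bigr => y _.
have c0 := card_block_gt0 t y.
rewrite (eq_bigr (fun=> phi y * f y / #|[pred z | blk t z == blk t y]|%:R)); last first.
  move=> x /eqP xy; rewrite (mphi _ _ (esym xy)) xy; ring.
rewrite sumr_const (_ : #|_| = #|[pred z | blk t z == blk t y]|); last first.
  by apply: eq_card => z; rewrite !inE eq_sym.
rewrite -[LHS]mulr_natr.
by rewrite divfK // gt_eqF.
Qed.

Lemma cexp_ge0 t f x : (forall y, 0 <= f y) -> 0 <= cexp blk t f x.
Proof. by move=> f0; rewrite /cexp divr_ge0 // sumr_ge0. Qed.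

Lemma cexp_norm t f x : `|cexp blk t f x| <= cexp blk t (fun y => `|f y|) x.
Proof.
rewrite /cexp normrM normfV [X in _ / X]ger0_norm //.
by apply: ler_wpM2r; [rewrite invr_ge0|exact: ler_norm_sum].
Qed.

Lemma cexp_full t f x : (forall y z, blk t y = blk t z -> y = z) ->
  cexp blk t f x = f x.
Proof.
move=> inj; rewrite /cexp (big_pred1 x).
  rewrite (_ : #|_| = 1%N) ?divr1 //; rewrite -(card1 x); apply: eq_card => y.
  by rewrite !inE; apply/eqP/eqP => [/inj|->].
by move=> y /=; apply/eqP/eqP => [/inj|->].
Qed.

Hypothesis blkS : refining blk.

Lemma adaptedS t phi : adapted blk t phi -> adapted blk t.+1 phi.
Proof. by move=> m x y /blkS; exact: m. Qed.

Lemma cexp_doubling t f x : doubling blk -> (forall y, 0 <= f y) ->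
  cexp blk t.+1 f x <= 2 * cexp blk t f x.
Proof.
move=> dbl f0; rewrite /cexp.
have c1 := card_block_gt0 t x; have c2 := card_block_gt0 t.+1 x.
rewrite ler_pdivrMr //.
set S := \sum_(y | blk t y == _) f y.
have S0 : 0 <= S by exact: sumr_ge0.
apply: (@le_trans _ _ S).
  rewrite /S [leRHS](bigID (fun y => blk t.+1 y == blk t.+1 x)) /=.
  rewrite -[leLHS]addr0; apply: lerD; last exact: sumr_ge0.
  rewrite le_eqVlt; apply/orP; left; apply/eqP/eq_bigl => y; case: (blk t.+1 y =P _) => [/blkS ->|_]; rewrite ?eqxx ?andbF //.
rewrite mulrAC mulrC -mulrA ler_peMr //.
rewrite mulrC ler_pdivlMr // mul1r -natrM ler_nat; exact: dbl.
Qed.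

Lemma runmax_adapted u t : (forall t, adapted blk t (u t : G -> R)) ->
  adapted blk t (runmax u t).
Proof.
move=> mu; elim: t => [|t IH] /=; first exact: mu.
by move=> x y xy /=; rewrite (adaptedS IH xy) (mu _ _ _ xy).
Qed.

End filtration.

Lemma runmax_ge (R : realType) (G : Type) (u : nat -> G -> R) t x :
  u t x <= runmax u t x.
Proof. by case: t => [|t] //=; rewrite le_max lexx orbT. Qed.

Lemma runmaxS (R : realType) (G : Type) (u : nat -> G -> R) t x :
  runmax u t x <= runmax u t.+1 x.
Proof. by rewrite /= le_max lexx. Qed.

Lemma runmax_le (R : realType) (G : Type) (u : nat -> G -> R) s t x :
  (s <= t)%N -> u s x <= runmax u t x.
Proof.
elim: t => [|t IH]; first by rewrite leqn0 => /eqP ->; exact: runmax_ge.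
rewrite leq_eqVlt => /orP[/eqP ->|]; first exact: runmax_ge.
by rewrite ltnS => /IH /le_trans; apply; exact: runmaxS.
Qed.

(** Let u_t be the martingale and m_t its running maximum.  As m_t only grows
    where m_(t+1) = u_(t+1), [powR_increment] bounds the growth of m_t^q by
    K u_(t+1) (m_(t+1)^(q-1) - m_t^(q-1)).  Both factors of u_(t+1) are constant
    on blocks, so u_(t+1) may be replaced by w under the sum; the sum over t then
    telescopes, and Young's inequality absorbs m_T^q. *)
Lemma doob_maximal (R : realType) (q : R) : 1 < q -> exists2 C : R, 0 < C &
  forall (G : finType) (blk : nat -> G -> nat) (w : G -> R) T,
    refining blk -> (forall x, 0 <= w x) ->
    \sum_x runmax (fun t => cexp blk t w) T x `^ q <= C * \sum_x w x `^ q.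
Proof.
move=> q1; have q10 : 0 < q - 1 by lra.
have [K K1 HK] := powR_increment q1.
have K0 : 0 < K by lra.
have d0 : 0 < (2 * K)^-1 by rewrite invr_gt0; lra.
have [C C0 HC] := young_powR (ltW q10) (@ltr01 R) d0.
exists (2 * K * C); first by rewrite !mulr_gt0.
move=> G blk w T ref w0.
pose u t := cexp blk t w; pose m t := runmax u t.
have u0 t x : 0 <= u t x by exact: cexp_ge0.
have m0 t x : 0 <= m t x.
  exact: le_trans (u0 t x) (runmax_ge _ _ _).
have mm t : adapted blk t (m t).
  by apply: runmax_adapted => // s; exact: cexp_adapted.
have mphi t : adapted blk t (fun x => m t x `^ (q - 1)).
  by move=> x y xy; rewrite (mm _ _ _ xy).
have claim t : \sum_x m t x `^ q <= K * \sum_x m t x `^ (q - 1) * w x.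
  elim: t => [|t IH].
    rewrite -(cexp_dual w (@mphi 0%N)).
    apply: (@le_trans _ _ (\sum_x m 0%N x `^ (q - 1) * cexp blk 0 w x)).
      have q0 : 0 < q by lra.
      by apply: ler_sum => x _; rewrite -(mulr_powRB1 (m0 _ _) q0) mulrC.
    by rewrite ler_peMl // sumr_ge0 // => x _; rewrite mulr_ge0 ?powR_ge0 ?cexp_ge0.
  have step x : m t.+1 x `^ q <= m t x `^ q +
     K * (m t.+1 x `^ (q - 1) * u t.+1 x - m t x `^ (q - 1) * u t.+1 x).
    rewrite /m /= -/(m t x); case: (leP (m t x) (u t.+1 x)) => h.
      by have := HK _ _ (m0 t x) h; lra.
    by rewrite subrr mulr0 addr0.
  apply: le_trans (ler_sum _ (fun x _ => step x)) _.
  rewrite big_split -mulr_sumr sumrB /= (cexp_dual w (@mphi t.+1)).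
  rewrite (cexp_dual w (adaptedS ref (@mphi t))).
  by move: IH; rewrite mulrBr; lra.
have young x : m T x `^ (q - 1) * w x <= (2 * K)^-1 * m T x `^ q + C * w x `^ q.
  by have := HC _ _ (m0 T x) (w0 x); rewrite powRr1 // subrK.
have := claim T => /le_trans /(_ (ler_wpM2l (ltW K0) (ler_sum _ (fun x _ => young x)))).
rewrite big_split /= -!mulr_sumr mulrDr mulrA invfM mulrCA mulfV ?gt_eqF //.
rewrite -/u -/(m T); set S := \sum_x _; lra.
Qed.

(** The Fefferman-Stein inequality for martingales: h dominates the mean square
    oscillation of g over the blocks around each point.  Let a_t be the
    conditional expectation of g, m_t the running maximum of that of |g|, and
    phi_t = m_t^(p-2).  The potential
    sum |a_t|^p + C sum phi_t (g - a_t)^2 ends at sum |g|^p.  In one step, a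
    Taylor expansion shows that its first term gains at most
    C sum phi_(t+1) (a_(t+1) - a_t)^2, the linear part being orthogonal to the
    martingale increment; by Pythagoras the second term loses exactly that
    much.  There remains C sum (phi_(t+1) - phi_t) (g - a_t)^2, which is
    controlled by h, and the sum over t telescopes to a multiple of
    sum m_T^(p-2) h^2.  Young's and Doob's inequalities conclude. *)
Lemma sharp_maximal (R : realType) (p : R) : 2 < p -> exists2 C : R, 0 < C &
  forall (G : finType) (blk : nat -> G -> nat) (g h : G -> R) T,
    refining blk -> doubling blk ->
    (forall y z, blk T y = blk T z -> y = z) ->
    (forall x, cexp blk 0 g x = 0) -> (forall x, 0 <= h x) ->
    (forall t x, cexp blk t (fun y => (g y - cexp blk t g y) ^+ 2) x <= h x ^+ 2) ->
    \sum_x `|g x| `^ p <= C * \sum_x h x `^ p.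
Proof.
move=> p2; have p1 : 1 < p by lra.
have [D D0 HD] := doob_maximal p1.
have [C C0 HC] := powR_taylor2 (ltW p2).
have d0 : 0 < (4 * C * D)^-1 by rewrite invr_gt0 !mulr_gt0.
have p20 : 0 <= p - 2 by lra.
have [Y Y0 HY] := young_powR p20 (@ltr0n R 2) d0.
exists (4 * C * Y); first by rewrite !mulr_gt0.
move=> G blk g h T ref dbl inj g0 h0 Hh.
pose u t := cexp blk t (fun y => `|g y|); pose m t := runmax u t.
pose a t := cexp blk t g.
have u0 t x : 0 <= u t x by apply: cexp_ge0.
have m0 t x : 0 <= m t x by exact: le_trans (u0 t x) (runmax_ge _ _ _).
have am t x : `|a t x| <= m t x.
  by apply: le_trans (cexp_norm _ _ _ _) _; exact: (runmax_ge u).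
have mm t : adapted blk t (m t).
  by apply: runmax_adapted => // s; exact: cexp_adapted.
pose phi t x := m t x `^ (p - 2).
have phi0 t x : 0 <= phi t x by exact: powR_ge0.
have mphi t : adapted blk t (phi t) by move=> x y xy; rewrite /phi (mm _ _ _ xy).
have ma t : adapted blk t (a t) by exact: cexp_adapted.
have phiS t x : phi t x <= phi t.+1 x by apply: powR_le => //; exact: runmaxS.
have claim t : \sum_x `|a t x| `^ p + C * \sum_x phi t x * (g x - a t x) ^+ 2 <=
    2 * C * \sum_x phi t x * h x ^+ 2.
  elim: t => [|t IH].
    rewrite big1 ?add0r; last by move=> x _; rewrite /a g0 normr0 powR0 //; lra.
    rewrite -(cexp_dual (fun x => (g x - a 0%N x) ^+ 2) (@mphi 0%N)).
    rewrite [2 * C]mulrC -mulrA ler_pM2l // mulr_sumr; apply: ler_sum => x _.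
    have := ler_wpM2l (phi0 0%N x) (Hh 0%N x).
    have := mulr_ge0 (phi0 0%N x) (sqr_ge0 (h x)); rewrite -/(a 0%N); lra.
  pose d x := a t.+1 x - a t x.
  pose L x := p * (`|a t x| `^ (p - 2) * a t x).
  have mL : adapted blk t L by move=> x y xy; rewrite /L (ma _ _ _ xy).
  have e1 : \sum_x L x * d x = 0.
    rewrite /d; under eq_bigr => x _ do rewrite mulrBr.
    by rewrite sumrB (cexp_dual _ mL) (cexp_dual _ (adaptedS ref mL)) subrr.
  have mpd : adapted blk t.+1 (fun x => phi t.+1 x * d x).
    move=> x y xy; rewrite /d (mphi _ _ _ xy) (ma _ _ _ xy).
    by rewrite (adaptedS ref (@ma t) xy).
  have e2 : \sum_x (phi t.+1 x * d x) * (g x - a t.+1 x) = 0.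
    under eq_bigr => x _ do rewrite mulrBr.
    by rewrite sumrB /a (cexp_dual _ mpd) subrr.
  have s1 : \sum_x `|a t.+1 x| `^ p <=
      \sum_x `|a t x| `^ p + C * \sum_x phi t.+1 x * d x ^+ 2.
    have st x : `|a t.+1 x| `^ p <=
        `|a t x| `^ p + L x * d x + C * (phi t.+1 x * d x ^+ 2).
      have h1 : `|a t x| <= m t.+1 x by exact: le_trans (am t x) (runmaxS _ _ _).
      have h2 : `|a t x + d x| <= m t.+1 x by rewrite /d subrKC.
      by have := HC _ _ _ h1 h2; rewrite {1}/d subrKC.
    apply: le_trans (ler_sum _ (fun x _ => st x)) _.
    by rewrite !big_split /= e1 addr0 -mulr_sumr.
  have s2 : \sum_x phi t.+1 x * (g x - a t x) ^+ 2 =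
      \sum_x phi t.+1 x * d x ^+ 2 + \sum_x phi t.+1 x * (g x - a t.+1 x) ^+ 2.
    transitivity (\sum_x phi t.+1 x * d x ^+ 2 + \sum_x phi t.+1 x * (g x - a t.+1 x) ^+ 2
      + 2 * \sum_x (phi t.+1 x * d x) * (g x - a t.+1 x)); last by rewrite e2 mulr0 addr0.
    rewrite mulr_sumr -!big_split /=.
    by apply: eq_bigr => x _; rewrite /d; ring.
  pose psi x := phi t.+1 x - phi t x.
  have psi0 x : 0 <= psi x by rewrite subr_ge0.
  have mpsi : adapted blk t.+1 psi.
    by move=> x y xy; rewrite /psi (mphi _ _ _ xy) (adaptedS ref (@mphi t) xy).
  (* psi is constant on blocks of level t + 1 only, while the mean of
     (g - a_t)^2 is bounded on blocks of level t: regularity of the filtration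
     costs a factor 2. *)
  have s3 : \sum_x psi x * (g x - a t x) ^+ 2 <= 2 * \sum_x psi x * h x ^+ 2.
    rewrite -(cexp_dual (fun x => (g x - a t x) ^+ 2) mpsi) mulr_sumr.
    apply: ler_sum => x _; rewrite [leRHS]mulrCA; apply: ler_wpM2l => //.
    apply: le_trans (cexp_doubling ref _ _ dbl _) _ => [y|]; first exact: sqr_ge0.
    by rewrite ler_pM2l.
  have s4 f : \sum_x psi x * f x = \sum_x phi t.+1 x * f x - \sum_x phi t x * f x.
    by rewrite -sumrB; apply: eq_bigr => x _; rewrite mulrBl.
  rewrite !s4 in s3; have := ler_wpM2l (ltW C0) s3; rewrite s2.
  by move: IH s1; lra.
have := claim T; rewrite (eq_bigr (fun x => `|g x| `^ p)); last first.
  by move=> x _; rewrite /a cexp_full.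
rewrite [X in _ + _ * X]big1 ?mulr0 ?addr0; last first.
  by move=> x _; rewrite /a cexp_full // subrr expr0n mulr0.
have young x : phi T x * h x ^+ 2 <= (4 * C * D)^-1 * m T x `^ p + Y * h x `^ p.
  by have := HY _ _ (m0 T x) (h0 x); rewrite subrK -powR_mulrn.
have C20 : 0 <= 2 * C by lra.
move=> /le_trans /(_ (ler_wpM2l C20 (ler_sum _ (fun x _ => young x)))).
rewrite big_split /= -!mulr_sumr.
have := HD _ _ _ T ref (fun x => normr_ge0 (g x)).
rewrite -/u -/(m T); set S1 := \sum_x _; set S2 := \sum_x _; set S3 := \sum_x _.
move=> h1 h2; have : 2 * C * (4 * C * D)^-1 * S1 <= 2^-1 * S2.
  apply: (@le_trans _ _ (2 * C * (4 * C * D)^-1 * (D * S2))).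
    by apply: ler_wpM2l => //; rewrite mulr_ge0 // ltW.
  rewrite le_eqVlt; apply/orP; left; apply/eqP; field.
  by rewrite !gt_eqF.
by move: h2; rewrite mulrDr !mulrA; lra.
Qed.

(** * Almost orthogonality *)

Definition ip (R : realType) (G : finType) (f g : G -> R) : R := \sum_x f x * g x.
Definition l2 (R : realType) (G : finType) (f : G -> R) : R := Num.sqrt (ip f f).

Section l2.
Variables (R : realType) (G : finType).
Implicit Types (f g h : G -> R).

Lemma ip_ge0 f : 0 <= ip f f.
Proof. by apply: sumr_ge0 => x _; rewrite -expr2 sqr_ge0. Qed.

Lemma ipC f g : ip f g = ip g f.
Proof. by apply: eq_bigr => x _; rewrite mulrC. Qed.

Lemma sqr_l2 f : l2 f ^+ 2 = ip f f.
Proof. by rewrite sqr_sqrtr // ip_ge0. Qed.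

Lemma l2_ge0 f : 0 <= l2 f. Proof. exact: sqrtr_ge0. Qed.

Lemma ip_sum n (a : nat -> R) (F : nat -> G -> R) g :
  ip (fun x => \sum_(i < n) a i * F i x) g = \sum_(i < n) a i * ip (F i) g.
Proof.
rewrite /ip; under eq_bigr => x _ do rewrite mulr_suml.
rewrite exchange_big /=; apply: eq_bigr => i _; rewrite mulr_sumr.
by apply: eq_bigr => x _; rewrite mulrA.
Qed.

Lemma ip_eq0 f g : ip f f = 0 -> ip f g = 0.
Proof.
move=> /eqP; rewrite psumr_eq0; last by move=> x _; rewrite -expr2 sqr_ge0.
move=> /allP h; rewrite /ip big1 // => x _.
have := h x (mem_index_enum x); rewrite -expr2 sqrf_eq0 => /eqP ->.
by rewrite mul0r.
Qed.

Lemma ip_le_l2 f g : ip f g <= l2 f * l2 g.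
Proof.
have [f0|f0] := eqVneq (ip f f) 0.
  by rewrite ip_eq0 // mulr_ge0 // l2_ge0.
have [g0|g0] := eqVneq (ip g g) 0.
  by rewrite ipC ip_eq0 // mulr_ge0 // l2_ge0.
have a0 : 0 < l2 f by rewrite sqrtr_gt0 lt_neqAle eq_sym f0 ip_ge0.
have b0 : 0 < l2 g by rewrite sqrtr_gt0 lt_neqAle eq_sym g0 ip_ge0.
have : 0 <= ip (fun x => l2 g * f x - l2 f * g x) (fun x => l2 g * f x - l2 f * g x).
  exact: ip_ge0.
have -> : ip (fun x => l2 g * f x - l2 f * g x) (fun x => l2 g * f x - l2 f * g x) =
  l2 g ^+ 2 * ip f f + l2 f ^+ 2 * ip g g - 2 * l2 f * l2 g * ip f g.
  rewrite /ip !mulr_sumr -big_split -sumrB /=; apply: eq_bigr => x _; ring.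
rewrite -!sqr_l2 => h.
have ab : 0 < l2 f * l2 g by exact: mulr_gt0.
rewrite -(ler_pM2l ab); lra.
Qed.

Lemma norm_ip_le f g : `|ip f g| <= l2 f * l2 g.
Proof.
rewrite ler_norml ip_le_l2 andbT lerNl.
have -> : - ip f g = ip (fun x => - f x) g.
  by rewrite /ip -sumrN; apply: eq_bigr => x _; rewrite mulNr.
apply: le_trans (ip_le_l2 _ _) _.
by rewrite /l2 /ip; under eq_bigr => x _ do rewrite mulrNN.
Qed.

Lemma l2D f g : l2 (fun x => f x + g x) <= l2 f + l2 g.
Proof.
rewrite -(ler_pXn2r (ltn0Sn 1)) ?nnegrE ?addr_ge0 ?l2_ge0 //.
rewrite sqrrD !sqr_l2.
have -> : ip (fun x => f x + g x) (fun x => f x + g x) = ip f f + 2 * ip f g + ip g g.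
  by rewrite /ip mulr_sumr -!big_split; apply: eq_bigr => x _ /=; ring.
by rewrite -[X in _ <= _ + X + _]mulr_natl lerD2r lerD2l ler_pM2l // ip_le_l2.
Qed.

Lemma l2Z a f : l2 (fun x => a * f x) = `|a| * l2 f.
Proof.
rewrite /l2 -sqrtr_sqr -sqrtrM ?sqr_ge0 //; congr Num.sqrt.
by rewrite /ip mulr_sumr; apply: eq_bigr => x _; ring.
Qed.

Lemma eq_l2 f g : f =1 g -> l2 f = l2 g.
Proof. by move=> fg; rewrite /l2 /ip; under eq_bigr => x _ do rewrite fg. Qed.

Lemma l2_sum n (F : nat -> G -> R) :
  l2 (fun x => \sum_(i < n) F i x) <= \sum_(i < n) l2 (F i).
Proof.
elim: n => [|n IH].
  rewrite big_ord0 /l2 /ip big1 ?sqrtr0 // => x _.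
  by rewrite big_ord0 mul0r.
rewrite big_ord_recr /= (eq_l2 (g := fun x => \sum_(i < n) F i x + F n x)); last first.
  by move=> x; rewrite big_ord_recr.
by apply: le_trans (l2D _ _) _; rewrite lerD2r.
Qed.

End l2.

Lemma sum_geo_le (R : realType) (s : R) (i n : nat) : 0 < s -> s < 1 ->
  \sum_(j < n) s ^+ (i - j + (j - i)) <= 2 / (1 - s).
Proof.
move=> s0 s1; have s1' : 0 < 1 - s by lra.
rewrite ler_pdivlMr //.
suff : (\sum_(j < n) s ^+ (i - j + (j - i))) * (1 - s) <= s ^+ (i - n) + 1 - s ^+ (n - i).
  move=> /le_trans; apply.
  have : s ^+ (i - n) <= 1 by apply: exprn_ile1; lra.
  have : 0 <= s ^+ (n - i) by apply: exprn_ge0; lra.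
  by lra.
elim: n => [|n IH].
  by rewrite big_ord0 mul0r subn0 sub0n expr0; have := exprn_gt0 i s0; lra.
rewrite big_ord_recr /= mulrDl.
case: (ltnP n i) => ni.
  have e1 : (n - i = 0)%N by lia.
  have e2 : (n.+1 - i = 0)%N by lia.
  have e3 : (i - n = (i - n.+1).+1)%N by lia.
  move: IH; rewrite e1 e2 e3 addn0 !exprS expr0.
  have z0 : 0 < s ^+ (i - n.+1) by exact: exprn_gt0.
  by have := mulr_ge0 (ltW z0) (sqr_ge0 (1 - s)); lra.
have e1 : (i - n = 0)%N by lia.
have e2 : (i - n.+1 = 0)%N by lia.
have e3 : (n.+1 - i = (n - i).+1)%N by lia.
by move: IH; rewrite e1 e2 e3 add0n exprS expr0; lra.
Qed.

Lemma amgm4 (R : realType) (a b d e : R) : 0 <= a -> 0 <= b -> 0 <= d -> 0 <= e ->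
  a * b * d * e <= ((a + b + d + e) / 4) ^+ 4.
Proof.
move=> a0 b0 d0 e0.
have h1 : a * b <= ((a + b) / 2) ^+ 2 by have := sqr_ge0 (a - b); lra.
have h2 : d * e <= ((d + e) / 2) ^+ 2 by have := sqr_ge0 (d - e); lra.
pose u := (a + b) / 2; pose v := (d + e) / 2; rewrite -/u in h1; rewrite -/v in h2.
have uv : u * v <= ((u + v) / 2) ^+ 2 by have := sqr_ge0 (u - v); lra.
have u0 : 0 <= u by rewrite /u; lra.
have v0 : 0 <= v by rewrite /v; lra.
have -> : (a + b + d + e) / 4 = (u + v) / 2 by rewrite /u /v; lra.
rewrite -mulrA; apply: (@le_trans _ _ ((u * v) ^+ 2)).
  by rewrite exprMn; apply: ler_pM; rewrite // mulr_ge0.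
by rewrite (exprM _ 2 2) ler_pXn2r ?nnegrE ?sqr_ge0 // mulr_ge0.
Qed.

Section almost_orthogonality.
Variables (R : realType) (G : finType) (n : nat).
Variables (B : nat -> (G -> R) -> G -> R) (c s : R).
Hypothesis s0 : 0 < s.
Hypothesis s1 : s < 1.
Hypothesis c0 : 0 <= c.
Hypothesis Blin : forall k m (a : nat -> R) (F : nat -> G -> R),
  B k (fun x => \sum_(i < m) a i * F i x) = (fun x => \sum_(i < m) a i * B k (F i) x).
Hypothesis Bsym : forall k f g, ip (B k f) g = ip f (B k g).
Hypothesis Bcomm : forall j k f, B j (B k f) = B k (B j f).
Let K (i j : nat) : R := s ^+ (i - j + (j - i)).
(* The fourth power leaves one factor of decay for each of the three links of a
   chain of four indices, once a geometric mean of four estimates is taken. *)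
Hypothesis Bdecay : forall j k f, (j < n)%N -> (k < n)%N ->
  l2 (B j (B k f)) <= c * K j k ^+ 4 * l2 f.

Let L := 2 / (1 - s).

Let K0 i j : 0 < K i j. Proof. exact: exprn_gt0. Qed.
Let K1 i j : K i j <= 1. Proof. exact: exprn_ile1 (ltW s0) (ltW s1). Qed.
Let KC i j : K i j = K j i. Proof. by rewrite /K addnC. Qed.
Let L0 : 0 < L. Proof. by rewrite /L divr_gt0 // subr_gt0. Qed.

Let rowK i : \sum_(j < n) K i j <= L. Proof. exact: sum_geo_le. Qed.

Let KM_ge0 i j a : 0 <= a -> 0 <= K i j * a.
Proof. by move=> a0; rewrite mulr_ge0 // ltW. Qed.

Let sumK (u : nat -> R) : (forall i, 0 <= u i) ->
  \sum_(i < n) \sum_(j < n) K i j * u j <= L * \sum_(j < n) u j.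
Proof.
move=> u0; rewrite exchange_big /= mulr_sumr; apply: ler_sum => j _.
rewrite -mulr_suml; apply: ler_wpM2r => //.
by under eq_bigr => i _ do rewrite KC.
Qed.

(** With X = sum ||B_k f||^2 and V = sum B_k B_k f one has X = <V, f>, while the
    decay of B_j B_k gives ||V||^2 <= c L X; Cauchy-Schwarz closes the loop. *)
Lemma square_sum_le f : \sum_(k < n) l2 (B k f) ^+ 2 <= c * L * l2 f ^+ 2.
Proof.
set X := \sum_(k < n) _.
have X0 : 0 <= X by apply: sumr_ge0 => k _; exact: sqr_ge0.
pose V x := \sum_(k < n) 1 * B k (B k f) x.
have XV : X = ip V f.
  rewrite /V (ip_sum n (fun=> 1) (fun k => B k (B k f))).
  by apply: eq_bigr => k _; rewrite mul1r sqr_l2 [RHS]Bsym.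
have VV : ip V V <= c * L * X.
  rewrite {1}/V (ip_sum n (fun=> 1) (fun k => B k (B k f))).
  apply: (@le_trans _ _ (\sum_(k < n) \sum_(j < n) c * (K k j * (l2 (B k f) ^+ 2 + l2 (B j f) ^+ 2) / 2))).
    apply: ler_sum => k _; rewrite mul1r ipC /V (ip_sum n (fun=> 1) (fun k => B k (B k f))).
    apply: ler_sum => j _; rewrite mul1r Bsym (Bcomm j k).
    apply: le_trans (ip_le_l2 _ _) _.
    have h := Bdecay (B k f) (ltn_ord k) (ltn_ord j).
    have kk : K k j ^+ 4 <= K k j.
      by rewrite exprS -[leRHS]mulr1 ler_pM2l // exprn_ile1 // ltW // K0.
    have hx := l2_ge0 (B k f); have hy := l2_ge0 (B j f).
    apply: (@le_trans _ _ (l2 (B j f) * (c * K k j * l2 (B k f)))).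
      apply: ler_wpM2l => //; apply: le_trans h _; apply: ler_wpM2r => //.
      exact: ler_wpM2l.
    have -> : l2 (B j f) * (c * K k j * l2 (B k f)) = c * (K k j * (l2 (B j f) * l2 (B k f))) by ring.
    apply: ler_wpM2l => //; rewrite -mulrA; apply: ler_wpM2l; first exact: ltW.
    have := sqr_ge0 (l2 (B j f) - l2 (B k f)); lra.
  have -> : \sum_(k < n) \sum_(j < n) c * (K k j * (l2 (B k f) ^+ 2 + l2 (B j f) ^+ 2) / 2)
    = c / 2 * (\sum_(k < n) \sum_(j < n) K k j * l2 (B k f) ^+ 2 +
        \sum_(k < n) \sum_(j < n) K k j * l2 (B j f) ^+ 2).
    rewrite -big_split mulr_sumr; apply: eq_bigr => k _.
    rewrite -big_split mulr_sumr; apply: eq_bigr => j _ /=; ring.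
  have h2 : \sum_(k < n) \sum_(j < n) K k j * l2 (B j f) ^+ 2 <= L * X.
    by apply: (sumK (u := fun j => l2 (B j f) ^+ 2)) => j; exact: sqr_ge0.
  have h1 : \sum_(k < n) \sum_(j < n) K k j * l2 (B k f) ^+ 2 <= L * X.
    rewrite mulr_sumr; apply: ler_sum => k _; rewrite -mulr_suml.
    by apply: ler_wpM2r; [exact: sqr_ge0|exact: rowK].
  by have := ler_wpM2l c0 h1; have := ler_wpM2l c0 h2; lra.
have XX : X ^+ 2 <= c * L * X * l2 f ^+ 2.
  rewrite XV; apply: (@le_trans _ _ ((l2 V * l2 f) ^+ 2)).
    rewrite ler_pXn2r ?nnegrE ?mulr_ge0 ?l2_ge0 ?ip_le_l2 //; last by rewrite -XV.
  rewrite exprMn -XV; apply: ler_wpM2r; first exact: sqr_ge0.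
  by rewrite sqr_l2.
have [X00|Xn0] := eqVneq X 0.
  rewrite X00; apply: mulr_ge0; last exact: sqr_ge0.
  by apply: mulr_ge0 => //; exact: ltW.
have Xp : 0 < X by rewrite lt_neqAle eq_sym Xn0.
rewrite -(ler_pM2l Xp); move: XX; rewrite expr2; lra.
Qed.

Let q f i j k l := ip (B i (B j (B k f))) (B l f).

Let q_le f i j k l : (i < n)%N -> (j < n)%N ->
  `|q f i j k l| <= c * K i j ^+ 4 * (l2 (B k f) * l2 (B l f)).
Proof.
move=> iin jn; apply: le_trans (norm_ip_le _ _) _; rewrite mulrA.
by apply: ler_wpM2r; [exact: l2_ge0|exact: Bdecay].
Qed.

Let q12 f i j k l : q f i j k l = q f j i k l.
Proof. by rewrite /q Bcomm. Qed.
Let q23 f i j k l : q f i j k l = q f i k j l.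
Proof. by rewrite /q (Bcomm j k). Qed.
Let q34 f i j k l : q f i j k l = q f i j l k.
Proof.
rewrite /q (Bcomm j k) (Bcomm i k) Bsym (Bcomm k l).
by rewrite -Bsym (Bcomm l i) (Bcomm l j).
Qed.

Let y f i := l2 (B i f) ^+ 2.

(** The four-fold product is invariant under permutations of the indices, so
    each of the pairs (i, j), (k, l), (j, k) and (i, l) can be placed in front and
    estimated by the decay hypothesis, the other two indices staying on f.  The
    geometric mean of the four estimates keeps the first three decay factors and
    distributes the norms evenly. *)
Let q_chain f i j k l : (i < n)%N -> (j < n)%N -> (k < n)%N -> (l < n)%N ->
  `|q f i j k l| <= c * (K i j * (K j k * (K k l * ((y f i + y f j + y f k + y f l) / 4)))).
Proof.
move=> li lj lk ll.
have y0 a : 0 <= y f a by exact: sqr_ge0.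
have x0 a : 0 <= l2 (B a f) by exact: l2_ge0.
have Y0 : 0 <= (y f i + y f j + y f k + y f l) / 4 by rewrite divr_ge0 // !addr_ge0.
have rhs0 : 0 <= c * (K i j * (K j k * (K k l * ((y f i + y f j + y f k + y f l) / 4)))).
  by apply: mulr_ge0 => //; do 3 apply: KM_ge0.
rewrite -(ler_pXn2r (ltn0Sn 3)) ?nnegrE //.
have b1 := q_le f k l li lj.
have b2 := q_le f i j lk ll.
have b3 := q_le f i l lj lk.
have b4 := q_le f j k li ll.
rewrite (_ : q f k l i j = q f i j k l) in b2; last first.
  by rewrite (q23 f k l i j) (q12 f k i l j) (q34 f i k l j) (q23 f i k j l).
rewrite (_ : q f j k i l = q f i j k l) in b3; last by rewrite (q23 f j k i l) (q12 f j i k l).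
rewrite (_ : q f i l j k = q f i j k l) in b4; last by rewrite (q23 f i l j k) (q34 f i j l k).
set t := `|q f i j k l| in b1 b2 b3 b4 *.
have t0 : 0 <= t by exact: normr_ge0.
(* Only the three links of the chain i - j - k - l keep their decay factor; that
   of the pair (i, l) is bounded by 1. *)
have b4' : t <= c * (l2 (B j f) * l2 (B k f)).
  apply: le_trans b4 _; apply: ler_wpM2r; first by rewrite mulr_ge0.
  by rewrite -[leRHS]mulr1; apply: ler_wpM2l => //; rewrite exprn_ile1 // ltW.
have m1 := ler_pM t0 t0 b1 b2; have m2 := ler_pM t0 t0 b3 b4'.
have tt0 : 0 <= t * t by rewrite mulr_ge0.
have m := ler_pM tt0 tt0 m1 m2.
have -> : t ^+ 4 = t * t * (t * t) by ring.
apply: le_trans m _.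
have -> : c * K i j ^+ 4 * (l2 (B k f) * l2 (B l f)) *
   (c * K k l ^+ 4 * (l2 (B i f) * l2 (B j f))) *
   (c * K j k ^+ 4 * (l2 (B i f) * l2 (B l f)) * (c * (l2 (B j f) * l2 (B k f)))) =
   (c * (K i j * (K j k * K k l))) ^+ 4 * (y f i * y f j * y f k * y f l).
  by rewrite /y; ring.
rewrite [leRHS](_ : _ = (c * (K i j * (K j k * K k l))) ^+ 4 *
   ((y f i + y f j + y f k + y f l) / 4) ^+ 4); last by rewrite -exprMn; congr (_ ^+ 4); ring.
by apply: ler_wpM2l; [rewrite exprn_ge0 // !mulr_ge0 // ltW|exact: amgm4].
Qed.

Let rowKM i a : 0 <= a -> \sum_(j < n) K i j * a <= L * a.
Proof. by move=> a0; rewrite -mulr_suml; apply: ler_wpM2r. Qed.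

Let nest i (F : nat -> nat -> nat -> R) :
  \sum_(j < n) \sum_(k < n) \sum_(l < n) K i j * (K j k * (K k l * F j k l)) =
  \sum_(j < n) K i j * (\sum_(k < n) K j k * (\sum_(l < n) K k l * F j k l)).
Proof.
apply: eq_bigr => j _; rewrite mulr_sumr; apply: eq_bigr => k _.
by rewrite !mulr_sumr.
Qed.

Let row_le i (v w : nat -> R) : (forall j, v j <= w j) ->
  \sum_(j < n) K i j * v j <= \sum_(j < n) K i j * w j.
Proof. by move=> vw; apply: ler_sum => j _; apply: ler_wpM2l => //; exact: ltW. Qed.

Let chain_sum (u : nat -> R) : (forall i, 0 <= u i) ->
  \sum_(i < n) \sum_(j < n) \sum_(k < n) \sum_(l < n)
     K i j * (K j k * (K k l * (u i + u j + u k + u l)))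
  <= 4 * L ^+ 3 * \sum_(i < n) u i.
Proof.
move=> u0; set U := \sum_(i < n) u i.
have L0' := ltW L0.
have r1 k a : 0 <= a -> \sum_(l < n) K k l * a <= L * a by exact: rowKM.
have r2 j a : 0 <= a -> \sum_(k < n) K j k * (\sum_(l < n) K k l * a) <= L * (L * a).
  move=> a0; apply: (@le_trans _ _ (\sum_(k < n) K j k * (L * a))); last first.
    by apply: rowKM; exact: mulr_ge0.
  by apply: (@row_le j (fun k => \sum_(l < n) K k l * a) (fun=> L * a)) => k; exact: r1.
have r3 i a : 0 <= a -> \sum_(j < n) K i j * (\sum_(k < n) K j k * (\sum_(l < n) K k l * a)) <= L * (L * (L * a)).
  move=> a0; apply: (@le_trans _ _ (\sum_(j < n) K i j * (L * (L * a)))); last first.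
    by apply: rowKM; do 2 apply: mulr_ge0 => //.
  by apply: (@row_le i (fun j => \sum_(k < n) K j k * (\sum_(l < n) K k l * a)) (fun=> L * (L * a))) => k; exact: r2.
have Ku_ge0 i (v : nat -> R) : (forall j, 0 <= v j) -> 0 <= \sum_(j < n) K i j * v j.
  by move=> v0; apply: sumr_ge0 => j _; exact: KM_ge0.
have T1 : \sum_(i < n) \sum_(j < n) \sum_(k < n) \sum_(l < n)
     K i j * (K j k * (K k l * u i)) <= L ^+ 3 * U.
  rewrite mulr_sumr; apply: ler_sum => i _; rewrite (nest i (fun _ _ _ => u i)).
  by apply: le_trans (r3 _ _ (u0 i)) _; rewrite !exprS expr0 mulr1 !mulrA.
have T2 : \sum_(i < n) \sum_(j < n) \sum_(k < n) \sum_(l < n)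
     K i j * (K j k * (K k l * u j)) <= L ^+ 3 * U.
  under eq_bigr => i _ do rewrite (nest i (fun j _ _ => u j)).
  apply: (@le_trans _ _ (\sum_(i < n) \sum_(j < n) K i j * (L * (L * u j)))).
    apply: ler_sum => i _.
    by apply: (@row_le i (fun j => \sum_(k < n) K j k * (\sum_(l < n) K k l * u j)) (fun j => L * (L * u j))) => j; exact: r2.
  apply: le_trans (sumK (u := fun j => L * (L * u j)) _) _; first by move=> j; do 2 apply: mulr_ge0 => //.
  by rewrite -!mulr_sumr !exprS expr0 mulr1 !mulrA.
have T3 : \sum_(i < n) \sum_(j < n) \sum_(k < n) \sum_(l < n)
     K i j * (K j k * (K k l * u k)) <= L ^+ 3 * U.
  under eq_bigr => i _ do rewrite (nest i (fun _ k _ => u k)).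
  apply: (@le_trans _ _ (\sum_(i < n) \sum_(j < n) K i j * (\sum_(k < n) K j k * (L * u k)))).
    apply: ler_sum => i _.
    apply: (@row_le i (fun j => \sum_(k < n) K j k * (\sum_(l < n) K k l * u k))
      (fun j => \sum_(k < n) K j k * (L * u k))) => j.
    by apply: (@row_le j (fun k => \sum_(l < n) K k l * u k) (fun k => L * u k)) => k; exact: r1.
  apply: le_trans (sumK (u := fun j => \sum_(k < n) K j k * (L * u k)) _) _.
    by move=> j; apply: (Ku_ge0 j (fun k => L * u k)) => k; rewrite mulr_ge0.
  apply: (@le_trans _ _ (L * (L * \sum_(k < n) (L * u k)))).
    apply: ler_wpM2l => //; apply: (sumK (u := fun k => L * u k)) => k.
    by rewrite mulr_ge0.
  by rewrite -!mulr_sumr !exprS expr0 mulr1 !mulrA.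
have T4 : \sum_(i < n) \sum_(j < n) \sum_(k < n) \sum_(l < n)
     K i j * (K j k * (K k l * u l)) <= L ^+ 3 * U.
  under eq_bigr => i _ do rewrite (nest i (fun _ _ l => u l)).
  have P1 k : 0 <= \sum_(l < n) K k l * u l by exact: Ku_ge0.
  have P2 j : 0 <= \sum_(k < n) K j k * (\sum_(l < n) K k l * u l).
    exact: (Ku_ge0 j (fun k => \sum_(l < n) K k l * u l)).
  apply: le_trans (sumK (u := fun j => \sum_(k < n) K j k * (\sum_(l < n) K k l * u l)) P2) _.
  have -> : L ^+ 3 * U = L * (L * (L * U)) by ring.
  apply: (ler_wpM2l L0').
  apply: le_trans (sumK (u := fun k => \sum_(l < n) K k l * u l) P1) _.
  by apply: (ler_wpM2l L0'); exact: sumK.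
have -> : \sum_(i < n) \sum_(j < n) \sum_(k < n) \sum_(l < n)
     K i j * (K j k * (K k l * (u i + u j + u k + u l))) =
   \sum_(i < n) \sum_(j < n) \sum_(k < n) \sum_(l < n) K i j * (K j k * (K k l * u i)) +
   \sum_(i < n) \sum_(j < n) \sum_(k < n) \sum_(l < n) K i j * (K j k * (K k l * u j)) +
   \sum_(i < n) \sum_(j < n) \sum_(k < n) \sum_(l < n) K i j * (K j k * (K k l * u k)) +
   \sum_(i < n) \sum_(j < n) \sum_(k < n) \sum_(l < n) K i j * (K j k * (K k l * u l)).
  rewrite -!big_split; apply: eq_bigr => i _.
  rewrite -!big_split; apply: eq_bigr => j _.
  rewrite -!big_split; apply: eq_bigr => k _.
  rewrite -!big_split; apply: eq_bigr => l _ /=; ring.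
lra.
Qed.

(** A Cotlar-Stein argument for commuting symmetric operators.  Expanding
    ||S S f||^2 into four-fold products and summing [q_chain] along the chain
    i - j - k - l gives c L^3 sum ||B_i f||^2, hence a multiple of ||f||^2 by
    [square_sum_le]; finally ||S f||^2 = <S S f, f>. *)
Lemma almost_orthogonal_sum (a : nat -> R) f : (forall k, `|a k| <= 1) ->
  l2 (fun x => \sum_(k < n) a k * B k f x) ^+ 2 <= c * L ^+ 2 * l2 f ^+ 2.
Proof.
move=> a1; pose S h x := \sum_(k < n) a k * B k h x.
rewrite -/(S f).
have Ssym g h : ip (S g) h = ip g (S h).
  rewrite /S (ip_sum n a (fun k => B k g)) [RHS]ipC (ip_sum n a (fun k => B k h)).
  by apply: eq_bigr => k _; rewrite Bsym ipC.
have SS h : S (S h) = fun x => \sum_(i < n) a i * (\sum_(j < n) a j * B i (B j h) x).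
  apply/funext => x; apply: eq_bigr => i _; congr (_ * _).
  by have -> : B i (S h) = (fun x => \sum_(j < n) a j * B i (B j h) x) by exact: (Blin i n a (fun j => B j h)).
have e4 : ip (S (S f)) (S (S f)) = \sum_(i < n) \sum_(j < n) \sum_(k < n) \sum_(l < n)
    a i * (a j * (a k * (a l * q f i j l k))).
  rewrite {1}SS (ip_sum n a (fun i x => \sum_(j < n) a j * B i (B j f) x)).
  apply: eq_bigr => i _; rewrite (ip_sum n a (fun j => B i (B j f))) mulr_sumr.
  apply: eq_bigr => j _; rewrite ipC SS.
  rewrite (ip_sum n a (fun k x => \sum_(l < n) a l * B k (B l f) x)) !mulr_sumr.
  apply: eq_bigr => k _; rewrite (ip_sum n a (fun l => B k (B l f))) !mulr_sumr.
  apply: eq_bigr => l _; do 4 congr (_ * _).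
  by rewrite ipC /q (Bcomm k l) -Bsym (Bcomm l i) (Bcomm l j).
have b4 : l2 (S (S f)) ^+ 2 <= c * L ^+ 3 * \sum_(i < n) y f i.
  rewrite sqr_l2 e4.
  have y0 i : 0 <= y f i by exact: sqr_ge0.
  have := ler_wpM2l (divr_ge0 c0 (ler0n R 4)) (chain_sum y0).
  rewrite [leRHS](_ : _ = c * L ^+ 3 * \sum_(i < n) y f i); last by field.
  apply: le_trans; rewrite mulr_sumr; apply: ler_sum => i _.
  rewrite mulr_sumr; apply: ler_sum => j _; rewrite mulr_sumr; apply: ler_sum => k _.
  rewrite mulr_sumr; apply: ler_sum => l _.
  apply: (@le_trans _ _ `|q f i j k l|).
    rewrite -(q34 f i j l k) !mulrA; apply: le_trans (ler_norm _) _.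
    rewrite normrM -[leRHS]mul1r; apply: ler_wpM2r => //.
    by rewrite !normrM; do 3 (apply: mulr_ile1; rewrite ?mulr_ge0 //).
  apply: le_trans (q_chain f (ltn_ord i) (ltn_ord j) (ltn_ord k) (ltn_ord l)) _.
  by rewrite le_eqVlt; apply/orP; left; apply/eqP; field.
have b5 : l2 (S (S f)) ^+ 2 <= (c * L ^+ 2 * l2 f) ^+ 2.
  apply: le_trans b4 _; have L30 : 0 <= c * L ^+ 3 by rewrite mulr_ge0 // exprn_ge0 // ltW.
  have := ler_wpM2l L30 (square_sum_le f); rewrite -/(y f) => h.
  by apply: le_trans h _; rewrite le_eqVlt; apply/orP; left; apply/eqP; ring.
have cL0 : 0 <= c * L ^+ 2 * l2 f by apply: mulr_ge0; [apply: mulr_ge0 => //; exact: sqr_ge0|exact: l2_ge0].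
rewrite ler_pXn2r ?nnegrE ?l2_ge0 // in b5.
rewrite sqr_l2 Ssym ipC; apply: le_trans (ip_le_l2 _ _) _.
by rewrite expr2 mulrA; apply: ler_wpM2r => //; exact: l2_ge0.
Qed.

End almost_orthogonality.

(** * Window averages on finite abelian groups *)

Definition wsum (R : realType) (G : finZmodType) (e : G) (f : G -> R) (x : G) (w : nat) : R :=
  \sum_(j < w) f (x + e *+ j).

Definition avg (R : realType) (G : finZmodType) (e : G) (m : nat) (f : G -> R) (x : G) : R :=
  wsum e f (x - e *+ m) m.*2.+1 / m.*2.+1%:R.

Definition avg_diff (R : realType) (G : finZmodType) (e : G) (m : nat -> nat)
    (k : nat) (f : G -> R) (x : G) : R :=
  avg e (m k.+1) f x - avg e (m k) f x.

Definition avg_transform (R : realType) (G : finZmodType) (e : G) (m : nat -> nat)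
    (a : nat -> R) (n : nat) (f : G -> R) (x : G) : R :=
  \sum_(k < n) a k * avg_diff e m k f x.

Section averages.
Variables (R : realType) (G : finZmodType) (e : G).
Implicit Types (f g : G -> R) (x : G).

Local Notation W m := (m.*2.+1%:R : R).

Lemma W_gt0 (m : nat) : 0 < W m. Proof. by rewrite ltr0n. Qed.

Lemma sum_translate (f : G -> R) (z : G) : \sum_x f (x + z) = \sum_x f x.
Proof. by rewrite [RHS](reindex_inj (addIr z)). Qed.

Lemma l2_translate f z : l2 (fun x => f (x + z)) = l2 f.
Proof. by congr Num.sqrt; rewrite /ip (sum_translate (fun x => f x * f x)). Qed.

Lemma avgE m f x :
  avg e m f x = (\sum_(j < m.*2.+1) f (x + (e *+ j - e *+ m))) / W m.
Proof.
congr (_ / _); apply: eq_bigr => j _; congr f.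
by rewrite addrA addrAC.
Qed.

Lemma avg_linear m n (a : nat -> R) (F : nat -> G -> R) :
  avg e m (fun x => \sum_(i < n) a i * F i x) =
  (fun x => \sum_(i < n) a i * avg e m (F i) x).
Proof.
apply/funext => x; rewrite avgE exchange_big /= mulr_suml.
by apply: eq_bigr => i _; rewrite avgE mulrA mulr_sumr.
Qed.

Lemma avgB m f g : avg e m (fun x => f x - g x) = fun x => avg e m f x - avg e m g x.
Proof. by apply/funext => x; rewrite !avgE sumrB mulrBl. Qed.

Lemma avg_sym m f g : ip (avg e m f) g = ip f (avg e m g).
Proof.
rewrite /ip; under eq_bigr => x _ do rewrite avgE mulrAC mulr_suml.
under [RHS]eq_bigr => x _ do rewrite avgE mulrA mulr_sumr.
rewrite -!mulr_suml; congr (_ / _).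
rewrite exchange_big [RHS]exchange_big /= (reindex_inj rev_ord_inj) /=.
apply: eq_bigr => j _.
rewrite -(sum_translate _ (e *+ j - e *+ m)); apply: eq_bigr => x _.
congr (f _ * _); have jm : (j <= m.*2)%N by rewrite -ltnS.
have -> : (m.*2.+1 - j.+1 = m.*2 - j)%N by lia.
move: (nat_of_ord j) jm => i im.
rewrite mulrnBr // -addnn mulrnDr (addrAC (e *+ m + e *+ m)) addrK.
by rewrite -[e *+ m - e *+ i]opprB addrK.
Qed.

Lemma avg_comm m k f : avg e m (avg e k f) = avg e k (avg e m f).
Proof.
apply/funext => x; rewrite !avgE.
under eq_bigr => i _ do rewrite avgE.
under [in RHS]eq_bigr => i _ do rewrite avgE.
rewrite -[X in X / _ = _]mulr_suml -[X in _ = X / _]mulr_suml.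
rewrite -!mulrA [(W m)^-1 * _]mulrC; congr (_ * _).
rewrite exchange_big /=; apply: eq_bigr => i _; apply: eq_bigr => j _.
by congr f; rewrite addrAC.
Qed.

Lemma wsumD f x w z : wsum e f x (w + z) = wsum e f x w + wsum e f (x + e *+ w) z.
Proof.
rewrite /wsum big_split_ord /=; congr (_ + _).
by apply: eq_bigr => j _; rewrite mulrnDr addrA.
Qed.

(** Sliding a window by z steps exchanges z terms at one end for z terms at the
    other, whatever the length of the window. *)
Lemma wsum_slide f x w z :
  wsum e f (x + e *+ z) w - wsum e f x w = wsum e f (x + e *+ w) z - wsum e f x z.
Proof.
have := wsumD f x w z; rewrite addnC wsumD => h; lra.
Qed.

Lemma l2_wsum f z c : l2 (fun x => wsum e f (x + c) z) <= z%:R * l2 f.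
Proof.
apply: le_trans (l2_sum z (fun j x => f (x + c + e *+ j))) _.
under eq_bigr => j _ do rewrite (@l2_translate (fun x => f (x + e *+ j)) c) l2_translate.
by rewrite sumr_const card_ord mulr_natl.
Qed.

Lemma l2_avg m f : l2 (avg e m f) <= l2 f.
Proof.
rewrite (eq_l2 (g := fun x => (W m)^-1 * wsum e f (x - e *+ m) m.*2.+1)); last first.
  by move=> x; rewrite mulrC.
rewrite l2Z normfV normr_nat ler_pdivrMl ?W_gt0 //.
exact: l2_wsum.
Qed.

Lemma l2B f g : l2 (fun x => f x - g x) <= l2 f + l2 g.
Proof.
apply: le_trans (l2D f (fun x => - g x)) _; rewrite lerD2l.
by rewrite (eq_l2 (g := fun x => -1 * g x)) ?l2Z ?normrN1 ?mul1r // => x; rewrite mulN1r.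
Qed.

Lemma l2_avg_shift m f z :
  l2 (fun x => avg e m f (x + e *+ z) - avg e m f x) <= 2 * z%:R / W m * l2 f.
Proof.
rewrite (eq_l2 (g := fun x => (W m)^-1 * (wsum e f (x + (e *+ m.*2.+1 - e *+ m)) z
   - wsum e f (x + - (e *+ m)) z))); last first.
  move=> x; rewrite -mulrBl mulrC; congr (_ * _).
  rewrite [x + e *+ z - _]addrAC wsum_slide.
  by rewrite (addrAC x) addrA.
rewrite l2Z normfV normr_nat.
have -> : 2 * z%:R / W m * l2 f = (W m)^-1 * (z%:R * l2 f + z%:R * l2 f) by ring.
apply: ler_wpM2l; first by rewrite invr_ge0 ltW // W_gt0.
by apply: le_trans (l2B _ _) _; apply: lerD; exact: l2_wsum.
Qed.

Lemma l2_avg_shiftN m f z :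
  l2 (fun x => avg e m f (x - e *+ z) - avg e m f x) <= 2 * z%:R / W m * l2 f.
Proof.
rewrite -(@l2_translate (fun x => avg e m f (x - e *+ z) - avg e m f x) (e *+ z)).
rewrite (eq_l2 (g := fun x => -1 * (avg e m f (x + e *+ z) - avg e m f x))).
  by rewrite l2Z normrN1 mul1r l2_avg_shift.
by move=> x /=; rewrite addrK mulN1r opprB.
Qed.

(** [avg e k] is a mean of translations by at most k steps, each of which moves
    [avg e j f] by at most 2 k / (2 j + 1) times the norm of f. *)
Lemma l2_avg_avg j k f :
  l2 (fun x => avg e j (avg e k f) x - avg e j f x) <= W k / W j * l2 f.
Proof.
rewrite avg_comm.
rewrite (eq_l2 (g := fun x => (W k)^-1 * \sum_(i < k.*2.+1)
    (avg e j f (x + (e *+ i - e *+ k)) - avg e j f x))); last first.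
  move=> x; rewrite avgE sumrB sumr_const card_ord mulrBr mulrC; congr (_ - _).
  by rewrite -[X in _ * X]mulr_natl mulKf // gt_eqF // W_gt0.
rewrite l2Z normfV normr_nat ler_pdivrMl ?W_gt0 //.
apply: le_trans (l2_sum _ (fun i x => avg e j f (x + (e *+ i - e *+ k)) - avg e j f x)) _.
apply: (@le_trans _ _ (\sum_(i < k.*2.+1) (W k / W j * l2 f))); last first.
  by rewrite sumr_const card_ord -[leLHS]mulr_natl.
apply: ler_sum => i _.
have bnd z : (z <= k)%N -> 2 * z%:R / W j * l2 f <= W k / W j * l2 f.
  move=> zk; apply: ler_wpM2r; first exact: l2_ge0.
  apply: ler_wpM2r; first by rewrite invr_ge0 ltW // W_gt0.
  by rewrite -natrM ler_nat; lia.
case: (leqP k i) => ki.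
  rewrite -(mulrnBr e ki); apply: le_trans (l2_avg_shift _ _ _) _.
  by apply: bnd; have := ltn_ord i; lia.
have -> : e *+ i - e *+ k = - (e *+ (k - i)) by rewrite mulrnBr ?opprB // ltnW.
apply: le_trans (l2_avg_shiftN _ _ _) _.
by apply: bnd; lia.
Qed.

Section lacunary.
Variables (m : nat -> nat) (n : nat) (r : R).
Hypothesis r0 : 0 < r.
Hypothesis r1 : r < 1.
Hypothesis lac : forall k, (k < n)%N -> W (m k.+1) <= r * W (m k).

Lemma lacunary_iter j k : (j <= k)%N -> (k <= n)%N -> W (m k) <= r ^+ (k - j) * W (m j).
Proof.
elim: k => [|k IH] jk kn.
  by move: jk; rewrite leqn0 => /eqP ->; rewrite expr0 mul1r.
move: jk; rewrite leq_eqVlt => /orP[/eqP <-|]; first by rewrite subnn expr0 mul1r.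
rewrite ltnS => jk; apply: le_trans (lac kn) _.
rewrite subSn // exprS -mulrA ler_pM2l //; apply: IH => //; exact: ltnW.
Qed.

Lemma lacunary_le j k : (j <= k)%N -> (k <= n)%N -> W (m k) <= W (m j).
Proof.
move=> jk kn; apply: le_trans (lacunary_iter jk kn) _.
by rewrite ler_piMl ?(ltW (W_gt0 _)) // exprn_ile1 // ltW.
Qed.

Lemma avg_diff_sym k f g : ip (avg_diff e m k f) g = ip f (avg_diff e m k g).
Proof.
rewrite /avg_diff /ip.
under eq_bigr => x _ do rewrite mulrBl.
under [RHS]eq_bigr => x _ do rewrite mulrBr.
by rewrite !sumrB; congr (_ - _); exact: avg_sym.
Qed.

Lemma avg_diff_comm j k f :
  avg_diff e m j (avg_diff e m k f) = avg_diff e m k (avg_diff e m j f).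
Proof.
apply/funext => x; rewrite /avg_diff !avgB.
by rewrite !(avg_comm (m j.+1)) !(avg_comm (m j)); lra.
Qed.

Lemma avg_diff_linear k p (a : nat -> R) (F : nat -> G -> R) :
  avg_diff e m k (fun x => \sum_(i < p) a i * F i x) =
  (fun x => \sum_(i < p) a i * avg_diff e m k (F i) x).
Proof.
apply/funext => x; rewrite /avg_diff !avg_linear -sumrB.
by apply: eq_bigr => i _; rewrite mulrBr.
Qed.

(** When j < k, the averages in the k-th difference are much shorter than those
    in the j-th one, and a short average hardly changes a long one. *)
Lemma avg_diff_decay j k f : (j < n)%N -> (k < n)%N ->
  l2 (avg_diff e m j (avg_diff e m k f)) <= 4 / r * r ^+ (j - k + (k - j)) * l2 f.
Proof.
wlog jk : j k / (j <= k)%N => [th|] jn kn.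
  case: (leqP j k) => [|/ltnW] h; first exact: th.
  by rewrite avg_diff_comm addnC; exact: th.
have avgdiff i : (i <= n)%N -> l2 (avg e (m i) (avg_diff e m k f)) <= 2 * (W (m k) / W (m i)) * l2 f.
  move=> iin; rewrite /avg_diff avgB.
  rewrite (eq_l2 (g := fun x => (avg e (m i) (avg e (m k.+1) f) x - avg e (m i) f x)
     - (avg e (m i) (avg e (m k) f) x - avg e (m i) f x))); last by move=> x; lra.
  apply: le_trans (l2B _ _) _.
  have h1 := l2_avg_avg (m i) (m k.+1) f; have h2 := l2_avg_avg (m i) (m k) f.
  have h3 : W (m k.+1) / W (m i) * l2 f <= W (m k) / W (m i) * l2 f.
    apply: ler_wpM2r; first exact: l2_ge0.
    apply: ler_wpM2r; first by rewrite invr_ge0 ltW // W_gt0.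
    exact: lacunary_le.
  by move: h1 h2 h3; set A := W (m k) / W (m i); set B := W (m k.+1) / W (m i); lra.
have [ejk|njk] := eqVneq j k.
  rewrite -{}ejk in kn avgdiff *; rewrite subnn expr0 mulr1.
  have b1 g : l2 (avg_diff e m j g) <= 2 * l2 g.
    apply: le_trans (l2B _ _) _.
    have := l2_avg (m j.+1) g; have := l2_avg (m j) g; lra.
  have := b1 (avg_diff e m j f); have := b1 f => h1 h2.
  have r4 : 4 <= 4 / r by rewrite ler_pdivlMr // -[leRHS]mulr1 ler_pM2l // ltW.
  have := ler_wpM2r (l2_ge0 f) r4; lra.
have ltjk : (j < k)%N by rewrite ltn_neqAle njk.
have -> : (j - k + (k - j) = (k - j.+1).+1)%N by lia.
rewrite exprS mulrA divfK ?gt_eqF // {1}/avg_diff.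
apply: le_trans (l2B _ _) _.
have h1 := avgdiff j.+1 jn; have h2 := avgdiff j (ltnW jn).
have c1 : W (m k) / W (m j.+1) <= r ^+ (k - j.+1).
  by rewrite ler_pdivrMr ?W_gt0 //; exact: lacunary_iter ltjk (ltnW kn).
have c2 : W (m k) / W (m j) <= r ^+ (k - j.+1).
  apply: le_trans c1; apply: ler_wpM2l; first exact: ltW (W_gt0 _).
  by rewrite lef_pV2 ?posrE ?W_gt0 //; exact: lacunary_le.
move: h1 h2 (ler_wpM2r (l2_ge0 f) c1) (ler_wpM2r (l2_ge0 f) c2).
by set A := W (m k) / W (m j); set B := W (m k) / W (m j.+1); lra.
Qed.

End lacunary.
End averages.

Lemma avg_transform_l2 (R : realType) (r : R) : 0 < r -> r < 1 ->
  exists2 C : R, 0 < C & forall (G : finZmodType) (e : G) (m : nat -> nat) (n : nat)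
    (a : nat -> R) (f : G -> R),
    (forall k, (k < n)%N -> (m k.+1).*2.+1%:R <= r * (m k).*2.+1%:R) ->
    (forall k, `|a k| <= 1) ->
    l2 (avg_transform e m a n f) ^+ 2 <= C * l2 f ^+ 2.
Proof.
(* s is the fourth root of r: the decay is required as a fourth power. *)
move=> r0 r1; pose s := Num.sqrt (Num.sqrt r).
have s4 : s ^+ 4 = r by rewrite (exprM _ 2 2) !sqr_sqrtr // ?sqrtr_ge0 // ltW.
have s0 : 0 < s by rewrite !sqrtr_gt0.
have s1 : s < 1.
  by rewrite ltNge; apply/negP => h; have := exprn_ege1 4 h; rewrite s4; lra.
exists (4 / r * (2 / (1 - s)) ^+ 2).
  by apply: mulr_gt0; [apply: divr_gt0|apply: exprn_gt0; apply: divr_gt0; lra].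
move=> G e m n a f lac a1.
apply: (almost_orthogonal_sum (B := avg_diff e m)) => //.
- by apply: divr_ge0 => //; exact: ltW.
- by move=> *; exact: avg_diff_linear.
- by move=> *; exact: avg_diff_sym.
- by move=> *; exact: avg_diff_comm.
- move=> j k g jn kn; rewrite -exprM mulnC exprM s4.
  exact: avg_diff_decay lac _ _ _ jn kn.
Qed.

(** * Dyadic blocks and the maximal function of a cyclic group *)

Lemma sum_inj_le (R : realType) (I G : finType) (P : pred G) (h : I -> G) (F : G -> R) :
  injective h -> (forall i, P (h i)) -> (forall y, 0 <= F y) ->
  \sum_i F (h i) <= \sum_(y | P y) F y.
Proof.
move=> hi hP F0.
have -> : \sum_i F (h i) = \sum_(y in imset h (mem predT)) F y.
  by rewrite big_imset //= => ? ? _ _; exact: hi.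
rewrite [leRHS](bigID (mem (imset h (mem predT)))) /= -[leLHS]addr0; apply: lerD; last exact: sumr_ge0.
rewrite le_eqVlt; apply/orP; left; apply/eqP; apply: eq_bigl => y.
by apply/idP/andP => [/[dup] /imsetP[i _ ->] ->|[]//]; rewrite hP.
Qed.

Section nat_count.
Local Open Scope nat_scope.
Lemma sum_modn (F : nat -> nat) (q L : nat) :
  \sum_(0 <= u < q * L) F (u %% L) = q * \sum_(0 <= i < L) F i.
Proof.
elim: q => [|q IH]; first by rewrite !mul0n big_geq.
rewrite mulSn addnC (big_cat_nat (n := q * L)) //=; last exact: leq_addr.
rewrite IH mulSn addnC; congr (_ + _).
rewrite -{1}[q * L]add0n big_addn addKn; apply: eq_big_nat => i /andP[_ iL].
by rewrite addnC modnMDl modn_small.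
Qed.

Lemma sum_middle (b : nat) : \sum_(0 <= i < 4 * b) (b <= i < 3 * b) = 2 * b.
Proof.
rewrite (big_cat_nat (n := b)) //=; last lia.
rewrite (big_cat_nat (n := 3 * b) (m := b)) //=; [|lia|lia].
rewrite (eq_big_nat _ _ (F2 := fun=> 0)); last by move=> i ?; lia.
rewrite (eq_big_nat (m := b) _ _ (F2 := fun=> 1)); last by move=> i ?; lia.
rewrite (eq_big_nat (m := 3 * b) _ _ (F2 := fun=> 0)); last by move=> i ?; lia.
by rewrite !sum_nat_const_nat; lia.
Qed.
End nat_count.

Section dyadic.
Variables (R : realType) (n : nat).
Hypothesis n0 : (0 < n)%N.
Local Notation N := (2 ^ n)%N.
Local Notation G := 'Z_(2 ^ n).
Implicit Types (x y : G) (f w : G -> R).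

Definition dyadic_block (t : nat) (x : G) : nat := ((x : nat) %/ 2 ^ (n - t))%N.
Local Notation blk := dyadic_block.

Lemma N_gt1 : (1 < N)%N.
Proof. by rewrite -{1}(expn0 2) ltn_exp2l. Qed.

Lemma cardZN : #|G| = N.
Proof. by rewrite card_ord Zp_cast // N_gt1. Qed.

Lemma ltZN x : ((x : nat) < N)%N.
Proof. by have := ltn_ord x; rewrite {2}Zp_cast // N_gt1. Qed.

Lemma natr_ZN k : (k < N)%N -> nat_of_ord (k%:R : G) = k.
Proof. by move=> kN; rewrite val_Zp_nat ?N_gt1 // modn_small. Qed.

Lemma dyadic_refining : refining blk.
Proof.
move=> t x y; rewrite /dyadic_block => h.
case: (ltnP t n) => tn; last first.
  by move: h; rewrite (_ : n - t.+1 = n - t)%N //; lia.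
have -> : (n - t = (n - t.+1).+1)%N by lia.
by rewrite expnSr !divnMA h.
Qed.

Lemma card_dyadic_block t x : #|[pred y | blk t y == blk t x]| = (2 ^ (n - t))%N.
Proof.
set L := (2 ^ (n - t))%N; have L0 : (0 < L)%N by rewrite expn_gt0.
have [q Nq] : exists q, N = (q * L)%N.
  by exists (2 ^ (n - (n - t)))%N; rewrite -expnD; congr (_ ^ _)%N; lia.
set b := blk t x; have bq : (b < q)%N by rewrite ltn_divLR // -Nq ltZN.
have bL i : (i < L)%N -> (b * L + i < N)%N.
  by move=> iL; rewrite Nq; have := leq_mul bq (leqnn L); lia.
pose h (i : 'I_L) : G := (b * L + i)%:R.
have hv (i : 'I_L) : nat_of_ord (h i) = (b * L + i)%N by rewrite natr_ZN // bL.
have hinj : injective h.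
  by move=> i j /(congr1 (@nat_of_ord _)); rewrite !hv => /addnI/val_inj.
rewrite -[RHS]card_ord -(card_codom hinj); apply: eq_card => y; rewrite !inE.
apply/eqP/codomP => [yb|[i ->]]; last by rewrite /dyadic_block hv divnMDl // divn_small ?addn0.
exists (Ordinal (ltn_pmod y L0)); apply: val_inj; rewrite /= hv /=.
by rewrite -yb /dyadic_block -divn_eq.
Qed.

Lemma dyadic_doubling : doubling blk.
Proof.
move=> t x; rewrite !card_dyadic_block -expnS leq_exp2l //; lia.
Qed.

Lemma dyadic_separates y z : blk n y = blk n z -> y = z.
Proof. by rewrite /dyadic_block subnn expn0 !divn1 => /val_inj. Qed.

Lemma cexp_dyadic t f x :
  cexp blk t f x = (\sum_(y | blk t y == blk t x) f y) / (2 ^ (n - t))%:R.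
Proof. by rewrite /cexp card_dyadic_block. Qed.

Lemma dyadic_block0 x : blk 0 x = 0%N.
Proof. by rewrite /dyadic_block subn0 divn_small // ltZN. Qed.

Lemma cexp0_mean f x : cexp blk 0 f x = (\sum_y f y) / N%:R.
Proof.
rewrite cexp_dyadic subn0; congr (_ / _); apply: eq_bigl => y.
by rewrite !dyadic_block0.
Qed.

(** A block of length L lies in the window of half-length L around any of its
    points.  The position is recorded as a natural number d so that
    later index computations stay in nat. *)
Lemma dyadic_near t x y : blk t y = blk t x -> exists2 d,
  (d < 2 * 2 ^ (n - t))%N & y = x - (2 ^ (n - t))%:R + d%:R.
Proof.
set L := (2 ^ (n - t))%N; have L0 : (0 < L)%N by rewrite expn_gt0.
rewrite /dyadic_block -/L => h.
have hx := divn_eq x L; have hy := divn_eq y L; rewrite h in hy.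
have := ltn_pmod x L0; have := ltn_pmod y L0 => ly lx.
exists (y + L - x)%N; first lia.
rewrite natrB; last lia.
by rewrite natrD !natr_Zp addrC addrA subrK addrK.
Qed.

(** The dyadic maximal function averaged over all translations of the dyadic
    grid.  Unlike that of a single grid it dominates means over arbitrary
    windows. *)
Definition max_fun (w : G -> R) (x : G) : R :=
  (\sum_(om : G) runmax (fun t => cexp blk t (fun y => w (y - om))) n (x + om)) / #|G|%:R.

Lemma card_ZN_gt0 : (0 < #|G|)%N.
Proof. by rewrite cardZN expn_gt0. Qed.

Lemma runmax_cexp_ge0 w t x : (forall y, 0 <= w y) ->
  0 <= runmax (fun t => cexp blk t w) t x.
Proof.
by move=> w0; apply: le_trans (runmax_ge _ _ _); exact: cexp_ge0.
Qed.

Lemma max_fun_ge0 w x : (forall y, 0 <= w y) -> 0 <= max_fun w x.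
Proof.
by move=> w0; rewrite divr_ge0 // sumr_ge0 // => om _; exact: (@runmax_cexp_ge0 (fun y => w (y - om))).
Qed.

Lemma mean_le_max_fun w x : (forall y, 0 <= w y) -> \sum_y w y <= N%:R * max_fun w x.
Proof.
move=> w0; have N0 : 0 < N%:R :> R by rewrite ltr0n expn_gt0.
rewrite /max_fun cardZN [leRHS]mulrC divfK ?gt_eqF //.
apply: (@le_trans _ _ (\sum_(om : G) (\sum_y w y) / N%:R)).
  by rewrite sumr_const cardZN -[leRHS]mulr_natr divfK ?gt_eqF.
apply: ler_sum => om _.
apply: le_trans (runmax_le (fun t => cexp blk t (fun y => w (y - om))) _ (leq0n n)).
by rewrite cexp0_mean (sum_translate w).
Qed.

(** Let b be a power of 2 with rho <= b < 2 rho.  The window of half-length rho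
    around x lies in a block of length 4 b as soon as x falls in the middle half
    of that block, and this happens for one half of the translations of the
    grid. *)
Lemma window_le_max_fun w x (rho : nat) : (0 < rho)%N -> (8 * rho <= N)%N ->
  (forall y, 0 <= w y) ->
  wsum 1 w (x - rho%:R) rho.*2.+1 <= (16 * rho)%:R * max_fun w x.
Proof.
move=> rho0 rhoN w0.
have [i bi1 bi2] : exists2 i, (rho <= 2 ^ i)%N & (2 ^ i < 2 * rho)%N.
  case: (ltnP 1 rho) => r1; last first.
    by exists 0%N; rewrite expn0; lia.
  have /andP[h1 h2] := up_log_bounds (isT : 1 < 2)%N r1.
  exists (up_log 2 rho) => //.
  by case: (up_log 2 rho) h1 => [|k] /= h1; rewrite ?expn0 ?expnS; lia.
set b := (2 ^ i)%N in bi1 bi2; have b0 : (0 < b)%N by rewrite expn_gt0.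
have iN : (i.+2 < n.+1)%N.
  rewrite ltnS -(leq_exp2l _ _ (isT : 1 < 2)%N) !expnS -/b; lia.
set t := (n - i.+2)%N; have tn : (n - t = i.+2)%N by lia.
have Lb : (2 ^ (n - t) = 4 * b)%N by rewrite tn !expnS -/b; lia.
set S := wsum _ _ _ _; have S0 : 0 <= S by apply: sumr_ge0.
have [q Nq] : exists q, N = (q * (4 * b))%N.
  by exists (2 ^ (n - i.+2))%N; rewrite -Lb tn -expnD; congr (_ ^ _)%N; lia.
(* The middle half of a block of length 4 b; b >= rho leaves room for the
   window on both sides. *)
pose good (u : G) := (b <= u %% (4 * b) < 3 * b)%N.
have key om : good (x + om) ->
    S / (4 * b)%:R <= runmax (fun t => cexp blk t (fun y => w (y - om))) n (x + om).
  move=> /andP[g1 g2]; apply: le_trans (runmax_le (s := t) (t := n) _ _ (leq_subr _ _)).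
  rewrite cexp_dyadic Lb ler_pM2r ?invr_gt0 ?ltr0n ?muln_gt0 //.
  set u := x + om in g1 g2 *.
  have uq := divn_eq u (4 * b); have uN := ltZN u.
  have uq2 : (u %/ (4 * b) < q)%N by rewrite ltn_divLR ?muln_gt0 // -Nq.
  have uub : (u + rho < N)%N.
    have h := leq_mul uq2 (leqnn (4 * b)); rewrite -Nq in h.
    by move: h uq g2; move: (u %/ (4 * b))%N (u %% (4 * b))%N => d c; lia.
  have ur : (rho <= u)%N by exact: leq_trans (leq_trans bi1 g1) (leq_mod _ _).
  pose h (j : 'I_rho.*2.+1) : G := (u - rho + j)%:R.
  have hN (j : 'I_rho.*2.+1) : (u - rho + j < N)%N by have := ltn_ord j; lia.
  have hE j : h j = u - rho%:R + j%:R.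
    by rewrite /h natrD natrB ?natr_Zp.
  rewrite (_ : S = \sum_j (fun y => w (y - om)) (h j)); last first.
    apply: eq_bigr => j _; congr w; rewrite hE /u.
    by rewrite (addrAC (x + om - rho%:R)) (addrAC (x + om)) addrK.
  apply: sum_inj_le => //.
    by move=> j k /(congr1 (@nat_of_ord _)); rewrite !natr_ZN // => /addnI/val_inj.
  move=> j; rewrite /dyadic_block Lb natr_ZN //.
  have -> : (u - rho + j = u %/ (4 * b) * (4 * b) + (u %% (4 * b) - rho + j))%N by lia.
  have sm : (u %% (4 * b) - rho + j < 4 * b)%N.
    by have := ltn_ord j; move: g1 g2; move: (u %% (4 * b))%N => c; lia.
  have b40 : (0 < 4 * b)%N by rewrite muln_gt0.
  by rewrite divnMDl // (divn_small sm) addn0.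
have cnt : (\sum_(om : G) (good (x + om)%R : nat) = q * (2 * b))%N.
  rewrite -[LHS](reindex_inj (P := predT) (F := fun u : G => good u : nat) (addrI x)) /=.
  rewrite -(big_mkord predT (fun u => (b <= u %% (4 * b) < 3 * b)%N : nat)) Zp_cast ?N_gt1 //.
  by rewrite Nq (sum_modn (fun i => (b <= i < 3 * b)%N : nat)) sum_middle.
have N0 : 0 < N%:R :> R by rewrite ltr0n expn_gt0.
have low : (q * (2 * b))%:R * (S / (4 * b)%:R) <= N%:R * max_fun w x.
  rewrite /max_fun cardZN [leRHS]mulrC divfK ?gt_eqF // -cnt natr_sum mulr_suml.
  apply: ler_sum => om _; case: (boolP (good (x + om))) => [/key|_]; first by rewrite mul1r.
  by rewrite mul0r (@runmax_cexp_ge0 (fun y => w (y - om))).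
have M0 := max_fun_ge0 x w0.
apply: (@le_trans _ _ ((8 * b)%:R * max_fun w x)); last first.
  apply: ler_wpM2r => //; rewrite ler_nat; lia.
have b0R : 0 < b%:R :> R by rewrite ltr0n.
have q0R : 0 < q%:R :> R by rewrite ltr0n; move: N0; rewrite Nq ltr0n muln_gt0 => /andP[].
move: low; rewrite Nq !natrM => low.
have c0 : 0 < q%:R / 2 :> R by rewrite divr_gt0.
rewrite -(ler_pM2l c0); apply: le_trans (le_trans low _); rewrite le_eqVlt; apply/orP; left; apply/eqP.
  by field; rewrite gt_eqF.
by field.
Qed.

End dyadic.

(** Jensen's inequality in the translation parameter, then Doob's inequality for
    each translated grid. *)
Lemma max_fun_bounded (R : realType) (q : R) : 1 < q -> exists2 C : R, 0 < C &
  forall (n : nat) (w : 'Z_(2 ^ n) -> R), (0 < n)%N -> (forall y, 0 <= w y) ->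
    \sum_x max_fun w x `^ q <= C * \sum_x w x `^ q.
Proof.
move=> q1; have [C C0 HC] := doob_maximal q1.
exists C => // n w n0 w0.
have N0 : 0 < #|'Z_(2 ^ n)|%:R :> R by rewrite ltr0n card_ZN_gt0.
apply: (@le_trans _ _ (\sum_x (\sum_(om : 'Z_(2 ^ n))
   runmax (fun t => cexp (dyadic_block (n := n)) t (fun y => w (y - om))) n (x + om) `^ q)
     / #|'Z_(2 ^ n)|%:R)).
  apply: ler_sum => x _; apply: power_mean => //; first exact: card_ZN_gt0.
  by move=> om; apply: (@runmax_cexp_ge0 _ _ (fun y => w (y - om))).
rewrite -mulr_suml ler_pdivrMr // exchange_big /=.
apply: (@le_trans _ _ (\sum_(om : 'Z_(2 ^ n)) C * \sum_x w x `^ q)).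
  apply: ler_sum => om _.
  rewrite (sum_translate (fun x => runmax _ n x `^ q)).
  apply: le_trans (HC _ _ (fun y => w (y - om)) n _ _) _ => //; first exact: dyadic_refining.
  by rewrite (sum_translate (fun x => w x `^ q)).
by rewrite sumr_const -[leLHS]mulr_natr.
Qed.

(** * Oscillation of lacunary transforms over dyadic blocks *)

Lemma cexp_variance_le (R : realType) (G : finType) (blk : nat -> G -> nat) t
    (g : G -> R) x c :
  cexp blk t (fun y => (g y - cexp blk t g y) ^+ 2) x <=
  cexp blk t (fun y => (g y - c) ^+ 2) x.
Proof.
have k0 := card_block_gt0 R blk t x.
set mu := cexp blk t g x.
have -> : cexp blk t (fun y => (g y - cexp blk t g y) ^+ 2) x =
    cexp blk t (fun y => (g y - mu) ^+ 2) x.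
  congr (_ / _); apply: eq_bigr => y /eqP yx.
  by rewrite (cexp_adapted g yx).
rewrite /cexp ler_pM2r ?invr_gt0 //.
have e : \sum_(y | blk t y == blk t x) (g y - mu) = 0.
  rewrite sumrB sumr_const /mu /cexp -[X in _ - X]mulr_natr.
  by rewrite divfK ?subrr // gt_eqF.
rewrite -subr_ge0 -sumrB.
rewrite (eq_bigr (fun y => 2 * (mu - c) * (g y - mu) + (mu - c) ^+ 2)).
  by rewrite big_split /= -mulr_sumr e mulr0 add0r sumr_ge0 // => y _; exact: sqr_ge0.
by move=> y _; ring.
Qed.

Lemma sqr_sum_le (R : realType) (z : nat) (F : 'I_z -> R) :
  (\sum_j F j) ^+ 2 <= z%:R * \sum_j F j ^+ 2.
Proof.
have := norm_ip_le F (fun=> 1); rewrite {1}/ip.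
under eq_bigr => j _ do rewrite mulr1.
move=> h; have : `|\sum_j F j| ^+ 2 <= (l2 F * l2 (fun _ : 'I_z => 1 : R)) ^+ 2.
  by rewrite ler_pXn2r ?nnegrE ?normr_ge0 ?mulr_ge0 ?l2_ge0.
rewrite real_normK ?num_real // exprMn !sqr_l2 {2}/ip mulr1 sumr_const card_ord mulrC.
by congr (_ <= _ * _); apply: eq_bigr => j _; rewrite expr2.
Qed.

(** The terms grow at least geometrically with k until w k falls to L, and none
    exceeds 1; the induction carries along the bound by a multiple of the last
    term. *)
Lemma lacunary_sqrt_sum (R : realType) (r L : R) (w : nat -> R) (s : nat) :
  0 < r -> r < 1 -> 0 < L -> (forall k, 0 < w k) ->
  (forall k, (k < s)%N -> w k.+1 <= r * w k) ->
  \sum_(k < s.+1) (if L < w k then Num.sqrt (L / w k) else 0) <= (1 - Num.sqrt r)^-1.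
Proof.
move=> r0 r1 L0 w0; set q := Num.sqrt r.
have q0 : 0 < q by rewrite sqrtr_gt0.
have q1 : q < 1 by rewrite -sqrtr1 ltr_sqrt.
have q10 : 0 < 1 - q by lra.
have qi0 : 0 < (1 - q)^-1 by rewrite invr_gt0.
have Lw0 k : 0 <= L / w k by apply: ltW; exact: divr_gt0.
pose v k := if L < w k then Num.sqrt (L / w k) else 0.
have le1 k : L < w k -> Num.sqrt (L / w k) <= 1.
  move=> h; rewrite -sqrtr1 ler_sqrt //; rewrite ler_pdivrMr // mul1r; exact: ltW.
move=> lac; suff : \sum_(k < s.+1) v k <= (1 - q)^-1 /\
   (L < w s -> \sum_(k < s.+1) v k <= Num.sqrt (L / w s) / (1 - q)) by case.
elim: s lac => [|s IH] lac.
  rewrite big_ord_recl big_ord0 addr0 /v; case: ifP => [h|_]; split => [|//].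
  - apply: le_trans (le1 _ h) _; rewrite invf_ge1 //; lra.
  - by move=> _; rewrite ler_peMr ?sqrtr_ge0 // invf_ge1 //; lra.
  - exact: ltW.
have [IH1 IH2] := IH (fun k ks => lac k (leqW ks)).
rewrite big_ord_recr /= {2 4}/v; case: ifP => [h|_]; last by rewrite addr0; split.
have ws := lac s (ltnSn s).
have Lws : L < w s.
  apply: lt_le_trans h _; apply: le_trans ws _.
  by rewrite ler_piMl ?(ltW (w0 _)) // ltW.
have step : Num.sqrt (L / w s) <= q * Num.sqrt (L / w s.+1).
  rewrite /q -(sqrtrM (L / w s.+1) (ltW r0)) ler_sqrt ?(mulr_ge0 (ltW r0)) ?Lw0 //.
  have := ler_wpM2l (Lw0 s.+1) ws; rewrite divfK ?gt_eqF // ler_pdivrMr //.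
  by rewrite (_ : r * _ * _ = L / w s.+1 * (r * w s)) //; ring.
have main : \sum_(i < s.+1) v i + Num.sqrt (L / w s.+1) <= Num.sqrt (L / w s.+1) / (1 - q).
  apply: (@le_trans _ _ (q * Num.sqrt (L / w s.+1) / (1 - q) + Num.sqrt (L / w s.+1))).
    rewrite lerD2r; apply: le_trans (IH2 Lws) _.
    by rewrite ler_pM2r.
  by rewrite le_eqVlt; apply/orP; left; apply/eqP; field; rewrite gt_eqF.
split => //; apply: le_trans main _.
by rewrite ler_piMl ?le1 // ltW.
Qed.

Section window.
Variables (R : realType) (n : nat).
Hypothesis n0 : (0 < n)%N.
Local Notation N := (2 ^ n)%N.
Local Notation G := 'Z_(2 ^ n).
Local Notation blk := (@dyadic_block n).
Local Notation W m := (m.*2.+1%:R : R).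
Implicit Types (x y : G) (f g w : G -> R).

Lemma sub_window (e x : G) (g : G -> R) (rho c len : nat) :
  (forall y, 0 <= g y) -> (c + len <= rho.*2.+1)%N ->
  wsum e g (x - e *+ rho + e *+ c) len <= wsum e g (x - e *+ rho) rho.*2.+1.
Proof.
move=> g0 h; have -> : rho.*2.+1 = (c + (len + (rho.*2.+1 - (c + len))))%N by lia.
have w0 z k : 0 <= wsum e g z k by exact: sumr_ge0.
rewrite wsumD wsumD; have := w0 (x - e *+ rho) c.
set u := wsum _ _ (_ + _ + _) _ ; have : 0 <= u by exact: w0.
by lra.
Qed.

Lemma sqr_wsum_le f s z : (wsum 1 f s z) ^+ 2 <= z%:R * wsum 1 (fun y : G => f y ^+ 2) s z.
Proof. exact: sqr_sum_le. Qed.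

(** An average over a window longer than L is nearly constant at distance L:
    moving the window exchanges two groups of z <= L terms, and Cauchy-Schwarz
    bounds each by sqrt z times the l2 norm of f over a window of length
    comparable to m. *)
Lemma avg_near (m L z : nat) f x y : (z <= L)%N -> (L < m.*2.+1)%N ->
  (16 * m.*2.+1 <= N)%N -> y = x + z%:R \/ x = y + z%:R ->
  `|avg 1 m f y - avg 1 m f x| <=
  2 * Num.sqrt (32 * max_fun (fun y => f y ^+ 2) x) * Num.sqrt (L%:R / W m).
Proof.
move=> zL Lw wN yx; set M := max_fun _ x.
have f20 y' : 0 <= f y' ^+ 2 by exact: sqr_ge0.
have M0 : 0 <= M by exact: max_fun_ge0.
have M32 : 0 <= 32 * M by exact: mulr_ge0 (ler0n _ _) M0.
pose w := m.*2.+1.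
have bound s c : s = x - 1 *+ (2 * w) + 1 *+ c -> (c + z <= (2 * w).*2.+1)%N ->
    `|wsum 1 f s z| <= Num.sqrt (32 * M) * Num.sqrt (L%:R * w%:R).
  move=> -> cz.
  have h1 := sqr_wsum_le f (x - 1 *+ (2 * w) + 1 *+ c) z.
  have h2 := sub_window 1 x f20 cz.
  have h3 := @window_le_max_fun _ _ n0 (fun y => f y ^+ 2) x (2 * w)%N _ _ f20.
  have {}h3 : wsum 1 (fun y => f y ^+ 2) (x - 1 *+ (2 * w)) (2 * w).*2.+1 <= (16 * (2 * w))%:R * M.
    by apply: h3; rewrite ?/w; lia.
  rewrite -(ler_pXn2r (ltn0Sn 1)) ?nnegrE ?mulr_ge0 ?sqrtr_ge0 //.
  rewrite exprMn real_normK ?num_real // !sqr_sqrtr ?M32 ?mulr_ge0 //.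
  apply: le_trans h1 _.
  apply: (@le_trans _ _ (L%:R * (32 * w%:R * M))); last by rewrite le_eqVlt; apply/orP; left; apply/eqP; ring.
  apply: ler_pM => //; first exact: sumr_ge0.
    by rewrite ler_nat.
  apply: le_trans h2 _; apply: le_trans h3 _.
  by rewrite !natrM mulrA -natrM.
have fin s1 s2 c1 c2 : s1 = x - 1 *+ (2 * w) + 1 *+ c1 -> s2 = x - 1 *+ (2 * w) + 1 *+ c2 ->
   (c1 + z <= (2 * w).*2.+1)%N -> (c2 + z <= (2 * w).*2.+1)%N ->
   `|(wsum 1 f s1 z - wsum 1 f s2 z) / W m| <= 2 * Num.sqrt (32 * M) * Num.sqrt (L%:R / W m).
  move=> e1 e2 l1 l2; rewrite normrM normfV normr_nat ler_pdivrMr ?W_gt0 //.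
  have -> : 2 * Num.sqrt (32 * M) * Num.sqrt (L%:R / W m) * W m = 2 * (Num.sqrt (32 * M) * Num.sqrt (L%:R * w%:R)).
    rewrite -!mulrA; congr (_ * (_ * _)).
    have -> : L%:R * w%:R = L%:R / W m * W m ^+ 2.
      by rewrite /w; field; rewrite gt_eqF // W_gt0.
    by rewrite [in RHS]sqrtrM ?divr_ge0 // sqrtr_sqr normr_nat.
  have := ler_normB (wsum 1 f s1 z) (wsum 1 f s2 z).
  have := bound _ _ e1 l1; have := bound _ _ e2 l2; lra.
case: yx => [->|yx].
  rewrite -mulrBl [x + _ - _]addrAC wsum_slide.
  apply: (fin _ _ (w + (w + (w - m)))%N (w + (w - m))%N); rewrite ?/w; try lia.
    by rewrite !mulrnDr mulrnBr; [ring|lia].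
  by rewrite !mulrnDr mulrnBr; [ring|lia].
rewrite distrC.
have -> : avg 1 m f x - avg 1 m f y =
    (wsum 1 f (y - 1 *+ m + 1 *+ m.*2.+1) z - wsum 1 f (y - 1 *+ m) z) / W m.
  by rewrite yx -mulrBl [y + _ - _]addrAC wsum_slide.
have -> : y = x - z%:R by rewrite yx addrK.
apply: (fin _ _ (w + (2 * w - z - m))%N (2 * w - z - m)%N); rewrite ?/w; try lia.
  by rewrite mulrnDr !mulrnBr; [ring|lia|lia].
by rewrite !mulrnBr; [ring|lia|lia].
Qed.

Definition restrict_window x (rho : nat) f (z : G) : R :=
  if [exists j : 'I_rho.*2.+1, z == x - rho%:R + j%:R] then f z else 0.

Lemma l2_restrict_window x rho f :
  l2 (restrict_window x rho f) ^+ 2 <= wsum 1 (fun y => f y ^+ 2) (x - rho%:R) rho.*2.+1.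
Proof.
rewrite sqr_l2 /ip /wsum.
apply: (@le_trans _ _ (\sum_(z : G) \sum_(j < rho.*2.+1)
    (if z == x - rho%:R + j%:R then f z ^+ 2 else 0))).
  apply: ler_sum => z _; rewrite /restrict_window; case: ifP => [/existsP[j zj]|_].
    rewrite (bigD1 j) //= zj -expr2 lerDl; apply: sumr_ge0 => i _.
    by case: ifP => // _; exact: sqr_ge0.
  by rewrite mul0r; apply: sumr_ge0 => i _; case: ifP => // _; exact: sqr_ge0.
rewrite exchange_big /=; apply: ler_sum => j _.
by rewrite -big_mkcond big_pred1_eq.
Qed.

Lemma avg_restrict_window x y f (L d m : nat) : y = x - L%:R + d%:R ->
  (d < 2 * L)%N -> (m.*2.+1 <= L)%N ->
  avg 1 m (restrict_window x (2 * L) f) y = avg 1 m f y.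
Proof.
clear n0; move=> -> dL mL; congr (_ / _); apply: eq_bigr => j _.
rewrite /restrict_window ifT //; apply/existsP.
have h : (L + d - m + j < (2 * L).*2.+1)%N by have := ltn_ord j; lia.
exists (Ordinal h); apply/eqP => /=.
by rewrite natrD natrB ?natrD ?natrM; [ring|lia].
Qed.

Lemma sqrD_le2 (a b : R) : (a + b) ^+ 2 <= 2 * a ^+ 2 + 2 * b ^+ 2.
Proof. by have := sqr_ge0 (a - b); lra. Qed.

End window.

(** Fix a block of length L containing x.  Differences of two averages of length
    at most L only see f near x, and the l2 bound applies to them after
    restriction of f to a window.  Differences of two longer averages vary little
    over the block by [avg_near], and their variations form a lacunary sum.  At
    most one index is transitional and contributes one average of each kind.  A
    block of length comparable to the order of the group needs the global l2
    bound only. *)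
Lemma oscillation (R : realType) (r : R) : 0 < r -> r < 1 ->
  exists2 C : R, 0 < C & forall (n : nat) (m : nat -> nat) (s : nat)
    (a : nat -> R) (f : 'Z_(2 ^ n) -> R), (0 < n)%N ->
    (forall k, (k < s)%N -> (m k.+1).*2.+1%:R <= r * (m k).*2.+1%:R) ->
    (16 * (m 0%N).*2.+1 <= 2 ^ n)%N ->
    (forall k, `|a k| <= 1) ->
    forall t x, cexp (@dyadic_block n) t (fun y => (avg_transform 1 m a s f y -
        cexp (@dyadic_block n) t (avg_transform 1 m a s f) y) ^+ 2) x
      <= C * max_fun (fun y => f y ^+ 2) x.
Proof.
move=> r0 r1; have [C2 C20 HC2] := avg_transform_l2 r0 r1.
have q1 : Num.sqrt r < 1 by rewrite -sqrtr1 ltr_sqrt.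
pose Q := (1 - Num.sqrt r)^-1; have Q0 : 0 < Q by rewrite invr_gt0; lra.
exists (128 * (C2 + 1) + 1024 * Q ^+ 2).
  by have := sqr_ge0 Q; lra.
move=> n m s a f n0 lac wN a1 t x.
set T := avg_transform 1 m a s; set M := max_fun _ x.
have f20 y' : 0 <= f y' ^+ 2 by exact: sqr_ge0.
have M0 : 0 <= M by exact: max_fun_ge0.
set blk := @dyadic_block n.
set L := (2 ^ (n - t))%N; have L0 : (0 < L)%N by rewrite expn_gt0.
have LR0 : 0 < L%:R :> R by rewrite ltr0n.
have wle k : (k <= s)%N -> ((m k).*2.+1 <= (m 0%N).*2.+1)%N.
  by move=> ks; rewrite -(ler_nat R); apply: (lacunary_le r0 r1 lac) ks.
suff [c hc] : exists c, \sum_(y | blk t y == blk t x) (T f y - c) ^+ 2 <=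
    (128 * (C2 + 1) + 1024 * Q ^+ 2) * L%:R * M.
  apply: le_trans (cexp_variance_le _ _ _ _ c) _.
  rewrite (cexp_dyadic n0) -/L -/blk ler_pdivrMr //.
  by apply: le_trans hc _; rewrite mulrAC.
(* Long blocks first: the comparison with windows of half-length 2 L below
   requires 16 L <= 2^n. *)
have [LN|LN] := ltnP (2 ^ n) (16 * L).
  exists 0; apply: (@le_trans _ _ (l2 (T f) ^+ 2)).
    rewrite sqr_l2 /ip [leRHS](bigID (fun y => blk t y == blk t x)) /= -[leLHS]addr0.
    apply: lerD; last by apply: sumr_ge0 => y _; rewrite -expr2 sqr_ge0.
    by apply: ler_sum => y _; rewrite subr0 expr2.
  apply: le_trans (HC2 _ 1 m s a f lac a1) _.
  have h : l2 f ^+ 2 <= (16 * L)%:R * M.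
    rewrite sqr_l2; apply: (@le_trans _ _ ((2 ^ n)%:R * M)).
      have := mean_le_max_fun n0 x f20; rewrite -/M /ip.
      by under eq_bigr => y _ do rewrite expr2.
    by apply: ler_wpM2r => //; rewrite ler_nat ltnW.
  apply: le_trans (ler_wpM2l (ltW C20) h) _.
  have LM : 0 <= L%:R * M by exact: mulr_ge0 (ltW LR0) M0.
  rewrite natrM -[leRHS]mulrA.
  have -> : C2 * (16 * L%:R * M) = 16 * C2 * (L%:R * M) by ring.
  by apply: ler_wpM2r => //; have := sqr_ge0 Q; lra.
pose f1 := restrict_window x (2 * L) f.
have f1le : l2 f1 ^+ 2 <= 32 * L%:R * M.
  apply: le_trans (l2_restrict_window _ _ _) _.
  apply: le_trans (window_le_max_fun n0 _ _ _ f20) _; [lia|lia|].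
  by rewrite !natrM mulrA -natrM.
(* l marks the averages longer than the block; it decreases with k, so tr marks
   the only index, if any, at which it drops. *)
pose l k : R := (L < (m k).*2.+1)%N%:R.
have l0 k : 0 <= l k by exact: ler0n.
have l1 k : l k <= 1 by rewrite lern1 leq_b1.
have lS k : (k < s)%N -> l k.+1 <= l k.
  move=> ks; rewrite ler_nat.
  have wS : ((m k.+1).*2.+1 <= (m k).*2.+1)%N.
    by rewrite -(ler_nat R); apply: (lacunary_le r0 r1 lac).
  by case: (ltnP L (m k.+1).*2.+1) => // h; rewrite (leq_trans h wS).
have ll k : (k < s)%N -> l k * l k.+1 = l k.+1.
  move=> /lS; rewrite /l; case: (_ < _)%N; case: (_ < _)%N; rewrite ?mul0r ?mul1r //.
  by rewrite ler10.
pose tr k := l k * (1 - l k.+1).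
have tr0 k : 0 <= tr k by rewrite mulr_ge0 // subr_ge0.
have trsum : \sum_(k < s) tr k <= 1.
  have : \sum_(k < s) tr k = l 0%N - l s.
    have := telescope_sumr (fun k => - l k) (leq0n s); rewrite opprK addrC => <-.
    rewrite big_mkord; apply: eq_bigr => k _.
    by rewrite /tr mulrBr mulr1 ll // opprK addrC.
  by have := l0 s; have := l1 0%N; lra.
pose P y := avg_transform 1 m (fun k => a k * (1 - l k)) s f1 y +
   \sum_(k < s) (a k * tr k) * avg 1 (m k.+1) f1 y.
pose df k y := avg 1 (m k) f y - avg 1 (m k) f x.
pose V y := \sum_(k < s) a k * (l k.+1 * df k.+1 y - l k * df k y).
exists (\sum_(k < s) a k * (l k.+1 * avg 1 (m k.+1) f x - l k * avg 1 (m k) f x)).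
have split y : blk t y = blk t x -> T f y -
   (\sum_(k < s) a k * (l k.+1 * avg 1 (m k.+1) f x - l k * avg 1 (m k) f x)) = P y + V y.
  move=> yx; have [d dL yE] := dyadic_near n0 yx.
  rewrite /T /avg_transform /P /V -sumrB -!big_split /=; apply: eq_bigr => k _.
  have loc j : (1 - l j) * avg 1 (m j) f1 y = (1 - l j) * avg 1 (m j) f y.
    rewrite /l; case: ltnP => h; first by rewrite subrr !mul0r.
    by rewrite /f1 (avg_restrict_window f yE dL h).
  have kk := ll k (ltn_ord k).
  have loc1 : tr k * avg 1 (m k.+1) f1 y = tr k * avg 1 (m k.+1) f y.
    by rewrite /tr -!mulrA loc.
  have loc2 : (1 - l k) * avg 1 (m k.+1) f1 y = (1 - l k) * avg 1 (m k.+1) f y.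
    have -> : 1 - l k = (1 - l k) * (1 - l k.+1) by rewrite mulrBr mulr1 mulrBl mul1r kk; lra.
    by rewrite -!mulrA loc.
  rewrite /avg_diff /df.
  have -> : a k * (1 - l k) * (avg 1 (m k.+1) f1 y - avg 1 (m k) f1 y) +
     a k * tr k * avg 1 (m k.+1) f1 y =
     a k * ((1 - l k) * avg 1 (m k.+1) f1 y - (1 - l k) * avg 1 (m k) f1 y + tr k * avg 1 (m k.+1) f1 y).
    by ring.
  have trE : tr k = l k - l k.+1 by rewrite /tr mulrBr mulr1 kk.
  by rewrite loc loc1 loc2 trE; ring.
have P2 : l2 P ^+ 2 <= 2 * (C2 + 1) * (32 * L%:R * M).
  have h1 : l2 (avg_transform 1 m (fun k => a k * (1 - l k)) s f1) ^+ 2 <= C2 * l2 f1 ^+ 2.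
    apply: HC2 => // k; rewrite normrM mulr_ile1 //.
    by rewrite ger0_norm ?subr_ge0 // gerBl.
  have h2 : l2 (fun y => \sum_(k < s) (a k * tr k) * avg 1 (m k.+1) f1 y) <= l2 f1.
    apply: le_trans (l2_sum s (fun k y => a k * tr k * avg 1 (m k.+1) f1 y)) _.
    apply: (@le_trans _ _ (\sum_(k < s) tr k * l2 f1)).
      apply: ler_sum => k _; rewrite l2Z; apply: ler_pM => //; first exact: l2_ge0.
        by rewrite normrM [`|tr k|]ger0_norm // ler_piMl.
      exact: l2_avg.
    by rewrite -mulr_suml ler_piMl // l2_ge0.
  have h3 := l2D (avg_transform 1 m (fun k => a k * (1 - l k)) s f1)
     (fun y => \sum_(k < s) (a k * tr k) * avg 1 (m k.+1) f1 y).
  apply: (@le_trans _ _ (2 * (C2 + 1) * l2 f1 ^+ 2)); last first.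
    by apply: ler_wpM2l => //; lra.
  apply: (@le_trans _ _ ((l2 (avg_transform 1 m (fun k => a k * (1 - l k)) s f1) + l2 f1) ^+ 2)).
    rewrite ler_pXn2r ?nnegrE ?addr_ge0 ?l2_ge0 //.
    by apply: le_trans h3 _; rewrite lerD2l.
  by apply: le_trans (sqrD_le2 _ _) _; lra.
have V2 y : blk t y = blk t x -> V y ^+ 2 <= 512 * Q ^+ 2 * M.
  move=> yx; have [d dL yE] := dyadic_near n0 yx.
  pose D := 2 * Num.sqrt (32 * M); have D0 : 0 <= D by rewrite mulr_ge0 // sqrtr_ge0.
  pose v k := if L%:R < (m k).*2.+1%:R :> R then Num.sqrt (L%:R / (m k).*2.+1%:R) else 0 : R.
  have v0 k : 0 <= v k by rewrite /v; case: ifP => // _; exact: sqrtr_ge0.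
  have dfle k : (k <= s)%N -> l k * `|df k y| <= D * v k.
    move=> ks; rewrite /l /v ltr_nat; case: ltnP => h; last by rewrite mul0r mulr0.
    rewrite mul1r; have h16 : (16 * (m k).*2.+1 <= 2 ^ n)%N by apply: leq_trans wN; rewrite leq_mul2l wle.
    case: (leqP L d) => Ld.
      apply: (@avg_near _ _ n0 _ _ (d - L)) => //; first by rewrite leq_subLR addnn -mul2n ltnW.
      by left; rewrite yE natrB //; ring.
    apply: (@avg_near _ _ n0 _ _ (L - d)) => //; first exact: leq_subr.
    by right; rewrite yE natrB ?(ltnW Ld) //; ring.
  have vsum : \sum_(k < s.+1) v k <= Q.
    exact: (@lacunary_sqrt_sum _ r L%:R (fun k => (m k).*2.+1%:R) s).
  have VD : `|V y| <= 2 * D * Q.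
    apply: le_trans (ler_norm_sum _ _ _) _.
    apply: (@le_trans _ _ (\sum_(k < s) (D * v k.+1 + D * v k))).
      apply: ler_sum => k _; rewrite normrM -[leRHS]mul1r; apply: ler_pM => //.
      apply: le_trans (ler_normB _ _) _; rewrite !normrM ![`|l _|]ger0_norm //.
      by apply: lerD; apply: dfle => //; exact: ltnW.
    rewrite big_split /= -!mulr_sumr.
    have e1 : \sum_(k < s) v k.+1 <= \sum_(k < s.+1) v k.
      by rewrite big_ord_recl lerDr.
    have e2 : \sum_(k < s) v k <= \sum_(k < s.+1) v k.
      by rewrite big_ord_recr lerDl /=.
    have := ler_wpM2l D0 (le_trans e1 vsum); have := ler_wpM2l D0 (le_trans e2 vsum); lra.
  rewrite -(real_normK (num_real (V y))).
  apply: (@le_trans _ _ ((2 * D * Q) ^+ 2)).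
    by rewrite ler_pXn2r ?nnegrE ?mulr_ge0 // ltW.
  rewrite !exprMn sqr_sqrtr; last exact: mulr_ge0 (ler0n _ _) M0.
  lra.
apply: (@le_trans _ _ (\sum_(y | blk t y == blk t x) (2 * P y ^+ 2 + 2 * (512 * Q ^+ 2 * M)))).
  apply: ler_sum => y /eqP yx; rewrite split //.
  apply: le_trans (sqrD_le2 _ _) _; rewrite lerD2l ler_pM2l //; exact: V2.
rewrite big_split /= -mulr_sumr sumr_const.
rewrite (_ : #|_| = L); last exact: card_dyadic_block.
have P3 : \sum_(y | blk t y == blk t x) P y ^+ 2 <= l2 P ^+ 2.
  rewrite sqr_l2 /ip [leRHS](bigID (fun y => blk t y == blk t x)) /= -[leLHS]addr0.
  apply: lerD; last by apply: sumr_ge0 => y _; rewrite -expr2 sqr_ge0.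
  by apply: ler_sum => y _; rewrite expr2.
by rewrite -[X in _ + X]mulr_natr; have := le_trans P3 P2; lra.
Qed.

(** * Lacunary transforms on cyclic groups *)

Lemma sum_avg_transform (R : realType) (G : finZmodType) (e : G) m (a : nat -> R) s (f : G -> R) :
  \sum_x avg_transform e m a s f x = 0.
Proof.
have sum_avg k : \sum_x avg e k f x = \sum_x f x.
  rewrite /avg -mulr_suml exchange_big /=.
  rewrite (eq_bigr (fun=> \sum_x f x)); last first.
    by move=> j _; under eq_bigr => x _ do rewrite -addrA; rewrite sum_translate.
  by rewrite sumr_const card_ord -[X in X / _]mulr_natr mulfK // gt_eqF // W_gt0.
rewrite exchange_big big1 //= => k _.
by rewrite -mulr_sumr sumrB !sum_avg subrr mulr0.
Qed.

Lemma avg_transform_sym (R : realType) (G : finZmodType) (e : G) m (a : nat -> R) s (f g : G -> R) :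
  ip (avg_transform e m a s f) g = ip f (avg_transform e m a s g).
Proof.
rewrite (ip_sum s a (fun k => avg_diff e m k f)) [RHS]ipC (ip_sum s a (fun k => avg_diff e m k g)).
by apply: eq_bigr => k _; rewrite avg_diff_sym ipC.
Qed.

(** The condition on [m 0] keeps all windows well below the order of the
    group. *)
Definition discrete_bound (R : realType) (r p C : R) :=
  forall (n : nat) (m : nat -> nat) (s : nat) (a : nat -> R) (f : 'Z_(2 ^ n) -> R),
    (0 < n)%N ->
    (forall k, (k < s)%N -> (m k.+1).*2.+1%:R <= r * (m k).*2.+1%:R) ->
    (16 * (m 0%N).*2.+1 <= 2 ^ n)%N ->
    (forall k, `|a k| <= 1) ->
    \sum_x `|avg_transform 1 m a s f x| `^ p <= C * \sum_x `|f x| `^ p.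

(** A multiple of sqrt (M (f^2)), with M the maximal function, dominates the
    oscillation of the transform, and M is bounded on L^(p/2). *)
Lemma discrete_bound_gt2 (R : realType) (r p : R) : 0 < r -> r < 1 -> 2 < p ->
  exists2 C : R, 0 < C & discrete_bound r p C.
Proof.
move=> r0 r1 p2.
have [C1 C10 H1] := sharp_maximal p2.
have [C2 C20 H2] := oscillation r0 r1.
have p21 : 1 < p / 2 by lra.
have [C3 C30 H3] := max_fun_bounded p21.
exists (C1 * (C2 `^ (p / 2) * C3)).
  by rewrite !mulr_gt0 // powR_gt0.
move=> n m s a f n0 lac wN a1.
have f20 y : 0 <= f y ^+ 2 by exact: sqr_ge0.
pose M x := max_fun (fun y => f y ^+ 2) x.
have M0 x : 0 <= M x by exact: max_fun_ge0.
have CM0 x : 0 <= C2 * M x by rewrite mulr_ge0 // ltW.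
apply: (@le_trans _ _ (C1 * \sum_x Num.sqrt (C2 * M x) `^ p)).
  apply: (H1 _ (@dyadic_block n) _ (fun x => Num.sqrt (C2 * M x)) n).
  - exact: dyadic_refining.
  - exact: dyadic_doubling.
  - exact: dyadic_separates.
  - by move=> x; rewrite cexp0_mean // sum_avg_transform mul0r.
  - by move=> x; exact: sqrtr_ge0.
  - by move=> t x; rewrite sqr_sqrtr //; exact: H2.
rewrite -!mulrA ler_pM2l //.
under eq_bigr => x _ do rewrite powR_sqrt // powRM ?(ltW C20) //.
rewrite -mulr_sumr ler_pM2l ?powR_gt0 //.
apply: le_trans (H3 _ _ n0 f20) _.
by under eq_bigr => x _ do rewrite sqr_powR_half.
Qed.

Lemma discrete_bound_ge2 (R : realType) (r p : R) : 0 < r -> r < 1 -> 2 <= p ->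
  exists2 C : R, 0 < C & discrete_bound r p C.
Proof.
move=> r0 r1; rewrite le_eqVlt => /orP[/eqP <-|]; last exact: discrete_bound_gt2.
have [C C0 HC] := avg_transform_l2 r0 r1; exists C => //.
move=> n m s a f n0 lac wN a1.
have l2E g : \sum_(x : 'Z_(2 ^ n)) `|g x| `^ 2 = l2 g ^+ 2.
  rewrite sqr_l2; apply: eq_bigr => x _.
  by rewrite powR_mulrn // real_normK ?num_real // expr2.
by rewrite !l2E; exact: HC.
Qed.

(** Duality: T f is tested against g = sgn (T f) |T f|^(p-1), for which
    |g|^p' = |T f|^p, and the symmetric operator T is moved over to g. *)
Lemma discrete_bound_lt2 (R : realType) (r p : R) : 0 < r -> r < 1 -> 1 < p -> p < 2 ->
  exists2 C : R, 0 < C & discrete_bound r p C.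
Proof.
move=> r0 r1 p1 p2; have p10 : 0 < p - 1 by lra.
have p0 : 0 < p by lra.
pose p' := p / (p - 1).
have p'2 : 2 <= p' by rewrite ler_pdivlMr //; lra.
have [C' C'0 HC'] := discrete_bound_ge2 r0 r1 p'2.
have d0 : 0 < (2 * C')^-1 by rewrite invr_gt0 mulr_gt0.
have [Y Y0 HY] := young_powR (ltW p10) (@ltr01 R) d0.
exists (2 * Y); first by rewrite mulr_gt0.
move=> n m s a f n0 lac wN a1.
pose T (h : 'Z_(2 ^ n) -> R) := avg_transform 1 m a s h.
pose g x := Num.sg (T f x) * `|T f x| `^ (p - 1).
have gp x : `|g x| `^ p' = `|T f x| `^ p.
  rewrite /g normrM [`|_ `^ _|]ger0_norm ?powR_ge0 // normr_sg.
  have [->|T0] := eqVneq (T f x) 0.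
    by rewrite mul0r normr0 !powR0 ?gt_eqF // divr_gt0.
  by rewrite mul1r -powRrM /p' mulrCA mulfV ?gt_eqF // mulr1.
have Tg x : T f x * g x = `|T f x| `^ p.
  by rewrite /g mulrA [T f x * _]mulrC -normrEsg mulr_powRB1.
have e1 : \sum_x `|T f x| `^ p = \sum_x f x * T g x.
  have := avg_transform_sym 1 m a s f g; rewrite /ip -/T => <-.
  by apply: eq_bigr => x _; rewrite Tg.
have young x : f x * T g x <= (2 * C')^-1 * `|T g x| `^ p' + Y * `|f x| `^ p.
  have := HY (`|T g x| `^ (p - 1)^-1) `|f x| (powR_ge0 _ _) (normr_ge0 _).
  rewrite -!powRrM mulVf ?gt_eqF // !powRr1 // subrK mulrC -normrM [(p - 1)^-1 * p]mulrC.
  exact: le_trans (ler_norm _).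
have : \sum_x f x * T g x <= \sum_x ((2 * C')^-1 * `|T g x| `^ p' + Y * `|f x| `^ p).
  by apply: ler_sum => x _; exact: young.
rewrite -e1 big_split /= -!mulr_sumr.
have := HC' n m s a g n0 lac wN a1; rewrite -/T.
under [X in _ <= C' * X]eq_bigr => x _ do rewrite gp.
set S := \sum_x `|T f x| `^ p; set U := \sum_x `|T g x| `^ p'; set F := \sum_x `|f x| `^ p.
move=> h1 h2.
have : (2 * C')^-1 * U <= 2^-1 * S.
  by rewrite invfM -mulrA ler_pM2l // ler_pdivrMl.
lra.
Qed.

Lemma discrete_Lp_bound (R : realType) (r p : R) : 0 < r -> r < 1 -> 1 < p ->
  exists2 C : R, 0 < C & discrete_bound r p C.
Proof.
move=> r0 r1 p1; case: (leP 2 p) => p2; first exact: discrete_bound_ge2.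
exact: discrete_bound_lt2.
Qed.

(** * Averages over intervals of the real line *)

(** The p-th power of the L^p norm; estimating it directly avoids p-th roots. *)
Definition pow_int (R : realType) (p : R) (f : R -> R) : \bar R :=
  (\int[@lebesgue_measure R]_x (`|f x| `^ p)%:E)%E.

Definition Lp_real (R : realType) (p : R) (f : R -> R) : Prop :=
  measurable_fun [set: measurableTypeR R] f /\ (pow_int p f < +oo)%E.

Definition Avg (R : realType) (e : R) (f : R -> R) (x : R) : R :=
  (2 * e)^-1 * \int[@lebesgue_measure R]_(y in `[x - e, x + e]) f y.

Section continuous_averages.
Variable R : realType.
Local Notation mu := (@lebesgue_measure R).
Implicit Types (f g : R -> R) (F : R -> \bar R) (e p x c : R).

Lemma measurable_add_cst c : measurable_fun [set: measurableTypeR R] (fun x : measurableTypeR R => x + c : measurableTypeR R).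
Proof. by apply: measurable_funD. Qed.

Lemma lebesgue_measure_translate c (A : set R) : measurable A ->
  pushforward mu (fun x : measurableTypeR R => x + c : measurableTypeR R) A = mu A.
Proof.
move=> mA; apply/esym/lebesgue_measure_unique => //=; first exact: measurable_add_cst.
move=> _ _ [[a b]] _ <-.
rewrite /pushforward.
have -> : (fun x : measurableTypeR R => x + c) @^-1` [set` `]a, b]] = [set` `]a - c, b - c]].
  by apply/seteqP; split => x /=; rewrite !in_itv /= ltrBlDr lerBrDr.
rewrite !lebesgue_measure_itv /= !lte_fin ltrD2r; case: ifP => // _.
by rewrite -!EFinD; congr (_%:E); ring.
Qed.

Lemma integral_translate F c : measurable_fun [set: measurableTypeR R] F -> (forall x, (0 <= F x)%E) ->
  (\int[mu]_x F (x + c)%R = \int[mu]_x F x)%E.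
Proof.
move=> mF F0.
have := @ge0_integral_pushforward _ _ _ _ R _ (measurable_add_cst c) mu setT F measurableT mF (fun x _ => F0 x).
rewrite preimage_setT => <-; apply: eq_measure_integral => [|mm A mA _]; first exact: measurable_add_cst.
exact: lebesgue_measure_translate.
Qed.

Lemma measurable_powR_norm p f : measurable_fun [set: measurableTypeR R] f ->
  measurable_fun [set: measurableTypeR R] (fun x => `|f x| `^ p).
Proof.
move=> mf; apply: (measurableT_comp (measurable_powR _)) => //.
exact: measurableT_comp.
Qed.

Lemma measurable_pow_abs p f : measurable_fun [set: measurableTypeR R] f ->
  measurable_fun [set: measurableTypeR R] (fun x => (`|f x| `^ p)%:E).
Proof.
by move=> mf; apply/measurable_EFinP; exact: measurable_powR_norm.
Qed.

Lemma Lp_real_integrable p f a b : 1 < p -> Lp_real p f ->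
  mu.-integrable `[a, b] (EFin \o f).
Proof.
move=> p1 [mf fp].
have mfab : measurable_fun [set` `[a, b]] f by exact: measurable_funS mf.
apply/integrableP; split; first exact/measurable_EFinP.
apply: (@le_lt_trans _ _ (\int[mu]_(x in `[a, b]) ((1 + `|f x| `^ p)%:E))%E).
  apply: ge0_le_integral => //.
  - by apply: measurableT_comp => //; exact/measurable_EFinP.
  - apply/measurable_EFinP; apply: measurable_funD => //.
    apply: (@measurable_funS _ _ _ _ setT) => //.
    exact: measurable_powR_norm.
  - move=> x _ /=; rewrite lee_fin; have [h|h] := leP `|f x| 1.
      by apply: le_trans h _; rewrite lerDl powR_ge0.
    rewrite -[leLHS]add0r lerD // le1r_powR //; exact: ltW.
under eq_integral do rewrite EFinD.
rewrite ge0_integralD //=; last first.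
  by apply: (@measurable_funS _ _ _ _ setT) => //; exact: measurable_pow_abs.
apply: lte_add_pinfty.
  rewrite integral_cst //= mul1e lebesgue_measure_itv /=; case: ifP => // _.
  by rewrite -EFinD ltry.
apply: le_lt_trans fp; apply: ge0_subset_integral => //; first exact: measurable_pow_abs.
Qed.

Lemma measurable_window e :
  measurable_fun [set: measurableTypeR R * measurableTypeR R]
    (fun z => (\1_(`[- e, e] : set R) (z.1 - z.2) : R)).
Proof.
have mg : measurable_fun [set: measurableTypeR R * measurableTypeR R]
    (fun z => (z.1 - z.2 : measurableTypeR R)) by apply: measurable_funB.
have mi : measurable_fun [set: measurableTypeR R] (\1_(`[- e, e] : set (measurableTypeR R)) : measurableTypeR R -> R).
  exact: measurable_indic.
exact: (measurableT_comp mi mg).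
Qed.

Let kernel F e (z : measurableTypeR R * measurableTypeR R) : \bar R :=
  (F z.2 * (\1_(`[- e, e] : set R) (z.1 - z.2))%:E)%E.

Let measurable_kernel F e : measurable_fun [set: measurableTypeR R] F ->
  measurable_fun setT (kernel F e).
Proof.
move=> mF; apply: emeasurable_funM; first by apply: measurableT_comp.
apply/measurable_EFinP; exact: measurable_window.
Qed.

Let kernelE F e x : (\int[mu]_(y in `[(x - e)%R, (x + e)%R]) F y = \int[mu]_y kernel F e (x, y))%E.
Proof.
rewrite integral_mkcond; apply: eq_integral => y _; rewrite /kernel patchE /= indicE.
have -> : (y \in `[(x - e)%R, (x + e)%R]%classic) = ((x - y)%R \in `[(- e)%R, e]%classic).
  by apply/idP/idP; rewrite !inE /= !in_itv /= => /andP[? ?]; apply/andP; split; lra.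
by case: ifP => _; rewrite ?mule1 ?mule0.
Qed.

Lemma measurable_integral_window F e : measurable_fun [set: measurableTypeR R] F ->
  (forall x, (0 <= F x)%E) ->
  measurable_fun [set: measurableTypeR R] (fun x => \int[mu]_(y in `[(x - e)%R, (x + e)%R]) F y)%E.
Proof.
move=> mF F0.
rewrite (_ : (fun x => _) = fubini_F mu (kernel F e)); last by apply/funext => x; exact: kernelE.
apply: measurable_fun_fubini_tonelli_F; first exact: measurable_kernel.
by move=> z; rewrite mule_ge0 // lee_fin.
Qed.

(** Each y lies in the windows of the x with |x - y| <= e, a set of measure
    2 e. *)
Lemma tonelli_window F e : 0 < e -> measurable_fun [set: measurableTypeR R] F ->
  (forall x, (0 <= F x)%E) ->
  (\int[mu]_x \int[mu]_(y in `[(x - e)%R, (x + e)%R]) F y = (2 * e)%:E * \int[mu]_x F x)%E.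
Proof.
move=> e0 mF F0.
have mh := measurable_kernel e mF.
have h0 z : (0 <= kernel F e z)%E by rewrite mule_ge0 // lee_fin.
under eq_integral do rewrite kernelE.
rewrite (@fubini_tonelli _ _ _ _ _ mu mu (kernel F e) mh h0).
rewrite -ge0_integralZl_EFin //; last by rewrite mulr_ge0 // ltW.
apply: eq_integral => y _; rewrite /kernel /=.
rewrite ge0_integralZl //=; last first.
  apply/measurable_EFinP.
  exact: (measurableT_comp (measurable_window e) (pair2_measurable y)).
rewrite muleC; congr (_ * _)%E.
transitivity (\int[mu]_x (\1_(`[(y - e)%R, (y + e)%R]%classic : set R) x)%:E)%E.
  apply: eq_integral => x _; rewrite !indicE; congr ((nat_of_bool _)%:R%:E).
  by apply/idP/idP; rewrite !inE /= !in_itv /= => /andP[? ?]; apply/andP; split; lra.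
rewrite integral_indic //= setIT lebesgue_measure_itv /= lte_fin.
rewrite ifT; last lra.
by rewrite -EFinD; congr (_%:E); lra.
Qed.

Lemma Lp_real_norm p f : Lp_real p f -> Lp_real p (fun x => `|f x|).
Proof.
move=> [mf fp]; split; first exact: measurableT_comp.
by rewrite /pow_int; under eq_integral do rewrite normr_id.
Qed.

Lemma pow_integrable p f (A : set R) : measurable A -> Lp_real p f ->
  mu.-integrable A (fun x => (`|f x| `^ p)%:E).
Proof.
move=> mA [mf fp]; apply: (@integrableS _ _ _ _ setT) => //.
apply/integrableP; split; first exact: measurable_pow_abs.
rewrite (_ : (\int[_]_x _)%E = pow_int p f) //; apply: eq_integral => x _.
by rewrite gee0_abs // lee_fin powR_ge0.
Qed.

Lemma lebesgue_measure_window e x : 0 < e ->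
  mu `[(x - e)%R, (x + e)%R]%classic = (2 * e)%:E.
Proof.
move=> e0; rewrite lebesgue_measure_itv /= lte_fin ifT; last lra.
by rewrite -EFinD; congr (_%:E); lra.
Qed.

Lemma Avg_ge0 e f x : 0 < e -> (forall y, 0 <= f y) -> 0 <= Avg e f x.
Proof.
move=> e0 f0; apply: mulr_ge0; first by rewrite invr_ge0 mulr_ge0 // ltW.
exact: Rintegral_ge0.
Qed.

Lemma Avg_norm_le e p f x : 0 < e -> 1 < p -> Lp_real p f ->
  `|Avg e f x| <= Avg e (fun y => `|f y|) x.
Proof.
move=> e0 p1 Lf; have e2 : 0 < (2 * e)^-1 by rewrite invr_gt0 mulr_gt0.
rewrite /Avg normrM ger0_norm ?(ltW e2) // ler_pM2l //.
by apply: le_normr_Rintegral => //; exact: Lp_real_integrable Lf.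
Qed.

Lemma Avg_jensen e p f x : 0 < e -> 1 < p -> Lp_real p f ->
  (((Avg e (fun y => `|f y|) x) `^ p)%:E <=
   ((2 * e)^-1)%:E * \int[mu]_(y in `[(x - e)%R, (x + e)%R]) (`|f y| `^ p)%:E)%E.
Proof.
move=> e0 p1 Lf; have p0 : 0 < p by lra.
have e20 : 0 < 2 * e by rewrite mulr_gt0.
set I := `[(x - e)%R, (x + e)%R]%classic.
have mI : measurable (I : set (measurableTypeR R)) by exact: measurable_itv.
have muI : mu I = (2 * e)%:E by exact: lebesgue_measure_window.
set A := Avg _ _ _; have A0 : 0 <= A by apply: Avg_ge0.
have if1 : mu.-integrable I (EFin \o (fun y => `|f y|)).
  exact: Lp_real_integrable p1 (Lp_real_norm Lf).
have ifp : mu.-integrable I (EFin \o (fun y => `|f y| `^ p)) by exact: pow_integrable.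
have icst c : mu.-integrable I (EFin \o (fun=> c)).
  apply: measurable_bounded_integrable => //; last exact: bounded_cst.
  by apply: (le_lt_trans _ (ltry (2 * e))); rewrite le_eqVlt; apply/orP; left; apply/eqP; exact: muI.
have key : A `^ (p - 1) * \int[mu]_(y in I) `|f y| <=
    (1 - p^-1) * A `^ p * (2 * e) + p^-1 * \int[mu]_(y in I) (`|f y| `^ p).
  have -> : (1 - p^-1) * A `^ p * (2 * e) = \int[mu]_(y in I) ((1 - p^-1) * A `^ p).
    transitivity ((1 - p^-1) * A `^ p * fine (mu I)); first by rewrite muI.
    by apply/esym; exact: Rintegral_cst.
  have iZ c g : mu.-integrable I (EFin \o g) -> mu.-integrable I (EFin \o (fun y => c * g y)).
    by move=> ig; apply: (@integrableZl _ _ _ mu I mI c (EFin \o g)).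
  have <- : \int[mu]_(y in I) (A `^ (p - 1) * `|f y|) = A `^ (p - 1) * \int[mu]_(y in I) `|f y|.
    exact: RintegralZl.
  have <- : \int[mu]_(y in I) (p^-1 * `|f y| `^ p) = p^-1 * \int[mu]_(y in I) (`|f y| `^ p).
    exact: RintegralZl.
  have <- : \int[mu]_(y in I) ((1 - p^-1) * A `^ p + p^-1 * `|f y| `^ p) =
     \int[mu]_(y in I) ((1 - p^-1) * A `^ p) + \int[mu]_(y in I) (p^-1 * `|f y| `^ p).
    by apply: RintegralD => //; exact: iZ.
  apply: le_Rintegral => //.
  - exact: iZ.
  - exact: (integrableD mI (icst ((1 - p^-1) * A `^ p)) (iZ p^-1 _ ifp)).
  - by move=> y _; exact: young_powR_exact.
have IA : \int[mu]_(y in I) `|f y| = (2 * e) * A by rewrite /A /Avg mulrA divff ?mul1r // gt_eqF.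
rewrite IA mulrCA [A `^ _ * A]mulrC mulr_powRB1 // in key.
have fin : (\int[mu]_(y in I) (`|f y| `^ p)%:E)%E = (\int[mu]_(y in I) (`|f y| `^ p))%:E.
  by rewrite /Rintegral fineK //; exact: integrable_fin_num.
rewrite fin -EFinM lee_fin ler_pdivlMl //.
have pi : 0 < p^-1 by rewrite invr_gt0.
by rewrite -(ler_pM2l pi); move: key; set S := \int[mu]_(y in I) _; lra.
Qed.

Lemma integral_continuous p f a t : 1 < p -> Lp_real p f -> a < t ->
  {for t, continuous (fun s => \int[mu]_(y in `[a, s]) f y)}.
Proof.
move=> p1 Lf ta; have at1 : a < t + 1 by lra.
have := parameterized_integral_continuous (ltW at1) (Lp_real_integrable a (t + 1) p1 Lf).
move=> /continuous_within_itvP => /(_ at1)[h _ _]; apply: h.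
by rewrite in_itv /= ta; lra.
Qed.

(** Through a primitive with a fixed base point, continuity in the centre and
    in the radius both reduce to continuity of the primitive. *)
Lemma Avg_primitive p e f a x : 1 < p -> Lp_real p f -> 0 < e -> a < x - e ->
  Avg e f x = (2 * e)^-1 *
    (\int[mu]_(y in `[a, (x + e)]) f y - \int[mu]_(y in `[a, (x - e)]) f y).
Proof.
move=> p1 Lf e0 ax; congr (_ * _).
rewrite (@Rintegral_itvB _ f (BLeft a) (BRight (x + e)) (x - e)); last 3 first.
- exact: Lp_real_integrable p1 Lf.
- by rewrite bnd_simp ltW.
- by rewrite bnd_simp; lra.
rewrite Rintegral_itv_obnd_cbnd //.
apply: (integrableS _ _ _ (Lp_real_integrable (x - e) (x + e) p1 Lf)) => //.
exact: subset_itv_oc_cc.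
Qed.

Lemma Avg_continuous p e f : 1 < p -> Lp_real p f -> 0 < e -> continuous (Avg e f).
Proof.
move=> p1 Lf e0 x; pose a := x - e - 1.
pose P s := \int[mu]_(y in `[a, s]) f y.
have cP s : a < s -> {for s, continuous P} by move=> sa; exact: integral_continuous p1 Lf sa.
have lim : (fun y => (2 * e)^-1 * (P (y + e) - P (y - e))) y @[y --> x] --> Avg e f x.
  rewrite (@Avg_primitive p e f a x) //; last by rewrite /a; lra.
  apply: cvgM; first exact: cvg_cst.
  apply: cvgB.
    apply: (@cvg_comp _ _ _ (fun y => y + e) P (nbhs x) (nbhs (x + e))).
      by apply: cvgD; [exact: cvg_id|exact: cvg_cst].
    by apply: cP; rewrite /a; lra.
  apply: (@cvg_comp _ _ _ (fun y => y - e) P (nbhs x) (nbhs (x - e))).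
    by apply: cvgB; [exact: cvg_id|exact: cvg_cst].
  by apply: cP; rewrite /a; lra.
apply: cvg_trans lim; apply: near_eq_cvg; near=> y.
rewrite (@Avg_primitive p e f a y) // /a.
have : `|x - y| < 1 by near: y; exact: cvgr_dist_lt.
by rewrite ltr_norml => /andP[? ?]; lra.
Unshelve. all: by end_near. Qed.

Lemma Avg_cvg_radius p f x e (u : nat -> R) : 1 < p -> Lp_real p f -> 0 < e ->
  (forall n, 0 < u n) -> u @ \oo --> e -> Avg (u n) f x @[n --> \oo] --> Avg e f x.
Proof.
move=> p1 Lf e0 u0 ue; pose a := x - e - 1.
pose P s := \int[mu]_(y in `[a, s]) f y.
have cP s : a < s -> {for s, continuous P} by move=> sa; exact: integral_continuous p1 Lf sa.
have lim : (2 * u n)^-1 * (P (x + u n) - P (x - u n)) @[n --> \oo] --> Avg e f x.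
  rewrite (@Avg_primitive p e f a x) //; last by rewrite /a; lra.
  apply: cvgM.
    apply: cvgV; first by rewrite mulf_neq0 // gt_eqF.
    by apply: cvgM => //; exact: cvg_cst.
  apply: cvgB.
    apply: (@cvg_comp _ _ _ (fun n => x + u n) P _ (nbhs (x + e))).
      by apply: cvgD => //; exact: cvg_cst.
    by apply: cP; rewrite /a; lra.
  apply: (@cvg_comp _ _ _ (fun n => x - u n) P _ (nbhs (x - e))).
    by apply: cvgB => //; exact: cvg_cst.
  by apply: cP; rewrite /a; lra.
apply: cvg_trans lim; apply: near_eq_cvg; near=> n.
rewrite (@Avg_primitive p (u n) f a x) // /a.
have : `|e - u n| < 1 by near: n; exact: cvgr_dist_lt.
by rewrite ltr_norml => /andP[? ?]; lra.
Unshelve. all: by end_near. Qed.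

Lemma measurable_Avg p e f : 1 < p -> Lp_real p f -> 0 < e ->
  measurable_fun [set: measurableTypeR R] (Avg e f).
Proof.
by move=> p1 Lf e0; apply: continuous_measurable_fun; exact: Avg_continuous Lf e0.
Qed.

Lemma pow_int_Avg_le p e f : 1 < p -> Lp_real p f -> 0 < e ->
  (pow_int p (Avg e f) <= pow_int p f)%E.
Proof.
move=> p1 Lf e0; have p0 : 0 <= p by lra.
have e20 : 0 < 2 * e by rewrite mulr_gt0.
have mF : measurable_fun [set: measurableTypeR R] (fun x => (`|f x| `^ p)%:E).
  by apply: measurable_pow_abs; case: Lf.
have F0 x : (0 <= (`|f x| `^ p)%:E)%E by rewrite lee_fin powR_ge0.
apply: (@le_trans _ _ (\int[mu]_x (((2 * e)^-1)%:E * \int[mu]_(y in `[(x - e)%R, (x + e)%R]) (`|f y| `^ p)%:E))%E).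
  apply: ge0_le_integral => //.
  - by apply: measurable_pow_abs; exact: measurable_Avg Lf e0.
  - by apply: emeasurable_funM => //; exact: measurable_integral_window.
  - move=> x _; apply: le_trans (Avg_jensen x e0 p1 Lf).
    by rewrite lee_fin; apply: powR_le => //; exact: Avg_norm_le Lf.
rewrite ge0_integralZl_EFin //; last 3 first.
- by move=> x _; exact: integral_ge0.
- exact: measurable_integral_window.
- by rewrite invr_ge0 ltW.
by rewrite tonelli_window // muleA -EFinM mulVf ?gt_eqF // mul1e.
Qed.

Lemma Lp_real_Avg p e f : 1 < p -> Lp_real p f -> 0 < e -> Lp_real p (Avg e f).
Proof.
move=> p1 Lf e0; split; first exact: measurable_Avg Lf e0.
by apply: le_lt_trans (pow_int_Avg_le p1 Lf e0) _; case: Lf.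
Qed.

End continuous_averages.

(** * Transference to the real line *)

Definition Avg_transform (R : realType) (eps a : nat -> R) (s : nat) (f : R -> R) (x : R) : R :=
  \sum_(k < s) a k * (Avg (eps k.+1) f x - Avg (eps k) f x).

Section transference.
Variable R : realType.
Local Notation mu := (@lebesgue_measure R).
Implicit Types (f g : R -> R) (p h x : R).

Lemma cvg_powR_norm p (u : nat -> R) l : 1 < p -> u @ \oo --> l ->
  `|u n| `^ p @[n --> \oo] --> `|l| `^ p.
Proof.
move=> p1 ul; have p0 : 0 < p by lra.
pose M := `|l| + 1; pose K := p * M `^ (p - 1).
have M0 : 0 < M by rewrite ltr_wpDl.
have K0 : 0 < K by rewrite mulr_gt0 // powR_gt0.
apply/cvgrPdistC_le => z z0; near=> n.
have d1 : `|u n - l| <= 1 by near: n; apply: cvgr_distC_le.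
have d2 : `|u n - l| <= z / K.
  by near: n; apply: cvgr_distC_le => //; rewrite divr_gt0.
have uM : `|u n| <= M.
  by rewrite -[u n](subrK l) /M addrC; apply: le_trans (ler_normD _ _) _; rewrite lerD2l.
apply: le_trans (powR_lipschitz p1 _ uM _ _) _ => //; first by rewrite lerDl.
rewrite -/K mulrC -ler_pdivlMr //; apply: le_trans d2.
exact: ler_dist_dist.
Unshelve. all: by end_near. Qed.

Lemma cvg_sum_ord (s : nat) (u : nat -> nat -> R) (l : nat -> R) :
  (forall k, u k n @[n --> \oo] --> l k) ->
  \sum_(k < s) u k n @[n --> \oo] --> \sum_(k < s) l k.
Proof.
move=> ul; elim: s => [|s IH].
  by rewrite big_ord0; under eq_fun do rewrite big_ord0; exact: cvg_cst.
by rewrite big_ord_recr; under eq_fun do rewrite big_ord_recr /=; exact: cvgD.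
Qed.

(** Fatou's lemma with a bound required for infinitely many n only: the lower
    limit of the integrals is at most any value that they stay below infinitely
    often. *)
Lemma fatou_frequently (F : nat -> R -> \bar R) (G : R -> \bar R) (B : \bar R) :
  (forall n, measurable_fun [set: measurableTypeR R] (F n)) ->
  measurable_fun [set: measurableTypeR R] G ->
  (forall n x, (0 <= F n x)%E) -> (forall x, (0 <= G x)%E) ->
  {ae mu, forall x, F n x @[n --> \oo] --> G x} ->
  (forall N, exists2 n, (N <= n)%N & (\int[mu]_x F n x <= B)%E) ->
  (\int[mu]_x G x <= B)%E.
Proof.
move=> mF mG F0 G0 FG HB.
have mL : measurable_fun [set: measurableTypeR R] (fun x => limn_einf (F ^~ x)).
  rewrite [X in measurable_fun _ X](_ : _ = (fun x => - limn_esup (fun n => - F n x)))%E //.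
  apply: measurableT_comp => //; apply: measurable_fun_limn_esup => n.
  exact: measurableT_comp.
have L0 x : (0 <= limn_einf (F ^~ x))%E.
  rewrite limn_einf_lim; apply: lime_ge; first exact: is_cvg_einfs.
  apply: nearW => n; apply: le_ereal_inf_tmp => _ [k /= _ <-]; exact: F0.
have -> : (\int[mu]_x G x = \int[mu]_x limn_einf (F ^~ x))%E.
  apply: ge0_ae_eq_integral => //.
  case: FG => A [mA A0 HA]; exists A; split => // x /= Hx; apply: HA => /= FGx.
  by apply: Hx => _; rewrite (cvg_limn_einf_sup FGx).1.
apply: (@le_trans _ _ (limn_einf (fun n => \int[mu]_x F n x)%E)).
  by apply: (@fatou _ (measurableTypeR R) R mu setT measurableT F) => // n x _; exact: F0.
rewrite limn_einf_lim; apply: lime_le; first exact: is_cvg_einfs.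
apply: nearW => N; have [n Nn Hn] := HB N; apply: le_trans Hn.
by apply: ereal_inf_lbound; exists n.
Qed.

Lemma pow_int_fatou p (u : nat -> R -> R) g B : 1 < p ->
  (forall n, measurable_fun [set: measurableTypeR R] (u n)) ->
  measurable_fun [set: measurableTypeR R] g ->
  (forall x, u n x @[n --> \oo] --> g x) ->
  (forall n, (pow_int p (u n) <= B)%E) -> (pow_int p g <= B)%E.
Proof.
move=> p1 mu_ mg ug HB.
apply: (@fatou_frequently (fun n x => (`|u n x| `^ p)%:E)).
- by move=> n; exact: measurable_pow_abs.
- exact: measurable_pow_abs.
- by move=> n x; rewrite lee_fin powR_ge0.
- by move=> x; rewrite lee_fin powR_ge0.
- by apply: aeW => x; apply/fine_cvgP; split; [exact: nearW|exact: cvg_powR_norm].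
- by move=> N; exists N => //; exact: HB.
Qed.

Lemma sume_const (I : finType) (X : \bar R) : (0 <= X)%E ->
  (\sum_(i : I) X = #|I|%:R%:E * X)%E.
Proof. by move=> X0; rewrite sumr_const mule_natl. Qed.

Lemma integral_chasles p f (a b c : R) : 1 < p -> Lp_real p f -> a <= b -> b <= c ->
  \int[mu]_(y in `[a, c]) f y =
  \int[mu]_(y in `[a, b]) f y + \int[mu]_(y in `[b, c]) f y.
Proof.
move=> p1 Lf ab bc; apply/eqP; rewrite addrC -subr_eq; apply/eqP.
rewrite (@Rintegral_itvB _ f (BLeft a) (BRight c) b); last 3 first.
- exact: Lp_real_integrable p1 Lf.
- by rewrite bnd_simp.
- by rewrite bnd_simp.
rewrite Rintegral_itv_obnd_cbnd //.
by apply: (integrableS _ _ _ (Lp_real_integrable b c p1 Lf)) => //; exact: subset_itv_oc_cc.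
Qed.

Lemma integral_pieces p f (a h : R) (w : nat) : 1 < p -> Lp_real p f -> 0 < h ->
  \int[mu]_(y in `[a, (a + w%:R * h)]) f y =
  \sum_(j < w) \int[mu]_(y in `[(a + j%:R * h), (a + j.+1%:R * h)]) f y.
Proof.
move=> p1 Lf h0; elim: w => [|w IH].
  by rewrite big_ord0 mul0r addr0 set_itv1 Rintegral_set1.
rewrite big_ord_recr /= -IH; apply: (integral_chasles p1 Lf).
  by rewrite lerDl mulr_ge0 // ltW.
by rewrite lerD2l ler_pM2r // ler_nat.
Qed.

(** An interval of length (2 m + 1) h is cut into 2 m + 1 intervals of length
    h. *)
Lemma Avg_commensurable p f h (m : nat) x : 1 < p -> Lp_real p f -> 0 < h ->
  Avg (m.*2.+1%:R * h / 2) f x =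
  (\sum_(j < m.*2.+1) Avg (h / 2) f (x + (j%:R - m%:R) * h)) / m.*2.+1%:R.
Proof.
move=> p1 Lf h0; have w0 : 0 < m.*2.+1%:R :> R by rewrite ltr0n.
have w_m : m.*2.+1%:R = 2 * m%:R + 1 :> R by rewrite -addn1 natrD -mul2n natrM.
rewrite /Avg -mulr_sumr.
have -> : x + m.*2.+1%:R * h / 2 = (x - m.*2.+1%:R * h / 2) + m.*2.+1%:R * h by lra.
rewrite (integral_pieces _ _ p1 Lf h0).
rewrite (eq_bigr (fun j : 'I__ => \int[mu]_(y in `[(x + (j%:R - m%:R) * h - h / 2), (x + (j%:R - m%:R) * h + h / 2)]) f y)); last first.
  move=> j _; rewrite -[(nat_of_ord j).+1%:R]natr1.
  have -> : x + (j%:R - m%:R) * h - h / 2 = x - m.*2.+1%:R * h / 2 + j%:R * h.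
    by rewrite w_m; field.
  have -> : x + (j%:R - m%:R) * h + h / 2 = x - m.*2.+1%:R * h / 2 + (j%:R + 1) * h.
    by rewrite w_m; field.
  by [].
set S := \sum_(j < _) _; field.
by rewrite !gt_eqF.
Qed.

Lemma window_index_le (i u v w : nat) :
  (u <= v)%N -> (w < u.*2.+1)%N -> (v + i - u + w <= i + v.*2)%N.
Proof. lia. Qed.

(** The averages over intervals of length h centred at x + j h, for
    0 <= j < 2^n, are regarded as a function on Z/2^n.  At a position whose
    longest window stays between 0 and 2^n - 1, arithmetic modulo 2^n does not
    wrap and the cyclic transform is the transform on the line. *)
Lemma transfer_pointwise p f h (n : nat) (m : nat -> nat) (s : nat) (a : nat -> R) (x : R) (i : nat) :
  1 < p -> Lp_real p f -> 0 < h -> (0 < n)%N ->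
  (forall k, (k <= s)%N -> (m k <= m 0)%N) ->
  (i + (m 0).*2 < 2 ^ n)%N ->
  avg_transform 1 m a s (fun j : 'Z_(2 ^ n) => Avg (h / 2) f (x + (nat_of_ord j)%:R * h)) (m 0 + i)%N%:R
  = Avg_transform (fun k => (m k).*2.+1%:R * h / 2) a s f (x + (m 0 + i)%N%:R * h).
Proof.
move=> p1 Lf h0 n0 mle iN.
have E k : (k <= s)%N -> avg 1 (m k) (fun j : 'Z_(2 ^ n) => Avg (h / 2) f (x + (nat_of_ord j)%:R * h)) (m 0 + i)%N%:R
   = Avg ((m k).*2.+1%:R * h / 2) f (x + (m 0 + i)%N%:R * h).
  move=> ks; rewrite (Avg_commensurable _ _ p1 Lf h0); congr (_ / _).
  apply: eq_bigr => j _; congr (Avg _ _ _).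
  have mk := mle k ks; have jk := ltn_ord j.
  have -> : ((m 0 + i)%N%:R - 1 *+ m k + 1 *+ j : 'Z_(2 ^ n)) = (m 0 + i - m k + j)%N%:R.
    rewrite (natrD _ (m 0 + i - m k) j) natrB //.
    by rewrite (leq_trans mk) // leq_addr.
  rewrite natr_ZN //; last first.
    by have W := leq_ltn_trans (window_index_le i mk jk) iN.
  rewrite -addrA -mulrDl; congr (_ + _ * _).
  rewrite (natrD _ (m 0 + i - m k) j) natrB; last exact: leq_trans mk (leq_addr _ _).
  by ring.
by apply: eq_bigr => k _; rewrite /avg_diff !E // ltnW.
Qed.

Lemma measurable_Avg_transform p f (eps a : nat -> R) s : 1 < p -> Lp_real p f ->
  (forall k, (k <= s)%N -> 0 < eps k) ->
  measurable_fun [set: measurableTypeR R] (Avg_transform eps a s f).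
Proof.
move=> p1 Lf eps0; rewrite /Avg_transform.
apply: (@measurable_sum _ _ _ _ _ (index_enum 'I_s) (fun (k : 'I_s) x => a k * (Avg (eps k.+1) f x - Avg (eps k) f x))) => k.
apply: measurable_funM => //; apply: measurable_funB.
  by apply: measurable_Avg Lf _ => //; exact: eps0.
by apply: measurable_Avg Lf _ => //; apply: eps0; exact: ltnW.
Qed.

Lemma pow_int_translate p g c : measurable_fun [set: measurableTypeR R] g ->
  pow_int p (fun x => g (x + c)) = pow_int p g.
Proof.
move=> mg; rewrite /pow_int.
rewrite (@integral_translate R (fun x => (`|g x| `^ p)%:E) c) //.
exact: measurable_pow_abs.
Qed.

(** The cyclic bound is applied to the samples at x + j h and integrated over x.
    By translation invariance all samples have the same integral, so that both
    sides are multiples of the desired ones; only the 2 m_0 positions near the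
    ends are lost on the left, which costs a factor 2. *)
Lemma commensurable_bound (r p : R) : 0 < r -> r < 1 -> 1 < p ->
  exists2 C : R, 0 < C & forall f h (m : nat -> nat) (s : nat) (a : nat -> R),
    Lp_real p f -> 0 < h ->
    (forall k, (k < s)%N -> (m k.+1).*2.+1%:R <= r * (m k).*2.+1%:R) ->
    (forall k, `|a k| <= 1) ->
    (pow_int p (Avg_transform (fun k => (m k).*2.+1%:R * h / 2)%R a s f) <= C%:E * pow_int p f)%E.
Proof.
move=> r0 r1 p1; have [C C0 HC] := discrete_Lp_bound r0 r1 p1.
exists (2 * C); first by rewrite mulr_gt0.
move=> f h m s a Lf h0 lac a1.
have h20 : 0 < h / 2 by rewrite divr_gt0.
have mle k : (k <= s)%N -> (m k <= m 0)%N.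
  move=> ks; have := lacunary_le r0 r1 lac (leq0n k) ks.
  by rewrite ler_nat ltnS leq_double.
(* This n is chosen for 16 (2 m_0 + 1) <= 2^n to be immediate. *)
pose n := (16 * (m 0).*2.+1)%N; have n0 : (0 < n)%N by rewrite /n; lia.
have wN : (16 * (m 0).*2.+1 <= 2 ^ n)%N by rewrite ltnW // ltn_expl.
pose N := (2 ^ n)%N; pose M := (N - (m 0).*2)%N.
have NM : (N <= 2 * M)%N by rewrite /M /N; lia.
have M0 : (0 < M)%N by rewrite /M /N; lia.
set T := Avg_transform _ _ _ _.
pose g := Avg (h / 2) f.
have mg : measurable_fun [set: measurableTypeR R] g by exact: measurable_Avg Lf h20.
have mT : measurable_fun [set: measurableTypeR R] T.
  apply: measurable_Avg_transform Lf _ => // k _.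
  by rewrite divr_gt0 // mulr_gt0.
have pt x : \sum_(i < M) `|T (x + (m 0 + i)%N%:R * h)| `^ p <=
    C * \sum_(j : 'Z_(2 ^ n)) `|g (x + (nat_of_ord j)%:R * h)| `^ p.
  apply: le_trans (HC n m s a (fun j : 'Z_(2 ^ n) => g (x + (nat_of_ord j)%:R * h)) n0 lac wN a1).
  have iN (i : 'I_M) : (i + (m 0).*2 < 2 ^ n)%N.
    by have := ltn_ord i; rewrite /M /N; lia.
  rewrite (eq_bigr (fun i : 'I_M => (fun j => `|avg_transform 1 m a s (fun j : 'Z_(2 ^ n) => g (x + (nat_of_ord j)%:R * h)) j| `^ p) (m 0 + i)%N%:R)); last first.
    by move=> i _; rewrite (transfer_pointwise _ _ p1 Lf h0 n0 mle (iN i)).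
  apply: (sum_inj_le (h := fun i : 'I_M => (m 0 + i)%N%:R : 'Z_(2 ^ n)) (P := predT)) => //.
  move=> i j /(congr1 (@nat_of_ord _)).
  rewrite !natr_ZN //; first by move/addnI/val_inj.
    by apply: leq_trans (iN j); rewrite ltnS addnC leq_add2l -addnn leq_addr.
  by apply: leq_trans (iN i); rewrite ltnS addnC leq_add2l -addnn leq_addr.
have Pg0 : (0 <= pow_int p g)%E by apply: integral_ge0 => x _; rewrite lee_fin powR_ge0.
have PT0 : (0 <= pow_int p T)%E by apply: integral_ge0 => x _; rewrite lee_fin powR_ge0.
have mTi c : measurable_fun [set: measurableTypeR R] (fun x => (`|T (x + c)| `^ p)%:E).
  apply: (@measurable_pow_abs R p (fun x => T (x + c))).
  exact: (measurableT_comp mT (measurable_add_cst c)).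
have mgi c : measurable_fun [set: measurableTypeR R] (fun x => (`|g (x + c)| `^ p)%:E).
  apply: (@measurable_pow_abs R p (fun x => g (x + c))).
  exact: (measurableT_comp mg (measurable_add_cst c)).
have lhs : (\int[mu]_x (\sum_(i < M) `|T (x + (m 0 + i)%N%:R * h)| `^ p)%:E = M%:R%:E * pow_int p T)%E.
  under eq_integral do rewrite -sumEFin.
  rewrite ge0_integral_sum //.
  rewrite (eq_bigr (fun=> pow_int p T)); last by move=> i _; exact: (pow_int_translate p _ mT).
  by rewrite sume_const // card_ord.
have rhs : (\int[mu]_x (C * \sum_(j : 'Z_(2 ^ n)) `|g (x + (nat_of_ord j)%:R * h)| `^ p)%:E
    = (C * N%:R)%:E * pow_int p g)%E.
  under eq_integral do rewrite EFinM -sumEFin.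
  rewrite ge0_integralZl_EFin; last 4 first.
  - exact: measurableT.
  - by move=> x _; apply: sume_ge0 => j _; rewrite lee_fin powR_ge0.
  - by apply: emeasurable_sum => j.
  - exact: ltW.
  rewrite ge0_integral_sum //.
  rewrite (eq_bigr (fun=> pow_int p g)); last by move=> i _; exact: (pow_int_translate p _ mg).
  rewrite (sume_const _ Pg0) (_ : #|_| = N); last exact: cardZN.
  rewrite muleA -EFinM; exact: erefl.
have main : (M%:R%:E * pow_int p T <= (C * N%:R)%:E * pow_int p f)%E.
  rewrite -lhs; apply: (@le_trans _ _ ((C * N%:R)%:E * pow_int p g)%E).
    rewrite -rhs; apply: ge0_le_integral => //.
    - by move=> x _; rewrite lee_fin sumr_ge0 // => i _; exact: powR_ge0.
    - under eq_fun do rewrite -sumEFin.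
      by apply: emeasurable_sum => j.
    - under eq_fun do rewrite EFinM -sumEFin.
      by apply: emeasurable_funM => //; apply: emeasurable_sum => j.
    - by move=> x _; rewrite lee_fin; exact: pt.
  apply: lee_wpmul2l; first by rewrite lee_fin mulr_ge0 // ltW.
  exact: pow_int_Avg_le.
have MR : 0 < M%:R :> R by rewrite ltr0n.
have -> : pow_int p T = ((M%:R^-1)%:E * (M%:R%:E * pow_int p T))%E.
  rewrite muleA -EFinM mulVf ?mul1e; [exact: erefl|by rewrite gt_eqF].
have Mi : (0 <= (M%:R^-1)%:E :> \bar R)%E by rewrite lee_fin invr_ge0.
apply: le_trans (lee_wpmul2l Mi main) _.
rewrite muleA -EFinM; apply: lee_wpmul2r.
  by apply: integral_ge0 => x _; rewrite lee_fin powR_ge0.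
rewrite lee_fin ler_pdivrMl //.
have : N%:R <= 2 * M%:R :> R by rewrite -natrM ler_nat.
have := C0; nra.
Qed.

(** Radii (2 m_k + 1) h / 2 within h / 2 of eps_k are still lacunary, with ratio
    (1 + r) / 2, once h is small compared with the smallest radius in use;
    Fatou's lemma handles h -> 0. *)
Lemma Avg_transform_bound (r p : R) : 0 < r -> r < 1 -> 1 < p ->
  exists2 C : R, 0 < C & forall f (eps : nat -> R) (s : nat) (a : nat -> R),
    Lp_real p f -> (forall k, 0 < eps k) ->
    (forall k, eps k.+1 <= r * eps k) ->
    (forall k, `|a k| <= 1) ->
    (pow_int p (Avg_transform eps a s f) <= C%:E * pow_int p f)%E.
Proof.
move=> r0 r1 p1; pose r' := (1 + r) / 2.
have r'0 : 0 < r' by rewrite /r'; lra.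
have r'1 : r' < 1 by rewrite /r'; lra.
have [C C0 HC] := commensurable_bound r'0 r'1 p1; exists C => //.
move=> f eps s a Lf eps0 lac a1.
have epsS k : eps k.+1 <= eps k.
  by apply: le_trans (lac k) _; rewrite ler_piMl // ltW.
have eps_le k : (k <= s)%N -> eps s <= eps k.
  elim: s => [|t IH]; first by rewrite leqn0 => /eqP ->.
  rewrite leq_eqVlt => /orP[/eqP -> //|]; rewrite ltnS => /IH; exact: le_trans.
(* For h <= d the perturbation of the radii, at most h / 2, is a small fraction
   of each radius in use. *)
pose d := (1 - r) / 4 * eps s; have d0 : 0 < d by rewrite mulr_gt0 // divr_gt0 //; lra.
pose h (l : nat) := d / l.+1%:R.
have h0 l : 0 < h l by rewrite divr_gt0.
have hd l : h l <= d by rewrite ler_pdivrMr // ler_peMr ?(ltW d0) // ler1n.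
pose m l k := Num.truncn (eps k / h l).
pose e l k := (m l k).*2.+1%:R * h l / 2.
have el l k : `|e l k - eps k| <= h l / 2.
  have q0 : 0 <= eps k / h l by rewrite divr_ge0 // ltW.
  have := truncn_itv q0; rewrite -/(m l k) => /andP[].
  rewrite ler_pdivlMr // ltr_pdivrMr // -natr1 => b1 b2.
  have -> : e l k = (2 * (m l k)%:R + 1) * h l / 2.
    by rewrite /e -addn1 natrD -mul2n natrM.
  have := h0 l => hl0; rewrite ler_norml; apply/andP; split; lra.
have e0 l k : 0 < e l k by rewrite divr_gt0 // mulr_gt0.
have lac' l k : (k < s)%N -> (m l k.+1).*2.+1%:R <= r' * (m l k).*2.+1%:R.
  move=> ks; have hl2 : 0 < h l / 2 by rewrite divr_gt0.
  have eE i : (m l i).*2.+1%:R * (h l / 2) = e l i by rewrite /e mulrA.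
  rewrite -(ler_pM2r hl2) -[leRHS]mulrA !eE.
  have hk : 4 * h l <= (1 - r) * eps k.
    have : (1 - r) * eps s <= (1 - r) * eps k.
      by apply: ler_wpM2l; [lra|exact: eps_le (ltnW ks)].
    by have := hd l; rewrite /d; lra.
  have /ler_normlP[b1 b2] := el l k; have /ler_normlP[b3 b4] := el l k.+1.
  have rb : (1 + r) * eps k <= (1 + r) * (e l k + h l / 2) by apply: ler_wpM2l; lra.
  have rh : r * h l <= h l by rewrite ler_piMl // ltW.
  have rh0 : 0 < r * h l by rewrite mulr_gt0.
  have := lac k; have := h0 l; rewrite /r'; lra.
have h_cvg : h l @[l --> \oo] --> 0.
  rewrite -[X in _ --> X](mulr0 d); apply: cvgM; first exact: cvg_cst.
  exact: cvg_harmonic.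
have e_cvg k : e l k @[l --> \oo] --> eps k.
  apply/cvgrPdistC_le => z z0; near=> l.
  apply: le_trans (el l k) _; apply: (@le_trans _ _ (h l)); first by have := h0 l; lra.
  rewrite -[leLHS]ger0_norm ?(ltW (h0 l)) // -[X in `|X|]subr0.
  by near: l; apply: cvgr_distC_le.
have cv x : Avg_transform (e l) a s f x @[l --> \oo] --> Avg_transform eps a s f x.
  apply: (@cvg_sum_ord s (fun k l => a k * (Avg (e l k.+1) f x - Avg (e l k) f x)) (fun k => a k * (Avg (eps k.+1) f x - Avg (eps k) f x))) => k.
  apply: cvgM; first exact: cvg_cst.
  by apply: cvgB; apply: (Avg_cvg_radius p1 Lf).
apply: (pow_int_fatou p1 _ _ cv) => [l||l].
- by apply: measurable_Avg_transform Lf _.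
- by apply: measurable_Avg_transform Lf _.
- exact: HC Lf (h0 l) (lac' l) a1.
Unshelve. all: by end_near. Qed.

End transference.

(** * Convergence of averages as the radius tends to 0 *)

Section power_integral.
Variable R : realType.
Local Notation mu := (@lebesgue_measure R).
Implicit Types (f g : R -> R) (p h x : R).

Lemma pow_int_ge0 p f : (0 <= pow_int p f)%E.
Proof. by apply: integral_ge0 => x _; rewrite lee_fin powR_ge0. Qed.

Lemma Lp_real_fin p f : Lp_real p f -> pow_int p f = (fine (pow_int p f))%:E.
Proof. by move=> [_ fp]; rewrite fineK // ge0_fin_numE // pow_int_ge0. Qed.

Lemma pow_int_le p f g : 0 <= p -> measurable_fun [set: measurableTypeR R] f ->
  measurable_fun [set: measurableTypeR R] g ->
  (forall x, `|f x| <= `|g x|) -> (pow_int p f <= pow_int p g)%E.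
Proof.
move=> p0 mf mg fg; apply: ge0_le_integral => //; try exact: measurable_pow_abs.
by move=> x _; rewrite lee_fin; apply: powR_le.
Qed.

Lemma pow_intD p f g : 0 <= p -> measurable_fun [set: measurableTypeR R] f ->
  measurable_fun [set: measurableTypeR R] g ->
  (pow_int p (fun x => f x + g x)%R <= (2 `^ p)%:E * (pow_int p f + pow_int p g))%E.
Proof.
move=> p0 mf mg; rewrite /pow_int -ge0_integralD //; try exact: measurable_pow_abs.
rewrite -ge0_integralZl_EFin ?powR_ge0 //; last 2 first.
- by move=> x _; apply: adde_ge0; rewrite lee_fin powR_ge0.
- by apply: emeasurable_funD; exact: measurable_pow_abs.
apply: ge0_le_integral => //.
- by apply: (@measurable_pow_abs R p (fun x => f x + g x)); exact: measurable_funD.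
- by apply: emeasurable_funM => //; apply: emeasurable_funD; exact: measurable_pow_abs.
- by move=> x _; rewrite -EFinD -EFinM lee_fin; exact: powR_normD_le.
Qed.

Lemma pow_int_norm p f : pow_int p (fun x => `|f x|) = pow_int p f.
Proof. by rewrite /pow_int; under eq_integral do rewrite normr_id. Qed.

Lemma pow_intN p f : pow_int p (fun x => - f x) = pow_int p f.
Proof. by rewrite /pow_int; under eq_integral do rewrite normrN. Qed.

Lemma Lp_realD p f g : 0 <= p -> Lp_real p f -> Lp_real p g -> Lp_real p (fun x => f x + g x).
Proof.
move=> p0 [mf fp] [mg gp]; split; first exact: measurable_funD.
apply: le_lt_trans (pow_intD p0 mf mg) _.
apply: lte_mul_pinfty; last exact: lte_add_pinfty fp gp.
  by rewrite lee_fin powR_ge0.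
exact: isT.
Qed.

Lemma Lp_realN p f : Lp_real p f -> Lp_real p (fun x => - f x).
Proof. by move=> [mf fp]; split; [exact: measurable_funN|rewrite pow_intN]. Qed.

Lemma Lp_realB p f g : 0 <= p -> Lp_real p f -> Lp_real p g -> Lp_real p (fun x => f x - g x).
Proof. by move=> p0 Lf Lg; exact: (Lp_realD p0 Lf (Lp_realN Lg)). Qed.

End power_integral.

Section approximation.
Variable R : realType.
Local Notation mu := (@lebesgue_measure R).
Implicit Types (f g : R -> R) (p h x : R).

Lemma integrable_cst_window (a b c : R) : mu.-integrable `[a, b] (EFin \o (fun=> c)).
Proof.
apply: measurable_bounded_integrable => //; last exact: bounded_cst.
change (mu `[a, b] < +oo)%E; rewrite lebesgue_measure_itv /=; case: ifP => // _.
by rewrite -EFinD ltry.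
Qed.

Lemma Avg_sub_cst p e f x c : 1 < p -> Lp_real p f -> 0 < e ->
  `|Avg e f x - c| <= Avg e (fun y => `|f y - c|) x.
Proof.
move=> p1 Lf e0; have e20 : 0 < 2 * e by rewrite mulr_gt0.
have ei : 0 <= (2 * e)^-1 by rewrite invr_ge0 ltW.
have iI := Lp_real_integrable (x - e) (x + e) p1 Lf.
have iB : mu.-integrable `[x - e, x + e] (EFin \o (fun y => f y - c)).
  exact: (integrableB _ iI (integrable_cst_window _ _ c)).
have -> : Avg e f x - c = (2 * e)^-1 * \int[mu]_(y in `[x - e, x + e]) (f y - c).
  rewrite RintegralB //; last exact: integrable_cst_window.
  rewrite Rintegral_cst // mulrBr; congr (_ - _).
  change (c = (2 * e)^-1 * (c * fine (mu `[(x - e)%R, (x + e)%R]%classic))).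
  by rewrite lebesgue_measure_window //= mulrCA mulVf ?mulr1 // gt_eqF.
rewrite normrM ger0_norm //; apply: ler_wpM2l => //.
exact: le_normr_Rintegral.
Qed.

Lemma Avg_sub_cst_le p e f x c K : 1 < p -> Lp_real p f -> 0 < e ->
  (forall y, x - e <= y <= x + e -> `|f y - c| <= K) ->
  `|Avg e f x - c| <= K.
Proof.
move=> p1 Lf e0 HK; apply: le_trans (Avg_sub_cst x c p1 Lf e0) _.
have e20 : 0 < 2 * e by rewrite mulr_gt0.
have iI := Lp_real_integrable (x - e) (x + e) p1 Lf.
have iB : mu.-integrable `[x - e, x + e] (EFin \o (fun y => f y - c)).
  exact: (integrableB _ iI (integrable_cst_window _ _ c)).
rewrite /Avg ler_pdivrMl //.
apply: (@le_trans _ _ (\int[mu]_(y in `[x - e, x + e]) K)).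
  apply: le_Rintegral => //.
  - exact: (integrable_norm iB).
  - exact: integrable_cst_window.
rewrite Rintegral_cst //.
change (K * fine (mu `[(x - e)%R, (x + e)%R]%classic) <= 2 * e * K).
by rewrite lebesgue_measure_window //= mulrC.
Qed.

Lemma Lp_real_locally_integrable p f : 1 < p -> Lp_real p f -> locally_integrable setT f.
Proof.
move=> p1 Lf; split; [by case: Lf|exact: openT|move=> K _ cK].
have [M [_ HM]] := compact_bounded cK.
pose m := `|M| + 1.
have Km : K `<=` `[- m, m].
  move=> y Ky; have := HM m _ y Ky.
  rewrite /m => H; rewrite /= in_itv /= -ler_norml; apply: H.
  by apply: le_lt_trans (ler_norm M) _; rewrite ltrDl.
have := Lp_real_integrable (- m) m p1 Lf => /integrableP[mm]; apply: le_lt_trans.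
apply: ge0_subset_integral => //.
- exact: compact_measurable.
- apply/measurable_EFinP; apply: measurableT_comp => //.
  exact/measurable_EFinP.
Qed.

(** Convergence holds at Lebesgue points; the closed window lies in the open
    ball of twice the radius. *)
Lemma Avg_cvg_ae p f (u : nat -> R) : 1 < p -> Lp_real p f ->
  (forall n, 0 < u n) -> u @ \oo --> 0 ->
  {ae mu, forall x, Avg (u n) f x @[n --> \oo] --> f x}.
Proof.
move=> p1 Lf u0 ucv.
have [A [mA A0 HA]] := lebesgue_differentiation (Lp_real_locally_integrable p1 Lf).
exists A; split => // x /= Hx; apply: HA => /= Lx; apply: Hx.
have bound n : (`|Avg (u n) f x - f x|%:E <= 2%:E * davg f x (2 * u n))%E.
  have un := u0 n; have un2 : 0 < 2 * u n by rewrite mulr_gt0.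
  have iI := Lp_real_integrable (x - u n) (x + u n) p1 Lf.
  have iB : mu.-integrable `[x - u n, x + u n] (EFin \o (fun y => `|f y - f x|)).
    exact: (integrable_norm (integrableB _ iI (integrable_cst_window _ _ (f x)))).
  apply: (@le_trans _ _ (Avg (u n) (fun y => `|f y - f x|) x)%:E).
    by rewrite lee_fin; exact: Avg_sub_cst Lf un.
  rewrite /Avg /Rintegral EFinM fineK; last exact: integrable_fin_num.
  rewrite /davg /iavg lebesgue_measure_ball; last exact: ltW.
  have -> : (((2 * u n) *+ 2)%:E^-1 = ((2 * u n) *+ 2)^-1%:E :> \bar R)%E.
    by rewrite inver ifF // gt_eqF // pmulrn_lgt0.
  rewrite muleA -EFinM.
  have -> : 2 * ((2 * u n) *+ 2)^-1 = (2 * u n)^-1.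
    by rewrite -mulr_natr; field; rewrite gt_eqF.
  apply: lee_wpmul2l; first by rewrite lee_fin invr_ge0 ltW.
  apply: ge0_subset_integral => //.
  - exact: measurable_ball.
  - apply/measurable_EFinP; apply: measurableT_comp => //.
    apply: (@measurable_funS _ _ _ _ setT) => //.
    by apply: measurable_funB => //; case: Lf.
  - move=> y /=; rewrite in_itv /= => /andP[y1 y2].
    by rewrite /ball /= ltr_norml; apply/andP; split; lra.
have u2 : (2 * u n) @[n --> \oo] --> 0^'+.
  have u20 : (2 * u n) @[n --> \oo] --> 0.
    by rewrite -[X in _ --> X](mulr0 2); apply: cvgM => //; exact: cvg_cst.
  move=> P HP.
  apply: (@filterS _ (nbhs \oo) _ (fun n => 0 < 2 * u n -> P (2 * u n))); last exact: u20 _ HP.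
  by move=> n; apply; rewrite mulr_gt0.
have Dcv : davg f x (2 * u n) @[n --> \oo] --> 0%E by exact: (cvg_comp _ _ u2 Lx).
have D2 : (2%:E * davg f x (2 * u n))%E @[n --> \oo] --> 0%E.
  rewrite -[X in _ --> X](mule0 2%:E); exact: cvgeZl.
have : `|Avg (u n) f x - f x|%:E @[n --> \oo] --> 0%E.
  apply: (squeeze_cvge _ _ D2); last exact: cvg_cst.
  by apply: nearW => n; rewrite bound lee_fin normr_ge0.
move/fine_cvgP => [_ H].
apply/subr_cvg0/norm_cvg0P; exact: H.
Qed.

(** The Riesz-Scheffe argument.  Fatou's lemma is applied to
    2^p (|f|^p + |D f|^p) - |D f - f|^p, which is nonnegative and tends to
    2^(p+1) |f|^p almost everywhere.  As averaging is a contraction, the integral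
    of |D f - f|^p cannot stay above a positive z infinitely often. *)
Lemma Avg_cvg_Lp p f (u : nat -> R) (z : R) : 1 < p -> Lp_real p f ->
  (forall n, 0 < u n) -> u @ \oo --> 0 -> 0 < z ->
  exists N, forall n, (N <= n)%N -> (pow_int p (fun x => Avg (u n) f x - f x)%R <= z%:E)%E.
Proof.
move=> p1 Lf u0 ucv z0; have p0 : 0 <= p by lra.
apply: contrapT => /forallNP Hn.
have Hn' N : exists2 n, (N <= n)%N & (z%:E <= pow_int p (fun x => Avg (u n) f x - f x)%R)%E.
  have /existsNP[n /not_implyP[Nn Hz]] := Hn N.
  by exists n => //; apply: ltW; rewrite ltNge; apply/negP.
pose F := fine (pow_int p f); have FE := Lp_real_fin Lf; rewrite -/F in FE.
pose c : R := 2 `^ p; have c0 : 0 <= c by exact: powR_ge0.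
pose Fn n x := (c * (`|f x| `^ p + `|Avg (u n) f x| `^ p) - `|Avg (u n) f x - f x| `^ p).
have mA n : measurable_fun [set: measurableTypeR R] (Avg (u n) f) by exact: measurable_Avg Lf _.
have mf : measurable_fun [set: measurableTypeR R] f by case: Lf.
have mAf n : measurable_fun [set: measurableTypeR R] (fun x => Avg (u n) f x - f x).
  exact: measurable_funB.
have mFn n : measurable_fun [set: measurableTypeR R] (Fn n).
  apply: measurable_funB; last exact: (measurable_powR_norm p (mAf n)).
  apply: measurable_funM => //; apply: measurable_funD.
    exact: measurable_powR_norm.
  exact: (measurable_powR_norm p (mA n)).
have Fn0 n x : 0 <= Fn n x.
  rewrite subr_ge0 /c; have := @powR_normD_le R (Avg (u n) f x) (- f x) p p0.
  by rewrite normrN addrC [X in _ * X]addrC addrC.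
have key : (\int[mu]_x (c * (`|f x| `^ p + `|f x| `^ p))%:E <= (c * (F + F) - z)%:E)%E.
  apply: (@fatou_frequently R (fun n x => (Fn n x)%:E)).
  - by move=> n; apply/measurable_EFinP; exact: mFn.
  - apply/measurable_EFinP; apply: measurable_funM => //; apply: measurable_funD; exact: measurable_powR_norm.
  - by move=> n x; rewrite lee_fin.
  - by move=> x; rewrite lee_fin mulr_ge0 // addr_ge0 // powR_ge0.
  - have [A [mA' A0 HA]] := Avg_cvg_ae p1 Lf u0 ucv.
    exists A; split => // x /= Hx; apply: HA => /= Ax; apply: Hx.
    apply/fine_cvgP; split; first exact: nearW.
    rewrite (_ : c * _ = c * (`|f x| `^ p + `|f x| `^ p) - `|f x - f x| `^ p); last first.
      by rewrite subrr normr0 powR0 ?subr0 // gt_eqF //; lra.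
    apply: cvgB.
      apply: cvgM; first exact: cvg_cst.
      by apply: cvgD; [exact: cvg_cst|exact: cvg_powR_norm].
    by apply: cvg_powR_norm => //; apply: cvgB => //; exact: cvg_cst.
  move=> N; have [n Nn zn] := Hn' N; exists n => //.
  have LA : Lp_real p (Avg (u n) f) by exact: Lp_real_Avg.
  have LAf : Lp_real p (fun x => Avg (u n) f x - f x) by exact: Lp_realB.
  have AE := Lp_real_fin LA; have BE := Lp_real_fin LAf.
  set a := fine _ in AE; set b := fine _ in BE.
  have aF : a <= F by rewrite -lee_fin -AE -FE; exact: pow_int_Avg_le p1 Lf (u0 n).
  have zb : z <= b by rewrite -lee_fin -BE.
  have -> : (\int[mu]_x (Fn n x)%:E = (c * (F + a) - b)%:E)%E.
    have eq : (\int[mu]_x (Fn n x)%:E + b%:E = (c * (F + a))%:E)%E.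
      rewrite -BE /pow_int -ge0_integralD //; last 3 first.
      - by move=> x _; rewrite lee_fin.
      - by apply/measurable_EFinP; exact: mFn.
      - exact: (measurable_pow_abs p (mAf n)).
      under eq_integral do rewrite -EFinD subrK EFinM EFinD.
      rewrite ge0_integralZl_EFin //; last 2 first.
      - by move=> x _; apply: adde_ge0; rewrite lee_fin powR_ge0.
      - by apply: emeasurable_funD; exact: measurable_pow_abs.
      rewrite ge0_integralD //; [|exact: measurable_pow_abs..].
      by rewrite -/(pow_int p f) -/(pow_int p (Avg (u n) f)) FE AE -EFinD -EFinM.
    have -> : (\int[mu]_x (Fn n x)%:E = \int[mu]_x (Fn n x)%:E + b%:E - b%:E)%E.
      by rewrite addeK.
    by rewrite eq -EFinB.
  rewrite lee_fin; apply: lerB; last exact: zb.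
  by apply: (ler_wpM2l c0); rewrite lerD2l; exact: aF.
have : (\int[mu]_x (c * (`|f x| `^ p + `|f x| `^ p))%:E = (c * (F + F))%:E)%E.
  under eq_integral do rewrite EFinM EFinD.
  rewrite ge0_integralZl_EFin //; last 2 first.
  - by move=> x _; apply: adde_ge0; rewrite lee_fin powR_ge0.
  - by apply: emeasurable_funD; exact: measurable_pow_abs.
  rewrite ge0_integralD //; [|exact: measurable_pow_abs..].
  by rewrite -/(pow_int p f) FE -EFinD -EFinM.
by move=> E; move: key; rewrite E lee_fin; lra.
Qed.

End approximation.

(** * Tails of lacunary transforms and rearrangements *)

Section smoothing.
Variable R : realType.
Local Notation mu := (@lebesgue_measure R).
Implicit Types (f g : R -> R) (p h x : R).

Lemma primitive_osc p f a c e s t : 1 < p -> Lp_real p f -> a <= c - e ->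
  `|s - c| <= e -> `|t - c| <= e ->
  `|\int[mu]_(y in `[a, t]) f y - \int[mu]_(y in `[a, s]) f y| <=
    \int[mu]_(y in `[c - e, c + e]) `|f y|.
Proof.
move=> p1 Lf ac; wlog st : s t / s <= t => [H se te|].
  have [st|/ltW ts] := leP s t; first exact: H.
  by rewrite distrC; exact: H.
move=> se te.
have /andP[s1 s2] : - e <= s - c <= e by rewrite -ler_norml.
have /andP[t1 t2] : - e <= t - c <= e by rewrite -ler_norml.
have Ln := Lp_real_norm Lf.
rewrite (@integral_chasles R p f a s t) //; last lra.
rewrite addrAC subrr add0r.
rewrite (@integral_chasles R p (fun y => `|f y|) (c - e) s (c + e)) //; [|lra..].
rewrite (@integral_chasles R p (fun y => `|f y|) s t (c + e)) //; [|lra..].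
have : `|\int[mu]_(y in `[s, t]) f y| <= \int[mu]_(y in `[s, t]) `|f y|.
  by apply: le_normr_Rintegral => //; exact: Lp_real_integrable p1 Lf.
have P u v : 0 <= \int[mu]_(y in `[u, v]) `|f y| by apply: Rintegral_ge0.
have := P (c - e) s; have := P t (c + e).
by move=> h1 h2 h3; apply: (le_trans h3); rewrite addrCA lerDl addr_ge0.
Qed.

(** D_d f is a difference quotient of a primitive of f, and each end point of
    the interval of integration moves by at most e. *)
Lemma Avg_osc p d e f x y : 1 < p -> Lp_real p f -> 0 < d -> 0 < e -> `|y - x| <= e ->
  `|Avg d f y - Avg d f x| <=
    e / d * (Avg e (fun t => `|f t|) (x + d) + Avg e (fun t => `|f t|) (x - d)).
Proof.
move=> p1 Lf d0 e0 yx; have := yx; rewrite ler_norml => /andP[y1 y2].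
pose a := x - d - e - 1.
rewrite (@Avg_primitive R p d f a y) //; last by rewrite /a; lra.
rewrite (@Avg_primitive R p d f a x) //; last by rewrite /a; lra.
have h1 := @primitive_osc p f a (x + d) e (x + d) (y + d) p1 Lf.
have h2 := @primitive_osc p f a (x - d) e (x - d) (y - d) p1 Lf.
rewrite -mulrBr normrM ger0_norm; last by rewrite invr_ge0 mulr_ge0 // ltW.
rewrite ler_pdivrMl ?mulr_gt0 //.
have yE1 : y + d - (x + d) = y - x by ring.
have yE2 : y - d - (x - d) = y - x by ring.
have {}h1 : `|\int[mu]_(y in `[a, y + d]) f y - \int[mu]_(y in `[a, x + d]) f y| <=
    \int[mu]_(y in `[x + d - e, x + d + e]) `|f y|.
  by apply: h1; rewrite ?yE1 ?subrr ?normr0 //; [rewrite /a; lra|exact: ltW].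
have {}h2 : `|\int[mu]_(y in `[a, y - d]) f y - \int[mu]_(y in `[a, x - d]) f y| <=
    \int[mu]_(y in `[x - d - e, x - d + e]) `|f y|.
  by apply: h2; rewrite ?yE2 ?subrr ?normr0 //; [rewrite /a; lra|exact: ltW].
have -> : 2 * d * (e / d * (Avg e (fun t => `|f t|) (x + d) + Avg e (fun t => `|f t|) (x - d))) =
  \int[mu]_(y in `[x + d - e, x + d + e]) `|f y| + \int[mu]_(y in `[x - d - e, x - d + e]) `|f y|.
  by rewrite /Avg; field; rewrite !gt_eqF.
apply: le_trans (lerD h1 h2).
apply: le_trans (ler_normB _ _); rewrite le_eqVlt; apply/orP; left; apply/eqP; congr `|_|.
ring.
Qed.

Definition two_windows d e f x : R :=
  Avg e (fun t => `|f t|) (x + d) + Avg e (fun t => `|f t|) (x - d).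

Lemma Avg_smooth p d e f x : 1 < p -> Lp_real p f -> 0 < d -> 0 < e ->
  `|Avg e (Avg d f) x - Avg d f x| <= e / d * two_windows d e f x.
Proof.
move=> p1 Lf d0 e0; apply: (Avg_sub_cst_le p1 (Lp_real_Avg p1 Lf d0) e0) => y /andP[y1 y2].
by apply: Avg_osc Lf d0 e0 _ => //; rewrite ler_norml; apply/andP; split; lra.
Qed.

Lemma two_windows_ge0 d e f x : 0 < e -> 0 <= two_windows d e f x.
Proof. by move=> e0; apply: addr_ge0; apply: Avg_ge0. Qed.

Lemma measurable_two_windows p d e f : 1 < p -> Lp_real p f -> 0 < e ->
  measurable_fun [set: measurableTypeR R] (two_windows d e f).
Proof.
move=> p1 Lf e0; have mA := measurable_Avg p1 (Lp_real_norm Lf) e0.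
by apply: measurable_funD; apply: (measurableT_comp mA); exact: measurable_add_cst.
Qed.

Lemma pow_int_two_windows p d e f : 1 < p -> Lp_real p f -> 0 < e ->
  (pow_int p (two_windows d e f) <= (2 `^ p * 2)%:E * pow_int p f)%E.
Proof.
move=> p1 Lf e0; have p0 : 0 <= p by lra.
have Ln := Lp_real_norm Lf; have mA := measurable_Avg p1 Ln e0.
apply: le_trans (pow_intD p0 _ _) _.
- by apply: (measurableT_comp mA); exact: measurable_add_cst.
- by apply: (measurableT_comp mA); exact: measurable_add_cst.
rewrite (@pow_int_translate R p _ d mA) (@pow_int_translate R p _ (- d) mA).
rewrite EFinM -muleA; apply: lee_wpmul2l; first by rewrite lee_fin powR_ge0.
rewrite mule_natl mule2n.
have : (pow_int p (Avg e (fun t => `|f t|%R)) <= pow_int p f)%E.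
  apply: le_trans (pow_int_Avg_le p1 Ln e0) _.
  by rewrite pow_int_norm.
by move=> H; exact: leeD.
Qed.

(** A substitute for the triangle inequality, for p-th powers of norms. *)
Lemma pow_int_weighted_sum p (n : nat) (w : nat -> R) (y : nat -> R -> R) (B : R) : 1 < p ->
  (forall k, 0 <= w k) -> (forall k x, 0 <= y k x) ->
  (forall k, measurable_fun [set: measurableTypeR R] (y k)) ->
  (forall k, (pow_int p (y k) <= B%:E)%E) ->
  (pow_int p (fun x => \sum_(k < n) w k * y k x)%R <= ((\sum_(k < n) w k) `^ p * B)%:E)%E.
Proof.
move=> p1 w0 y0 my yB; set W := \sum_(k < n) w k.
have W0 : 0 <= W by rewrite sumr_ge0.
apply: (@le_trans _ _ (\int[mu]_x ((W `^ (p - 1))%:E * \sum_(k < n) (w k)%:E * (`|y k x| `^ p)%:E))%E).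
  apply: ge0_le_integral => //.
  - apply: (measurable_pow_abs p (f := fun x => \sum_(k < n) w k * y k x)).
    by apply: measurable_sum => k; exact: measurable_funM.
  - apply: emeasurable_funM => //; apply: emeasurable_sum => k; apply: emeasurable_funM => //.
    exact: measurable_pow_abs.
  - move=> x _; under [X in (_ <= _ * X)%E]eq_bigr do rewrite -EFinM; rewrite sumEFin -EFinM lee_fin.
    rewrite ger0_norm; last by apply: sumr_ge0 => k _; exact: mulr_ge0.
    under [in leRHS]eq_bigr do rewrite ger0_norm //.
    exact: (@jensen_sum R n p w (fun k => y k x)).
rewrite ge0_integralZl_EFin ?powR_ge0 //; last 2 first.
- by move=> x _; apply: sume_ge0 => k _; apply: mule_ge0; rewrite lee_fin ?powR_ge0.
- apply: emeasurable_sum => k; apply: emeasurable_funM => //; exact: measurable_pow_abs.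
rewrite ge0_integral_sum //; last 2 first.
- move=> k; apply: emeasurable_funM => //; exact: measurable_pow_abs.
- by move=> k x _; apply: mule_ge0; rewrite lee_fin ?powR_ge0.
apply: (@le_trans _ _ ((W `^ (p - 1))%:E * (\sum_(k < n) (w k * B)%:E))%E).
  apply: lee_wpmul2l; first by rewrite lee_fin powR_ge0.
  apply: lee_sum => k _; rewrite ge0_integralZl_EFin //; last exact: measurable_pow_abs.
  by rewrite EFinM; apply: lee_wpmul2l; [rewrite lee_fin|exact: yB].
rewrite sumEFin -mulr_suml -/W -EFinM lee_fin mulrA [W `^ _ * W]mulrC mulr_powRB1 //; lra.
Qed.

(** Each difference is at most the sum of the distances of its two averages to
    D_d f, and every distance is used at most twice. *)
Lemma Avg_transform_smooth_le (r p d : R) f (eps c : nat -> R) (m s : nat) x :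
  0 < r -> 1 < p -> Lp_real p f -> 0 < d ->
  (forall k, 0 < eps k) -> (forall k, eps k.+1 <= r * eps k) ->
  (forall k, `|c k| <= 1) -> (forall k, (k < m)%N -> c k = 0) ->
  `|Avg_transform eps c s (Avg d f) x| <=
     \sum_(k < s.+1) (2 * eps m / d * r ^+ k) * two_windows d (eps (m + k)%N) f x.
Proof.
move=> r0 p1 Lf d0 eps0 lac c1 cm.
pose v k := `|Avg (eps k) (Avg d f) x - Avg d f x|.
pose b k := (m <= k)%:R * v k.
have v0 k : 0 <= v k by rewrite /v.
have b0 k : 0 <= b k by apply: mulr_ge0.
have eps_m k : eps (m + k)%N <= r ^+ k * eps m.
  elim: k => [|k IH]; first by rewrite addn0 expr0 mul1r.
  rewrite addnS exprS -mulrA; apply: le_trans (lac _) _.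
  by rewrite ler_pM2l.
have step1 : `|Avg_transform eps c s (Avg d f) x| <= \sum_(k < s) (b k.+1 + b k).
  apply: le_trans (ler_norm_sum _ _ _) _; apply: ler_sum => k _; rewrite normrM.
  have [km|mk] := ltnP k m; first by rewrite cm // normr0 mul0r addr_ge0.
  rewrite /b mk (leq_trans mk) // !mul1r.
  apply: (@le_trans _ _ `|Avg (eps k.+1) (Avg d f) x - Avg (eps k) (Avg d f) x|).
    by rewrite ler_piMl.
  rewrite /v; set g := Avg d f; rewrite [`|Avg (eps k) g x - _|]distrC.
  by apply: le_trans (ler_normD _ _); rewrite addrA subrK.
have step2 : \sum_(k < s) (b k.+1 + b k) <= 2 * \sum_(k < s.+1) b k.
  rewrite big_split /= mulr_natl mulr2n; apply: lerD.
    by rewrite [leRHS]big_ord_recl /= lerDr.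
  by rewrite [leRHS]big_ord_recr /= lerDl.
have step3 : \sum_(k < s.+1) b k <= \sum_(k < s.+1) v (m + k)%N.
  have -> : \sum_(k < s.+1) v (m + k)%N = \sum_(k < m + s.+1) b k.
    rewrite [RHS]big_split_ord /= [X in _ = X + _]big1 ?add0r => [|k _].
      by apply: eq_bigr => k _; rewrite /b leq_addr mul1r.
    by rewrite /b leqNgt ltn_ord mul0r.
  rewrite addnC big_split_ord /= lerDl; exact: sumr_ge0.
apply: (le_trans step1); apply: (le_trans step2).
apply: (@le_trans _ _ (2 * \sum_(k < s.+1) v (m + k)%N)); first by rewrite ler_pM2l.
rewrite mulr_sumr; apply: ler_sum => k _.
apply: (@le_trans _ _ (2 * (eps (m + k)%N / d * two_windows d (eps (m + k)%N) f x))).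
  by rewrite ler_pM2l //; exact: Avg_smooth Lf _ _.
rewrite mulrA; apply: ler_wpM2r; first exact: two_windows_ge0.
rewrite -!mulrA ler_pM2l // [_^-1 * _]mulrC mulrA ler_pM2r ?invr_gt0 //.
by rewrite mulrC; exact: eps_m.
Qed.

Lemma Avg_transform_smooth (r p d : R) f (eps c : nat -> R) (m s : nat) :
  0 < r -> r < 1 -> 1 < p -> Lp_real p f -> 0 < d ->
  (forall k, 0 < eps k) -> (forall k, eps k.+1 <= r * eps k) ->
  (forall k, `|c k| <= 1) -> (forall k, (k < m)%N -> c k = 0) ->
  (pow_int p (Avg_transform eps c s (Avg d f)) <=
    ((2 * eps m / d / (1 - r)) `^ p * (2 `^ p * 2 * fine (pow_int p f)))%:E)%E.
Proof.
move=> r0 r1 p1 Lf d0 eps0 lac c1 cm; have p0 : 0 <= p by lra.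
set F := fine _; have FE := Lp_real_fin Lf; rewrite -/F in FE.
have F0 : 0 <= F by rewrite -lee_fin -FE pow_int_ge0.
set q := 2 * eps m / d; have q0 : 0 < q by rewrite divr_gt0 // mulr_gt0.
have mw k : measurable_fun [set: measurableTypeR R] (two_windows d (eps (m + k)%N) f).
  exact: measurable_two_windows Lf _.
apply: (@le_trans _ _ (pow_int p (fun x => \sum_(k < s.+1) (q * r ^+ k) * two_windows d (eps (m + k)%N) f x)%R)).
  apply: pow_int_le => //.
  - exact: (@measurable_Avg_transform R p (Avg d f) eps c s p1 (Lp_real_Avg p1 Lf d0) (fun k _ => eps0 k)).
  - by apply: measurable_sum => k; exact: measurable_funM.
  - move=> x; apply: le_trans (Avg_transform_smooth_le s x r0 p1 Lf d0 eps0 lac c1 cm) _.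
    exact: ler_norm.
apply: le_trans (@pow_int_weighted_sum p s.+1 (fun k => q * r ^+ k) (fun k => two_windows d (eps (m + k)%N) f) (2 `^ p * 2 * F) p1 _ _ mw _) _.
- by move=> k; rewrite mulr_ge0 ?exprn_ge0 // ltW.
- by move=> k x; exact: two_windows_ge0.
- by move=> k; rewrite EFinM -FE; exact: pow_int_two_windows.
rewrite lee_fin; apply: ler_wpM2r.
  by rewrite !mulr_ge0 // powR_ge0.
apply: powR_le => //; first by apply: sumr_ge0 => k _; rewrite mulr_ge0 ?exprn_ge0 // ltW.
rewrite -mulr_sumr ler_pM2l // -div1r ler_pdivlMr ?subr_gt0 //.
have := subrX1 r s.+1; set S := \sum_(i < _) _ => rS.
have : 0 <= r ^+ s.+1 by rewrite exprn_ge0 // ltW.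
lra.
Qed.

Lemma lacunary_cvg0 (r : R) (eps : nat -> R) : 0 < r -> r < 1 ->
  (forall k, 0 < eps k) -> (forall k, eps k.+1 <= r * eps k) -> eps @ \oo --> 0.
Proof.
move=> r0 r1 eps0 lac.
have b k : eps k <= eps 0%N * r ^+ k.
  elim: k => [|k IH]; first by rewrite expr0 mulr1.
  by apply: le_trans (lac k) _; rewrite exprS mulrCA ler_pM2l.
have c : eps 0%N * r ^+ k @[k --> \oo] --> 0.
  rewrite -[X in _ --> X](mulr0 (eps 0%N)); apply: cvgM; first exact: cvg_cst.
  by apply: cvg_expr; rewrite ger0_norm // ltW.
apply: (squeeze_cvgr _ _ c); last exact: cvg_cst.
by apply: nearW => k; rewrite b ltW.
Qed.

Lemma Avg_transformD p f g (eps c : nat -> R) s x : 1 < p -> Lp_real p f -> Lp_real p g ->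
  Avg_transform eps c s (fun y => f y + g y) x =
  Avg_transform eps c s f x + Avg_transform eps c s g x.
Proof.
move=> p1 Lf Lg; have AD e : Avg e (fun y => f y + g y) x = Avg e f x + Avg e g x.
  by rewrite /Avg RintegralD ?mulrDr //; [exact: Lp_real_integrable p1 Lf|exact: Lp_real_integrable p1 Lg].
by rewrite /Avg_transform -big_split /=; apply: eq_bigr => k _; rewrite !AD; ring.
Qed.

(** After the splitting f = (f - D_d f) + D_d f, the radius d is chosen first, to
    make the transform of f - D_d f small for all coefficients, and then M, to
    make the tail on D_d f small. *)
Lemma Avg_transform_tail (r p z : R) f (eps : nat -> R) :
  0 < r -> r < 1 -> 1 < p -> Lp_real p f -> 0 < z ->
  (forall k, 0 < eps k) -> (forall k, eps k.+1 <= r * eps k) ->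
  exists M, forall (c : nat -> R) (s : nat),
    (forall k, `|c k| <= 1) -> (forall k, (k < M)%N -> c k = 0) ->
    (pow_int p (Avg_transform eps c s f) <= z%:E)%E.
Proof.
move=> r0 r1 p1 Lf z0 eps0 lac; have p0 : 0 <= p by lra.
have [C C0 HC] := Avg_transform_bound r0 r1 p1.
have ecv := lacunary_cvg0 r0 r1 eps0 lac.
pose P : R := 2 `^ p; have P0 : 0 < P by exact: powR_gt0.
have zz : 0 < z / (2 * P * C) by rewrite divr_gt0 // !mulr_gt0.
have [N HN] := Avg_cvg_Lp p1 Lf eps0 ecv zz.
pose d := eps N; have d0 : 0 < d by rewrite /d.
pose F := fine (pow_int p f); pose K : R := 2 `^ p * 2 * F.
have F0 : 0 <= F by rewrite fine_ge0 // pow_int_ge0.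
have K0 : 0 <= K by rewrite !mulr_ge0 // powR_ge0.
have [M HM] : exists M, (2 * eps M / d / (1 - r)) `^ p * K <= z / (2 * P).
  pose u k := 2 * eps k / d / (1 - r).
  have ucv : u @ \oo --> 0.
    rewrite (_ : u = fun k => (2 / d / (1 - r)) * eps k); last by apply/funext => k; rewrite /u; ring.
    by rewrite -[X in _ --> X](mulr0 (2 / d / (1 - r))); apply: cvgM => //; exact: cvg_cst.
  have Kcv : `|u k| `^ p * K @[k --> \oo] --> 0.
    rewrite -[X in _ --> X](mul0r K); apply: cvgM; last exact: cvg_cst.
    by have := cvg_powR_norm p1 ucv; rewrite normr0 powR0 // gt_eqF //; lra.
  have z2 : 0 < z / (2 * P) by rewrite divr_gt0 // mulr_gt0.
  have [M _ HM] := cvgr_le _ Kcv _ z2.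
  exists M; have := HM M (leqnn M); rewrite /= ger0_norm //.
  by rewrite /u !divr_ge0 ?mulr_ge0 ?(ltW (eps0 _)) ?(ltW d0) // subr_ge0 ltW.
exists M => c s c1 cM.
have Lg : Lp_real p (Avg d f) by exact: Lp_real_Avg.
have Lh : Lp_real p (fun x => f x - Avg d f x) by exact: Lp_realB.
have -> : Avg_transform eps c s f = (fun x => Avg_transform eps c s (fun x => f x - Avg d f x) x + Avg_transform eps c s (Avg d f) x).
  apply/funext => x; rewrite -(Avg_transformD _ _ _ _ p1 Lh Lg); congr Avg_transform.
  by apply/funext => y; rewrite subrK.
apply: le_trans (pow_intD p0 _ _) _.
- exact: measurable_Avg_transform Lh _.
- exact: measurable_Avg_transform Lg _.
have b1 : (pow_int p (Avg_transform eps c s (fun x => f x - Avg d f x)%R) <= (C * (z / (2 * P * C)))%:E)%E.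
  apply: le_trans (HC _ _ _ _ Lh eps0 lac c1) _.
  rewrite EFinM; apply: lee_wpmul2l; first by rewrite lee_fin ltW.
  apply: le_trans (HN N (leqnn N)).
  by rewrite -pow_intN; under eq_fun do rewrite opprB.
have b2 := le_trans (Avg_transform_smooth s r0 r1 p1 Lf d0 eps0 lac c1 cM) _.
have {}b2 : (pow_int p (Avg_transform eps c s (Avg d f)) <= (z / (2 * P))%:E)%E.
  by apply: b2; rewrite lee_fin.
apply: (@le_trans _ _ (P%:E * ((C * (z / (2 * P * C)))%:E + (z / (2 * P))%:E))%E).
  by apply: lee_wpmul2l; [rewrite lee_fin ltW|exact: leeD].
rewrite -EFinD -EFinM lee_fin le_eqVlt; apply/orP; left; apply/eqP.
by field; rewrite !gt_eqF.
Qed.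

Section rearrangement.
Variables (r p : R) (f : R -> R) (eps : nat -> R).
Hypotheses (r_gt0 : 0 < r) (r_lt1 : r < 1) (p_gt1 : 1 < p) (Lf : Lp_real p f).
Hypotheses (eps_gt0 : forall k, 0 < eps k) (eps_lac : forall k, eps k.+1 <= r * eps k).

Let jump k x := Avg (eps k.+1) f x - Avg (eps k) f x.

Lemma sum_rearranged (pi : nat -> nat) (n s : nat) x : injective pi ->
  (forall k, (k < n)%N -> (pi k < s)%N) ->
  \sum_(k < n) jump (pi k) x =
  \sum_(j < s) (nat_of_ord j \in [seq pi k | k <- iota 0 n])%:R * jump j x.
Proof.
move=> inj pis.
rewrite -(big_mkord xpredT (fun k => jump (pi k) x)) /index_iota subn0.
rewrite -(big_mkord xpredT (fun j => (j \in [seq pi k | k <- iota 0 n])%:R * jump j x)) /index_iota subn0.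
rewrite -(big_map pi xpredT (fun j => jump j x)).
under [RHS]eq_bigr do rewrite mulr_natl mulrb.
rewrite -[RHS]big_mkcond -[RHS]big_filter; apply: perm_big.
apply: uniq_perm.
- by rewrite map_inj_uniq // iota_uniq.
- by rewrite filter_uniq // iota_uniq.
move=> j; rewrite mem_filter mem_iota add0n /=.
have [/mapP[k]|] // := boolP (j \in _); rewrite mem_iota add0n => kn -> /=.
by rewrite pis.
Qed.

(** Subtracting a long partial sum of the telescoping series leaves a transform
    with coefficients 0 and -1, the latter at the indices that pi has not
    enumerated yet.  Those are at least M as soon as n exceeds the preimages
    of 0, ..., M - 1. *)
Lemma rearranged_cvg (pi : nat -> nat) (z : R) : bijective pi -> 0 < z ->
  exists N, forall n, (N <= n)%N ->
    (pow_int p (fun x => \sum_(k < n) jump (pi k) x - (f x - Avg (eps 0%N) f x))%R <= z%:E)%E.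
Proof.
move=> [rho piK rhoK] z0; have p0 : 0 <= p by exact: le_trans (ltW p_gt1).
pose P : R := 2 `^ p; have P0 : 0 < P by exact: powR_gt0.
have z1 : 0 < z / (2 * P) by rewrite divr_gt0 // mulr_gt0.
have [M HM] := Avg_transform_tail r_gt0 r_lt1 p_gt1 Lf z1 eps_gt0 eps_lac.
have [K HK] := Avg_cvg_Lp p_gt1 Lf eps_gt0 (lacunary_cvg0 r_gt0 r_lt1 eps_gt0 eps_lac) z1.
(* The sum bounds all the preimages rho j, j < M, at once. *)
exists (\sum_(j < M) (rho j).+1)%N => n Nn.
pose s := (K + \sum_(k < n) (pi k).+1)%N.
have pis k : (k < n)%N -> (pi k < s)%N.
  move=> kn; apply: leq_trans (leq_addl _ _).
  by rewrite (bigD1 (Ordinal kn)) //= leq_addr.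
pose c j : R := - (j \notin [seq pi k | k <- iota 0 n])%:R.
have c1 j : `|c j| <= 1 by rewrite normrN; case: (_ \notin _); rewrite ?normr1 ?normr0.
have cM j : (j < M)%N -> c j = 0.
  move=> jM; rewrite /c (_ : j \in _) ?oppr0 //.
  apply/mapP; exists (rho j); rewrite ?rhoK // mem_iota add0n /=.
  apply: leq_trans Nn; rewrite (bigD1 (Ordinal jM)) //= leq_addr //.
have E x : \sum_(k < n) jump (pi k) x - (f x - Avg (eps 0%N) f x) =
    Avg_transform eps c s f x + (Avg (eps s) f x - f x).
  rewrite (@sum_rearranged pi n s) //; last exact: can_inj piK.
  have tele : \sum_(j < s) jump j x = Avg (eps s) f x - Avg (eps 0%N) f x.
    rewrite -(big_mkord xpredT (fun j => jump j x)).
    exact: (telescope_sumr (fun j => Avg (eps j) f x)).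
  have -> : Avg_transform eps c s f x = \sum_(j < s) (nat_of_ord j \in [seq pi k | k <- iota 0 n])%:R * jump j x - \sum_(j < s) jump j x.
    rewrite -sumrB; apply: eq_bigr => j _; rewrite /c -/(jump j x).
    by case: (_ \in _) => /=; ring.
  by rewrite tele; ring.
under eq_fun do rewrite E.
have LA : Lp_real p (fun x => Avg (eps s) f x - f x) by exact: (Lp_realB p0 (Lp_real_Avg p_gt1 Lf (eps_gt0 s)) Lf).
apply: le_trans (pow_intD p0 _ _) _.
- exact: measurable_Avg_transform Lf _.
- by case: LA.
apply: (@le_trans _ _ (P%:E * ((z / (2 * P))%:E + (z / (2 * P))%:E))%E).
  apply: lee_wpmul2l; first by rewrite lee_fin ltW.
  apply: leeD; first exact: HM.
  by apply: HK; exact: leq_addr.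
rewrite -EFinD -EFinM lee_fin le_eqVlt; apply/orP; left; apply/eqP.
by field; rewrite gt_eqF.
Qed.

End rearrangement.

End smoothing.

(** * Complex-valued functions *)

Section complex_valued.
Variable R : realType.
Local Notation mu := (@lebesgue_measure R).
Implicit Types (f g u : measurableTypeR R -> R[i]) (p x : R).

Local Notation ReF f := (fun x => complex.Re (f x)).
Local Notation ImF f := (fun x => complex.Im (f x)).

Lemma normcE (z : R[i]) : normc z = Num.sqrt (complex.Re z ^+ 2 + complex.Im z ^+ 2).
Proof. by case: z. Qed.

Lemma normc_ge0 (z : R[i]) : 0 <= normc z.
Proof. by rewrite normcE sqrtr_ge0. Qed.

Lemma Re_le_normc (z : R[i]) : `|complex.Re z| <= normc z.
Proof.
rewrite normcE -sqrtr_sqr ler_sqrt; first by rewrite lerDl sqr_ge0.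
by rewrite addr_ge0 ?sqr_ge0.
Qed.

Lemma Im_le_normc (z : R[i]) : `|complex.Im z| <= normc z.
Proof.
rewrite normcE -sqrtr_sqr ler_sqrt; first by rewrite lerDr sqr_ge0.
by rewrite addr_ge0 ?sqr_ge0.
Qed.

Lemma normc_le (z : R[i]) : normc z <= `|complex.Re z| + `|complex.Im z|.
Proof.
rewrite normcE -[leRHS]ger0_norm ?addr_ge0 // -sqrtr_sqr ler_sqrt ?sqr_ge0 //.
have -> : complex.Re z ^+ 2 = `|complex.Re z| ^+ 2 by rewrite real_normK ?num_real.
have -> : complex.Im z ^+ 2 = `|complex.Im z| ^+ 2 by rewrite real_normK ?num_real.
have : 0 <= `|complex.Re z| * `|complex.Im z| by rewrite mulr_ge0.
rewrite sqrrD; set A := `|_|; set B := `|_|; lra.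
Qed.

Lemma measurable_normc f : cmeasurable f ->
  measurable_fun [set: measurableTypeR R] (fun x => normc (f x)).
Proof.
move=> [mr mi].
rewrite (_ : (fun x => _) = (@Num.sqrt R) \o (fun x => complex.Re (f x) ^+ 2 + complex.Im (f x) ^+ 2)); last first.
  by apply/funext => x; rewrite /= normcE.
apply: measurableT_comp; first exact: (continuous_measurable_fun (@sqrt_continuous R)).
by apply: measurable_funD; exact: measurable_funX.
Qed.

Lemma cLnormE p f : cLnorm p f = (pow_int p (fun x => normc (f x)) `^ p^-1)%E.
Proof.
by rewrite /cLnorm unlock.
Qed.

Lemma pow_int_normc_le p f : 0 <= p -> cmeasurable f ->
  (pow_int p (fun x => normc (f x)) <=
    (2 `^ p)%:E * (pow_int p (ReF f) + pow_int p (ImF f)))%E.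
Proof.
move=> p0 mf; have [mr mi] := mf.
have mnr : measurable_fun [set: measurableTypeR R] (fun x => `|complex.Re (f x)|) by exact: measurableT_comp.
have mni : measurable_fun [set: measurableTypeR R] (fun x => `|complex.Im (f x)|) by exact: measurableT_comp.
apply: (@le_trans _ _ (pow_int p (fun x => `|complex.Re (f x)| + `|complex.Im (f x)|)%R)).
  apply: pow_int_le => //; first exact: measurable_normc.
    exact: measurable_funD.
  by move=> x; rewrite ger0_norm ?normc_ge0 // ger0_norm ?addr_ge0 // normc_le.
apply: le_trans (pow_intD p0 mnr mni) _.
by rewrite !pow_int_norm.
Qed.

Lemma cLfunP p f : 0 < p -> cLfun p f <-> Lp_real p (ReF f) /\ Lp_real p (ImF f).
Proof.
move=> p0; have p0' := ltW p0; have pi : p^-1 != 0 by rewrite invr_neq0 // gt_eqF.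
split=> [[mf]|[[mr rp] [mi ip]]].
  have [mr mi] := mf; have mn := measurable_normc mf.
  rewrite cLnormE => fp.
  have {}fp : (pow_int p (fun x => normc (f x)) < +oo)%E.
    rewrite ltey; apply/eqP => E; move: fp.
    by rewrite E poweRyr // ltxx.
  split.
    split; first exact: mr.
    apply: le_lt_trans fp; apply: (pow_int_le p0' mr mn) => x.
    rewrite [leRHS]ger0_norm; [exact: Re_le_normc|exact: normc_ge0].
  split; first exact: mi.
  apply: le_lt_trans fp; apply: (pow_int_le p0' mi mn) => x.
  rewrite [leRHS]ger0_norm; [exact: Im_le_normc|exact: normc_ge0].
split; first by split.
rewrite cLnormE; apply: poweR_lty.
apply: le_lt_trans (pow_int_normc_le p0' _) _; first by split.
apply: lte_mul_pinfty; last exact: lte_add_pinfty rp ip.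
  by rewrite lee_fin powR_ge0.
exact: isT.
Qed.

Lemma cLnorm_cvg0 p (u : nat -> measurableTypeR R -> R[i]) : 0 < p ->
  (forall n, cmeasurable (u n)) ->
  (forall z, 0 < z -> exists N, forall n, (N <= n)%N ->
     (pow_int p (ReF (u n)) <= z%:E)%E /\ (pow_int p (ImF (u n)) <= z%:E)%E) ->
  cLnorm p (u n) @[n --> \oo] --> 0%E.
Proof.
move=> p0 mu_ Hu; have P0 : 0 < 2 `^ p :> R by exact: powR_gt0.
have bound (e : R) : 0 < e -> exists N, forall n, (N <= n)%N -> (cLnorm p (u n) <= e%:E)%E.
  move=> e0; have ep : 0 < e `^ p by exact: powR_gt0.
  pose z := e `^ p / (2 `^ p * 2).
  have z0 : 0 < z by rewrite divr_gt0 // mulr_gt0.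
  have [N HN] := Hu z z0; exists N => n /HN[h1 h2]; rewrite cLnormE.
  have H : (pow_int p (fun x => normc (u n x)) <= (e `^ p)%:E)%E.
    apply: le_trans (pow_int_normc_le (ltW p0) (mu_ n)) _.
    apply: (@le_trans _ _ ((2 `^ p)%:E * (z%:E + z%:E))%E).
      by apply: lee_wpmul2l; [rewrite lee_fin; exact: ltW P0|exact: leeD h1 h2].
    rewrite -EFinD -EFinM lee_fin le_eqVlt; apply/orP; left; apply/eqP.
    by rewrite /z; field; rewrite gt_eqF.
  have -> : e%:E = ((e `^ p)%:E `^ p^-1)%E.
    by rewrite poweR_EFin -powRrM mulfV ?powRr1 ?(ltW e0) // gt_eqF.
  apply: gt0_ler_poweR => //; first by rewrite invr_ge0 ltW.
  - by rewrite in_itv /= leey andbT pow_int_ge0.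
  - by rewrite in_itv /= leey andbT lee_fin powR_ge0.
have ge0 n : (0 <= cLnorm p (u n))%E by rewrite cLnormE poweR_ge0.
apply/fine_cvgP; split.
  have [N HN] := bound 1 ltr01; exists N => // n /= Nn.
  by rewrite ge0_fin_numE //; apply: le_lt_trans (HN n Nn) _; rewrite ltry.
apply/cvgrPdist_le => e e0; have [N HN] := bound e e0.
exists N => // n /= Nn; have h := HN n Nn.
rewrite sub0r normrN ger0_norm ?fine_ge0 // -lee_fin fineK //.
by rewrite ge0_fin_numE //; apply: le_lt_trans h _; rewrite ltry.
Qed.

Lemma Avg_convolution p e (g : R -> R) x : 1 < p -> Lp_real p g ->
  \int[mu]_y ((2 * e)^-1 * \1_(`[- e, e]) (x - y) * g y) = Avg e g x.
Proof.
move=> p1 Lg; rewrite /Avg -RintegralZl //; last exact: Lp_real_integrable p1 Lg.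
rewrite [RHS]Rintegral_mkcond; apply: eq_Rintegral => y _.
rewrite patchE /= indicE.
have -> : ((x - y) \in `[(- e)%R, e]%classic) = (y \in `[(x - e)%R, (x + e)%R]%classic).
  by apply/idP/idP; rewrite !inE /= !in_itv /= => /andP[? ?]; apply/andP; split; lra.
by case: ifP => _; rewrite ?mulr1 // mulr0 mul0r.
Qed.

Lemma Re_D p e f x : 1 < p -> cLfun p f -> complex.Re (D e f x) = Avg e (ReF f) x.
Proof.
move=> p1 fp; have p0 : 0 < p by lra.
have [Lr Li] := (cLfunP _ p0).1 fp.
rewrite -(Avg_convolution e x p1 Lr) /D /convolution /=.
apply: eq_Rintegral => y _; rewrite /phi; case: (f y) => a b /=; ring.
Qed.

Lemma Im_D p e f x : 1 < p -> cLfun p f -> complex.Im (D e f x) = Avg e (ImF f) x.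
Proof.
move=> p1 fp; have p0 : 0 < p by lra.
have [Lr Li] := (cLfunP _ p0).1 fp.
rewrite -(Avg_convolution e x p1 Li) /D /convolution /=.
apply: eq_Rintegral => y _; rewrite /phi; case: (f y) => a b /=; ring.
Qed.

Lemma ReB (z w : R[i]) : complex.Re (z - w) = complex.Re z - complex.Re w.
Proof. by case: z; case: w. Qed.

Lemma ImB (z w : R[i]) : complex.Im (z - w) = complex.Im z - complex.Im w.
Proof. by case: z; case: w. Qed.

Lemma cLfunB p f g : 0 < p -> cLfun p f -> cLfun p g -> cLfun p (f - g).
Proof.
move=> p0 /(cLfunP _ p0)[fr fi] /(cLfunP _ p0)[gr gi]; apply/(cLfunP _ p0); split.
  rewrite (_ : (fun x => _) = (fun x => complex.Re (f x) - complex.Re (g x))); last first.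
    by apply/funext => x; exact: ReB.
  by apply: Lp_realB => //; exact: ltW.
rewrite (_ : (fun x => _) = (fun x => complex.Im (f x) - complex.Im (g x))); last first.
  by apply/funext => x; exact: ImB.
by apply: Lp_realB => //; exact: ltW.
Qed.

Lemma cLfun_D p e f : 1 < p -> 0 < e -> cLfun p f -> cLfun p (D e f).
Proof.
move=> p1 e0 fp; have p0 : 0 < p by lra.
have [Lr Li] := (cLfunP _ p0).1 fp; apply/(cLfunP _ p0); split.
  rewrite (_ : (fun x => _) = Avg e (ReF f)); first exact: Lp_real_Avg.
  by apply/funext => x; exact: Re_D fp.
rewrite (_ : (fun x => _) = Avg e (ImF f)); first exact: Lp_real_Avg.
by apply/funext => x; exact: Im_D fp.
Qed.

Lemma Re_series (u : nat -> measurableTypeR R -> R[i]) n x :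
  complex.Re (series u n x) = \sum_(k < n) complex.Re (u k x).
Proof.
rewrite /series /= big_mkord; elim: n => [|n IH]; first by rewrite !big_ord0.
rewrite !big_ord_recr /= -IH -[X in complex.Re X]/(_ x + _ x).
by case: (_ x) => a b; case: (_ x).
Qed.

Lemma Im_series (u : nat -> measurableTypeR R -> R[i]) n x :
  complex.Im (series u n x) = \sum_(k < n) complex.Im (u k x).
Proof.
rewrite /series /= big_mkord; elim: n => [|n IH]; first by rewrite !big_ord0.
rewrite !big_ord_recr /= -IH -[X in complex.Im X]/(_ x + _ x).
by case: (_ x) => a b; case: (_ x).
Qed.

Lemma cLfun_series p (u : nat -> measurableTypeR R -> R[i]) n : 0 < p ->
  (forall k, cLfun p (u k)) -> cLfun p (series u n).
Proof.
move=> p0 Lu; rewrite /series /=; elim: n => [|n IH].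
  by rewrite big_geq // -(subrr (u 0%N)); exact: cLfunB.
rewrite big_nat_recr //=; set S := \sum_(0 <= k < n) u k.
have -> : S + u n = S - ((u n - u n) - u n) by rewrite subrr sub0r opprK.
exact: (cLfunB p0 IH (cLfunB p0 (cLfunB p0 (Lu n) (Lu n)) (Lu n))).
Qed.

End complex_valued.

(* The sequences are indexed from 0: [eps k] is $\epsilon_{k+1}$. *)
Theorem theorem6p1 (R : realType) (r : R) (r_gt0 : 0 < r) (r_lt1 : r < 1)
    (eps : nat -> R) (eps_gt0 : forall k, 0 < eps k)
    (eps_lacunary : forall k, eps k.+1 <= r * eps k)
    (p : R) (p_gt1 : 1 < p)
    (f : measurableTypeR R -> R[i]) (fLp : cLfun p f) :
  unconditionally_convergent_in_Lp p
    (fun k => D (eps k.+1) f - D (eps k) f).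
Proof.
have p0 : 0 < p by exact: lt_trans p_gt1.
have [Lr Li] := (cLfunP _ p0).1 fLp.
have cLD k : cLfun p (D (eps k) f) by exact: cLfun_D.
have cLu k : cLfun p (D (eps k.+1) f - D (eps k) f) by exact: cLfunB.
split=> // pi bij; exists (f - D (eps 0%N) f); first exact: cLfunB.
set u := _ \o pi.
have ReE n x : complex.Re ((series u n - (f - D (eps 0%N) f)) x) =
    \sum_(k < n) (Avg (eps (pi k).+1) (fun x => complex.Re (f x)) x - Avg (eps (pi k)) (fun x => complex.Re (f x)) x)
    - (complex.Re (f x) - Avg (eps 0%N) (fun x => complex.Re (f x)) x).
  rewrite [LHS]ReB Re_series [X in _ - X]ReB (Re_D _ _ p_gt1 fLp); congr (_ - _).
  by apply: eq_bigr => k _; rewrite [LHS]ReB !(Re_D _ _ p_gt1 fLp).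
have ImE n x : complex.Im ((series u n - (f - D (eps 0%N) f)) x) =
    \sum_(k < n) (Avg (eps (pi k).+1) (fun x => complex.Im (f x)) x - Avg (eps (pi k)) (fun x => complex.Im (f x)) x)
    - (complex.Im (f x) - Avg (eps 0%N) (fun x => complex.Im (f x)) x).
  rewrite [LHS]ImB Im_series [X in _ - X]ImB (Im_D _ _ p_gt1 fLp); congr (_ - _).
  by apply: eq_bigr => k _; rewrite [LHS]ImB !(Im_D _ _ p_gt1 fLp).
apply: (@cLnorm_cvg0 R p (fun n => series u n - (f - D (eps 0%N) f)) p0).
  move=> n; have Ls : cLfun p (series u n) by apply: cLfun_series p0 _ => k; exact: cLu.
  by case: (cLfunB p0 Ls (cLfunB p0 fLp (cLD 0%N))).
move=> z z0.
have [N1 H1] := rearranged_cvg r_gt0 r_lt1 p_gt1 Lr eps_gt0 eps_lacunary bij z0.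
have [N2 H2] := rearranged_cvg r_gt0 r_lt1 p_gt1 Li eps_gt0 eps_lacunary bij z0.
exists (maxn N1 N2) => n; rewrite geq_max => /andP[n1 n2]; split.
  by under eq_fun do rewrite ReE; exact: H1.
by under eq_fun do rewrite ImE; exact: H2.
Qed.
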